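(* Let $f:\{-1,1\}\to\mathbb{C}$. Then $$m\big(|f(\Psi_1)|^2\log|f(\Psi_1)|^2\big)-m\big(|f(\Psi_1)|^2\big)\log m\big(|f(\Psi_1)|^2\big)\le 2\log 4\cdot\big\|\mathcal{D}_\cdot f(\Psi_1)\big\|^2_{L^2(\mathbb{R}_+)\otimes L^2(\mathcal{C})}.$$
   Context: $L^2(\mathbb{R}_+)$ is the complex $L^2$ space for Lebesgue measure (inner products linear in the second variable), with complex conjugation $J$. For $h\in L^2(\mathbb{R}_+^n)$ its anti-symmetrization is $\hat h(t_1,\dots,t_n)=\frac1{n!}\sum_{\sigma\in S_n}\mathrm{sgn}(\sigma)h(t_{\sigma(1)},\dots,t_{\sigma(n)})$. $\Lambda_n$ is the space of anti-symmetric functions in $L^2(\mathbb{R}_+^n)$ with inner product $\langle f,g\rangle_{\Lambda_n}=n!\int\overline{f}g\,d\mathbf{x}$, and $\Lambda_0=\mathbb{C}$. $\Gamma_a=\bigoplus_{n\ge0}\Lambda_n$ is the anti-symmetric Fock space (Hilbert direct sum) with vacuum vector $\Omega=1\in\Lambda_0$. For $z\in L^2(\mathbb{R}_+)$, $b^*(z)$ is the bounded operator with $b^*(z)w=\widehat{z\otimes w}$ for $w\in\Lambda_n$, $b(z)$ is its adjoint, and $\Psi(z)=b^*(z)+b(Jz)$. $\mathcal{C}$ is the von Neumann algebra generated by $\{\Psi(z)\}$, and $m(u)=\langle\Omega,u\Omega\rangle$ is a faithful normal tracial state on it; $L^2(\mathcal{C})$ is the completion of $\mathcal{C}$ for the inner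 product $m(u^*v)$. The map $u\mapsto u\Omega$ extends to a unitary $L^2(\mathcal{C})\to\Gamma_a$, and for $f\in\Lambda_n$, $J_n(f)\in L^2(\mathcal{C})$ denotes the element mapped to $f$ by this unitary; $J_{-1}(\cdot)=0$. On finite sums of $J_n(v_n)$, $v_n\in\Lambda_n$, $\mathcal{D}$ is given by linearity and $\mathcal{D}_t(J_n(v_n))=nJ_{n-1}(v_n(t,\cdot))$, with values in $L^2(\mathbb{R}_+)\otimes L^2(\mathcal{C})\cong L^2(\mathbb{R}_+;L^2(\mathcal{C}))$. $\Psi_1=\Psi(\mathbf{1}_{[0,1]})=J_1(\mathbf{1}_{[0,1]})$ is self-adjoint with $\Psi_1^2=1$ and spectrum $\{-1,1\}$; functions of $\Psi_1$ are defined by functional calculus, with the convention $0\log0=0$. *)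

(* Defs.v *)
From HB Require Import structures.
From mathcomp Require Import all_boot all_order all_algebra perm complex.
From mathcomp Require Import all_classical all_reals all_analysis measurable_realfun.
From mathcomp Require Import ring lra.

Set Implicit Arguments.
Unset Strict Implicit.
Unset Printing Implicit Defensive.

Import Order.TTheory GRing.Theory Num.Theory.
Import numFieldNormedType.Exports.

Local Open Scope classical_set_scope.
Local Open Scope complex_scope.
Local Open Scope ring_scope.

(* Inner products are linear in the second variable. *)

HB.mixin Record Lmodule_isInner (R : realType) V of GRing.Lmodule R[i] V := {
  dot : V -> V -> R[i];
  dotPr : forall u (a : R[i]) v w, dot u (a *: v + w) = a * dot u v + dot u w;
  dotC : forall u v, dot v u = conjc (dot u v);
  dot_ge0 : forall u, 0 <= dot u u;
  dot_eq0 : forall u, dot u u = 0 -> u = 0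
}.

#[short(type="innerType")]
HB.structure Definition Inner (R : realType) :=
  {V of GRing.Lmodule R[i] V & Lmodule_isInner R V}.

Definition hnorm {R : realType} {H : innerType R} (u : H) : R :=
  Num.sqrt (complex.Re (dot u u)).

Definition hcvg {R : realType} {H : innerType R} (u : nat -> H) (l : H) :=
  (fun n => hnorm (u n - l)) @ \oo --> (0 : R).

Definition hcauchy {R : realType} {H : innerType R} (u : nat -> H) :=
  forall e : R, 0 < e ->
    exists N, forall p q, (N <= p)%N -> (N <= q)%N -> hnorm (u p - u q) < e.

HB.mixin Record Inner_isHilbert (R : realType) V of Inner R V := {
  hilbert_complete : forall u : nat -> V, hcauchy u -> exists l, hcvg u l
}.

#[short(type="hilbertType")]
HB.structure Definition Hilbert (R : realType) :=
  {V of Inner R V & Inner_isHilbert R V}.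

Section operators.
Context {R : realType} {H : innerType R}.
Implicit Types (S T : H -> H) (A M : set (H -> H)).

Definition is_adjoint S T := forall u v, dot (S u) v = dot u (T v).

Definition adj T : H -> H := xget (fun=> 0) [set S | is_adjoint S T].

(* On a Hilbert space the last conjunct follows from the first two by the Riesz
   representation theorem; it is spelled out because the completeness of the
   Fock space below is not recorded in its type. *)
Definition bounded_operators : set (H -> H) := [set T |
  [/\ linear T,
      exists K : R, forall u, hnorm (T u) <= K * hnorm u
    & exists S, is_adjoint S T]].

Definition commutant A : set (H -> H) := [set T |
  bounded_operators T /\ forall S, A S -> T \o S = S \o T].

Definition von_neumann_algebra M :=
  [/\ M `<=` bounded_operators,
      forall T, M T -> M (adj T)
    & commutant (commutant M) = M].

Definition von_neumann_generated A : set (H -> H) :=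
  \bigcap_(M in [set M | von_neumann_algebra M /\ A `<=` M]) M.

(* For a finite set D of reals and a self-adjoint T with spectrum contained in
   D, the functional calculus of T is the unique unital *-homomorphism from the
   algebra of all functions on D that maps the inclusion of D in the complex
   numbers to T. *)
Definition is_functional_calculus (D : set R) T
    (Phi : (D -> R[i]) -> H -> H) :=
  (forall f, bounded_operators (Phi f)) /\
  (forall (a : R[i]) f g, Phi (fun x => a * f x + g x) = a *: Phi f + Phi g) /\
  (forall f g, Phi (fun x => f x * g x) = Phi f \o Phi g) /\
  Phi (fun=> 1) = id /\
  (forall f, is_adjoint (Phi (fun x => conjc (f x))) (Phi f)) /\
  Phi (fun x => (\val x)%:C) = T.

Definition functional_calculus (D : set R) T : (D -> R[i]) -> H -> H :=
  xget (fun _ => fun=> 0) [set Phi | is_functional_calculus T Phi].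

End operators.

Section lebesgue_plus.
Context {R : realType}.

Local Notation RT := (measurableTypeR R).

Lemma sigma_finite_mrestr d (T : measurableType d)
    (mu : {sigma_finite_measure set T -> \bar R}) (D : set T)
    (mD : measurable D) :
  sigma_finite [set: T] (mrestr mu mD).
Proof.
have [F TF Ffin] := sigma_finiteT mu.
exists F => // i; have [mF Foo] := Ffin i; split => //.
rewrite /mrestr (le_lt_trans _ Foo)// le_measure ?inE//.
exact: measurableI.
Qed.

(* Lebesgue measure on the half-line, as a measure on R carried by [0, +oo[. *)
Definition lebp : set RT -> \bar R :=
  mrestr (@lebesgue_measure R) (measurable_itv `[(0 : R), +oo[%R).

HB.instance Definition _ := Measure.on lebp.
HB.instance Definition _ := @Measure_isSigmaFinite.Build _ RT R lebp
  (sigma_finite_mrestr _ _).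

Definition cons_pair n (p : RT * n.-tuple RT) : n.+1.-tuple RT :=
  [the n.+1.-tuple RT of p.1 :: p.2].

Lemma measurable_cons_pair n : measurable_fun setT (@cons_pair n).
Proof. exact: measurable_cons. Qed.

Definition lebp_cons n (mu : {sigma_finite_measure set (n.-tuple RT) -> \bar R})
  : set (n.+1.-tuple RT) -> \bar R := pushforward (lebp \x mu)%E (@cons_pair n).

HB.instance Definition _ n
    (mu : {sigma_finite_measure set (n.-tuple RT) -> \bar R}) :=
  Measure.copy (lebp_cons mu)
    (@measure_function_pushforward__canonical__measure_function_Measure
       _ _ _ _ _ (lebp \x mu)%E _ (@measurable_cons_pair n)).

Lemma sigma_finite_lebp_cons n
    (mu : {sigma_finite_measure set (n.-tuple RT) -> \bar R}) :
  sigma_finite [set: n.+1.-tuple RT] (lebp_cons mu).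
Proof.
have /sigma_finiteP[F [TF ndF Foo]] :=
  sigma_finiteT (@lebp : {sigma_finite_measure set RT -> \bar R}).
have /sigma_finiteP[G [TG ndG Goo]] := sigma_finiteT mu.
exists (fun i => [set x | F i (thead x) /\ G i [tuple of behead x]]).
  apply/seteqP; split => // x _.
  have [i _ Fi] : (\bigcup_i F i) (thead x) by rewrite -TF.
  have [j _ Gj] : (\bigcup_i G i) [tuple of behead x] by rewrite -TG.
  exists (maxn i j) => //; split.
    by move: Fi; exact/subsetPset/ndF/leq_maxl.
  by move: Gj; exact/subsetPset/ndG/leq_maxr.
move=> i; have [mF Fi] := Foo i; have [mG Gi] := Goo i; split.
  apply: measurableI.
    rewrite -[X in measurable X]setTI.
    exact: (measurable_tnth ord0).
  rewrite -[X in measurable X]setTI.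
  exact: measurable_behead.
rewrite /lebp_cons /pushforward [X in ((_ \x _)%E X < _)%E](_ : _ = F i `*` G i).
  by rewrite product_measure1E// lte_mul_pinfty// ge0_fin_numE.
apply/seteqP; split=> -[x y] /=.
  by rewrite (_ : [tuple of _] = y)//; exact/val_inj.
by rewrite (_ : [tuple of _] = y)//; exact/val_inj.
Qed.

HB.instance Definition _ n
    (mu : {sigma_finite_measure set (n.-tuple RT) -> \bar R}) :=
  @Measure_isSigmaFinite.Build _ _ _ (lebp_cons mu) (sigma_finite_lebp_cons mu).

(* Lebesgue measure on the n-th power of the half-line, as the n-fold product
   of lebp; the library has the sigma-algebra on tuples, but no measure. *)
Fixpoint lebpn n : {sigma_finite_measure set (n.-tuple RT) -> \bar R} :=
  match n return {sigma_finite_measure set (n.-tuple RT) -> \bar R} with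
  | 0 => [the {sigma_finite_measure set (0.-tuple RT) -> \bar R} of
          \d_ ([tuple] : 0.-tuple RT)]
  | m.+1 => [the {sigma_finite_measure set (m.+1.-tuple RT) -> \bar R} of
             lebp_cons (lebpn m)]
  end.

End lebesgue_plus.

Section complex_functions.
Context {R : realType}.

Definition abs2 (z : R[i]) : R := complex.Re z ^+ 2 + complex.Im z ^+ 2.

Lemma abs2_ge0 z : 0 <= abs2 z.
Proof. by rewrite addr_ge0// sqr_ge0. Qed.

Lemma abs2_eq0 z : (abs2 z == 0) = (z == 0).
Proof. by case: z => a b; rewrite /abs2/= paddr_eq0 ?sqr_ge0// !sqrf_eq0 eq_complex/=. Qed.

Lemma abs2D z w : abs2 (z + w) <= 2 * abs2 z + 2 * abs2 w.
Proof.
case: z w => a b [c d]; rewrite /abs2/= -subr_ge0.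
rewrite [leRHS](_ : _ = (a - c) ^+ 2 + (b - d) ^+ 2); last by ring.
by rewrite addr_ge0// sqr_ge0.
Qed.

Lemma abs2M z w : abs2 (z * w) = abs2 z * abs2 w.
Proof. by case: z w => a b [c d]; rewrite /abs2/=; ring. Qed.

Lemma normRe_conjM z w : `|complex.Re (conjc z * w)| <= abs2 z + abs2 w.
Proof.
case: z w => a b [c d]; rewrite /abs2/= ler_norml.
have := (sqr_ge0 (a + c), sqr_ge0 (b + d), sqr_ge0 (a - c), sqr_ge0 (b - d)).
have := (sqr_ge0 a, sqr_ge0 b, sqr_ge0 c, sqr_ge0 d).
by move=> [] [] [] ? ? ? ? [] [] [] ? ? ? ?; apply/andP; split; nra.
Qed.

Lemma normIm_conjM z w : `|complex.Im (conjc z * w)| <= abs2 z + abs2 w.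
Proof.
case: z w => a b [c d]; rewrite /abs2/= ler_norml.
have := (sqr_ge0 (a + d), sqr_ge0 (b + c), sqr_ge0 (a - d), sqr_ge0 (b - c)).
have := (sqr_ge0 a, sqr_ge0 b, sqr_ge0 c, sqr_ge0 d).
by move=> [] [] [] ? ? ? ? [] [] [] ? ? ? ?; apply/andP; split; nra.
Qed.

Section measure.
Context d (T : measurableType d) (mu : {measure set T -> \bar R}).
Implicit Types f g h : T -> R[i].

Definition cmeasurable f :=
  measurable_fun setT (fun x => complex.Re (f x)) /\
  measurable_fun setT (fun x => complex.Im (f x)).

Definition square_integrable f :=
  cmeasurable f /\ (\int[mu]_x (abs2 (f x))%:E < +oo)%E.

Definition cintegral f : R[i] :=
  Complex (\int[mu]_x complex.Re (f x)) (\int[mu]_x complex.Im (f x)).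

Definition cintegrable f :=
  mu.-integrable setT (EFin \o (fun x => complex.Re (f x))) /\
  mu.-integrable setT (EFin \o (fun x => complex.Im (f x))).

Lemma cmeasurableD f g : cmeasurable f -> cmeasurable g ->
  cmeasurable (fun x => f x + g x).
Proof.
move=> [mf1 mf2] [mg1 mg2]; split.
  rewrite (_ : (fun _ => _) =
    (fun x => complex.Re (f x)) \+ (fun x => complex.Re (g x))).
    exact: measurable_funD.
  by apply/funext => x/=; case: (f x) (g x) => ? ? [].
rewrite (_ : (fun _ => _) =
  (fun x => complex.Im (f x)) \+ (fun x => complex.Im (g x))).
  exact: measurable_funD.
by apply/funext => x/=; case: (f x) (g x) => ? ? [].
Qed.

Lemma cmeasurableM f g : cmeasurable f -> cmeasurable g ->
  cmeasurable (fun x => f x * g x).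
Proof.
move=> [mf1 mf2] [mg1 mg2]; split.
  rewrite (_ : (fun _ => _) =
    ((fun x => complex.Re (f x)) \* (fun x => complex.Re (g x))) \-
    ((fun x => complex.Im (f x)) \* (fun x => complex.Im (g x)))).
    by apply: measurable_funB; exact: measurable_funM.
  by apply/funext => x/=; case: (f x) (g x) => ? ? [].
rewrite (_ : (fun _ => _) =
  ((fun x => complex.Re (f x)) \* (fun x => complex.Im (g x))) \+
  ((fun x => complex.Im (f x)) \* (fun x => complex.Re (g x)))).
  by apply: measurable_funD; exact: measurable_funM.
by apply/funext => x/=; case: (f x) (g x) => ? ? [].
Qed.

Lemma cmeasurable_conj f : cmeasurable f -> cmeasurable (fun x => conjc (f x)).
Proof.
move=> [mf1 mf2]; split.
  by rewrite (_ : (fun _ => _) = (fun x => complex.Re (f x)))//;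
    apply/funext => x; case: (f x).
rewrite (_ : (fun _ => _) = \- (fun x => complex.Im (f x)))//.
  exact: measurableT_comp.
by apply/funext => x/=; case: (f x).
Qed.

Lemma cmeasurable_cst a : cmeasurable (fun=> a).
Proof. by split; exact: measurable_cst. Qed.

Lemma measurable_abs2 f : cmeasurable f ->
  measurable_fun setT (fun x => abs2 (f x)).
Proof.
by move=> [mf1 mf2]; apply: measurable_funD; exact: measurable_funX.
Qed.

Lemma measurable_eabs2 f : cmeasurable f ->
  measurable_fun setT (fun x => (abs2 (f x))%:E).
Proof. by move=> mf; apply/measurable_EFinP/measurable_abs2. Qed.

Lemma int_abs2_ge0 f : (0 <= \int[mu]_x (abs2 (f x))%:E)%E.
Proof. by apply: integral_ge0 => x _; rewrite lee_fin abs2_ge0. Qed.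

Lemma int_abs2D f g : cmeasurable f -> cmeasurable g ->
  (\int[mu]_x (abs2 (f x + g x))%:E <=
   2%:E * \int[mu]_x (abs2 (f x))%:E + 2%:E * \int[mu]_x (abs2 (g x))%:E)%E.
Proof.
move=> mf mg.
have nf x : setT x -> (0 <= (abs2 (f x))%:E)%E by rewrite lee_fin abs2_ge0.
have ng x : setT x -> (0 <= (abs2 (g x))%:E)%E by rewrite lee_fin abs2_ge0.
have mef := measurable_eabs2 mf; have meg := measurable_eabs2 mg.
rewrite -!ge0_integralZl_EFin// -ge0_integralD//=; last 4 first.
- by move=> x _; rewrite mule_ge0// lee_fin abs2_ge0.
- exact: measurable_funeM.
- by move=> x _; rewrite mule_ge0// lee_fin abs2_ge0.
- exact: measurable_funeM.
apply: ge0_le_integral => //=.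
- by move=> x _; rewrite lee_fin abs2_ge0.
- exact/measurable_eabs2/cmeasurableD.
- by apply: emeasurable_funD; exact: measurable_funeM.
- by move=> x _; rewrite -!EFinM -EFinD lee_fin abs2D.
Qed.

Lemma int_abs2Z a f : cmeasurable f ->
  (\int[mu]_x (abs2 (a * f x))%:E =
   (abs2 a)%:E * \int[mu]_x (abs2 (f x))%:E)%E.
Proof.
move=> mf; rewrite -ge0_integralZl_EFin ?abs2_ge0//=.
- by apply: eq_integral => x _; rewrite abs2M.
- by move=> x _; rewrite lee_fin abs2_ge0.
- exact: measurable_eabs2.
Qed.

Lemma square_integrableD f g : square_integrable f -> square_integrable g ->
  square_integrable (fun x => f x + g x).
Proof.
move=> [mf f2] [mg g2]; split; first exact: cmeasurableD.
rewrite (le_lt_trans (int_abs2D mf mg))// lte_add_pinfty// lte_mul_pinfty//.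
Qed.

Lemma square_integrableZ a f : square_integrable f ->
  square_integrable (fun x => a * f x).
Proof.
move=> [mf f2]; split; first exact: cmeasurableM (cmeasurable_cst a) mf.
by rewrite int_abs2Z// lte_mul_pinfty// ?lee_fin ?abs2_ge0.
Qed.

Lemma square_integrable0 : square_integrable (fun=> 0).
Proof.
split; first exact: cmeasurable_cst.
rewrite (eq_integral (cst 0%E)) ?integral0// => x _.
by rewrite /abs2/= expr0n/= addr0.
Qed.

Lemma integrable_dominated (h : T -> R) f g :
  square_integrable f -> square_integrable g ->
  measurable_fun setT h -> (forall x, `|h x| <= abs2 (f x) + abs2 (g x)) ->
  mu.-integrable setT (EFin \o h).
Proof.
move=> [mf f2] [mg g2] mh hfg.
apply: (@le_integrable _ _ _ mu _ _ _
    (fun x => (abs2 (f x) + abs2 (g x))%:E)) => //.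
- exact/measurable_EFinP.
- move=> x _ /=; rewrite lee_fin (le_trans (hfg x))// ler_norm//.
- apply/integrableP; split.
    apply/measurable_EFinP/measurable_funD; exact: measurable_abs2.
  rewrite (eq_integral (fun x => (abs2 (f x))%:E + (abs2 (g x))%:E)%E); last first.
    by move=> x _; rewrite gee0_abs ?EFinD// lee_fin addr_ge0 ?abs2_ge0.
  rewrite ge0_integralD//; last 4 first.
  + by move=> x _; rewrite lee_fin abs2_ge0.
  + exact: measurable_eabs2.
  + by move=> x _; rewrite lee_fin abs2_ge0.
  + exact: measurable_eabs2.
  by rewrite lte_add_pinfty.
Qed.

Lemma cintegrable_conjM f g : square_integrable f -> square_integrable g ->
  cintegrable (fun x => conjc (f x) * g x).
Proof.
move=> f2 g2; have [m1 m2] := cmeasurableM (cmeasurable_conj f2.1) g2.1.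
split.
  by apply: (integrable_dominated f2 g2) => // x; exact: normRe_conjM.
by apply: (integrable_dominated f2 g2) => // x; exact: normIm_conjM.
Qed.

Lemma cintegralP a f g : cintegrable f -> cintegrable g ->
  cintegral (fun x => a * f x + g x) = a * cintegral f + cintegral g.
Proof.
move=> [f1 f2] [g1 g2]; case: a => p q; rewrite /cintegral.
have Z (c : R) (k : T -> R) : mu.-integrable setT (EFin \o k) ->
    mu.-integrable setT (EFin \o (fun x => c * k x)).
  by move=> ik; have := integrableZl measurableT c ik; exact: eq_integrable.
have D (k l : T -> R) : mu.-integrable setT (EFin \o k) ->
    mu.-integrable setT (EFin \o l) ->
    mu.-integrable setT (EFin \o (fun x => k x + l x)).
  by move=> ik il; have := integrableD measurableT ik il; exact: eq_integrable.
have -> : (fun x => complex.Re ((p +i* q)%C * f x + g x)) = (fun x =>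
    (p * complex.Re (f x) + - q * complex.Im (f x)) + complex.Re (g x)).
  by apply/funext => x; case: (f x) (g x) => ? ? [? ?]/=; rewrite mulNr.
have -> : (fun x => complex.Im ((p +i* q)%C * f x + g x)) = (fun x =>
    (p * complex.Im (f x) + q * complex.Re (f x)) + complex.Im (g x)).
  by apply/funext => x; case: (f x) (g x) => ? ? [? ?]/=.
rewrite !RintegralD ?RintegralZl//; try by repeat apply: D; exact: Z.
by apply/eqP; rewrite eq_complex/= mulNr !eqxx.
Qed.

Lemma eq_cintegral f g : f =1 g -> cintegral f = cintegral g.
Proof. by move=> fg; congr cintegral; exact/funext. Qed.

Lemma cintegral_conj f : cintegrable f ->
  cintegral (fun x => conjc (f x)) = conjc (cintegral f).
Proof.
move=> [f1 f2]; rewrite /cintegral/=; congr Complex.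
  by apply: eq_Rintegral => x _; case: (f x).
rewrite -mulN1r -RintegralZl//.
by apply: eq_Rintegral => x _; case: (f x) => ? ?; rewrite mulN1r.
Qed.

Lemma ae_eq_cintegral f g : cmeasurable f -> cmeasurable g ->
  (\forall x \ae mu, f x = g x) -> cintegral f = cintegral g.
Proof.
move=> [f1 f2] [g1 g2] fg; congr Complex; rewrite /Rintegral; congr fine.
  apply: ae_eq_integral => //; [exact/measurable_EFinP|exact/measurable_EFinP|].
  by apply: filterS fg => x -> _.
apply: ae_eq_integral => //; [exact/measurable_EFinP|exact/measurable_EFinP|].
by apply: filterS fg => x -> _.
Qed.

Lemma ae_eq_int_abs2 f g : cmeasurable f -> cmeasurable g ->
  (\forall x \ae mu, f x = g x) ->
  (\int[mu]_x (abs2 (f x))%:E = \int[mu]_x (abs2 (g x))%:E)%E.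
Proof.
move=> mf mg fg; apply: ae_eq_integral => //; try exact: measurable_eabs2.
by apply: filterS fg => x -> _.
Qed.

Lemma int_abs2_eq0 f : cmeasurable f ->
  (\int[mu]_x (abs2 (f x))%:E = 0)%E -> \forall x \ae mu, f x = 0.
Proof.
move=> mf f0.
have /(ae_eq_integral_abs _ measurableT (measurable_eabs2 mf)) :
    (\int[mu]_x `|(abs2 (f x))%:E| = 0)%E.
  by rewrite -[RHS]f0; apply: eq_integral => x _; rewrite gee0_abs ?lee_fin ?abs2_ge0.
apply: filterS => x /(_ I) [] /eqP; rewrite abs2_eq0 => /eqP //.
Qed.

Lemma conjM_self (z : R[i]) : conjc z * z = (abs2 z)%:C.
Proof. by case: z => a b; rewrite /abs2; simpc; congr Complex; ring. Qed.

Lemma cintegral_conjM_self f :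
  cintegral (fun x => conjc (f x) * f x) =
  (fine (\int[mu]_x (abs2 (f x))%:E)%E)%:C.
Proof.
rewrite /cintegral; congr Complex.
  by apply: eq_Rintegral => x _; rewrite conjM_self.
under eq_Rintegral => x _ do rewrite conjM_self/=.
by rewrite /Rintegral integral0.
Qed.

End measure.
End complex_functions.

Section complex_series.
Context {R : realType}.
Implicit Types u v : nat -> R[i].

Definition csum u : R[i] :=
  Complex (limn (series (fun n => complex.Re (u n))))
          (limn (series (fun n => complex.Im (u n)))).

Definition csummable u :=
  cvgn (series (fun n => complex.Re (u n))) /\
  cvgn (series (fun n => complex.Im (u n))).

Lemma csumP a u v : csummable u -> csummable v ->
  csum (fun n => a * u n + v n) = a * csum u + csum v.
Proof.
move=> [u1 u2] [v1 v2]; case: a => p q; rewrite /csum.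
have E (c1 c2 : R) (h k l : nat -> R) : cvgn (series h) -> cvgn (series k) ->
    cvgn (series l) ->
    limn (series (fun n => c1 * h n + c2 * k n + l n)) =
    c1 * limn (series h) + c2 * limn (series k) + limn (series l).
  move=> ch ck cl; apply/cvg_lim => //.
  rewrite (_ : series _ = (fun n => c1 * series h n + c2 * series k n + series l n)).
    by apply: cvgD => //; apply: cvgD; apply: cvgMr.
  apply/funext => n; rewrite /series/= !mulr_sumr -!big_split/=.
  exact: eq_bigr.
have -> : (fun n => complex.Re ((p +i* q)%C * u n + v n)) = (fun n =>
    (p * complex.Re (u n) + - q * complex.Im (u n)) + complex.Re (v n)).
  by apply/funext => n; case: (u n) (v n) => ? ? [? ?]/=; rewrite mulNr.
have -> : (fun n => complex.Im ((p +i* q)%C * u n + v n)) = (fun n =>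
    (p * complex.Im (u n) + q * complex.Re (u n)) + complex.Im (v n)).
  by apply/funext => n; case: (u n) (v n) => ? ? [? ?]/=.
by rewrite !E//; apply/eqP; rewrite eq_complex/= mulNr !eqxx.
Qed.

Lemma csum_conj u : csummable u -> csum (fun n => conjc (u n)) = conjc (csum u).
Proof.
move=> [u1 u2]; rewrite /csum/=; congr Complex.
  by congr (limn (series _)); apply/funext => n; case: (u n).
apply/cvg_lim => //.
rewrite (_ : series _ = - series (fun n => complex.Im (u n))); first exact: cvgN.
apply/funext => n; rewrite /series opprfctE/= -sumrN.
by apply: eq_bigr => i _; case: (u i).
Qed.

Lemma nneseries_cvg (a : nat -> \bar R) : (forall n, 0 <= a n)%E ->
  (\sum_(0 <= n <oo) a n < +oo)%E ->
  (forall n, a n \is a fin_num) /\ cvgn (series (fun n => fine (a n))).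
Proof.
move=> a0 aoo.
have afin n : a n \is a fin_num.
  rewrite ge0_fin_numE//; apply: le_lt_trans aoo.
  apply: le_trans (nneseries_lim_ge n.+1 _) => //.
  by rewrite big_nat_recr//= leeDr// sume_ge0.
split=> //; apply: nondecreasing_is_cvgn.
  by apply/nondecreasing_series => n _ _; rewrite fine_ge0.
exists (fine (\sum_(0 <= n <oo) a n)%E) => _ [n _ <-].
rewrite -lee_fin fineK; last by rewrite ge0_fin_numE// nneseries_ge0.
rewrite /series/= -sumEFin (eq_bigr a); last by move=> i _; rewrite fineK.
exact: nneseries_lim_ge.
Qed.

End complex_series.

Section fock_functions.
Context {R : realType}.
Local Notation RT := (measurableTypeR R).

Section n_variables.
Variable n : nat.
Implicit Types f g : n.-tuple RT -> R[i].

Definition perm_tuple (s : 'S_n) (x : n.-tuple RT) : n.-tuple RT :=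
  [tuple tnth x (s i) | i < n].

Definition antisymmetrization f : n.-tuple RT -> R[i] := fun x =>
  (n`!)%:R^-1 * \sum_(s : 'S_n) (-1) ^+ s * f (perm_tuple s x).

Definition antisymmetric_fun f :=
  forall (s : 'S_n) x, f (perm_tuple s x) = (-1) ^+ s * f x.

(* Functions representing an element of the n-th antisymmetric space. Since the
   measure is carried by tuples of nonnegative reals, every almost everywhere
   antisymmetric class contains a function antisymmetric at every point. *)
Definition Lambda : set (n.-tuple RT -> R[i]) :=
  [set f | square_integrable (lebpn n) f /\ antisymmetric_fun f].

Definition Lambda_dot f g : R[i] :=
  (n`!)%:R * cintegral (lebpn n) (fun x => conjc (f x) * g x).

Definition Lambda_norm2 f : \bar R :=
  ((n`!)%:R%:E * \int[lebpn n]_x (abs2 (f x))%:E)%E.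

Lemma LambdaP a f g : Lambda f -> Lambda g -> Lambda (fun x => a * f x + g x).
Proof.
move=> [f2 fa] [g2 ga]; split.
  by apply: square_integrableD => //; exact: square_integrableZ.
by move=> s x; rewrite fa ga mulrDr mulrCA.
Qed.

Lemma Lambda0 : Lambda (fun=> 0).
Proof. by split=> [|s x]; [exact: square_integrable0|rewrite mulr0]. Qed.

Lemma Lambda_norm2_ge0 f : (0 <= Lambda_norm2 f)%E.
Proof. by rewrite mule_ge0// int_abs2_ge0. Qed.

Lemma fact_gt0R : 0 < (n`!)%:R :> R.
Proof. by rewrite ltr0n fact_gt0. Qed.

Lemma Lambda_dotPr a f g h : Lambda f -> Lambda g -> Lambda h ->
  Lambda_dot f (fun x => a * g x + h x) = a * Lambda_dot f g + Lambda_dot f h.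
Proof.
move=> [f2 _] [g2 _] [h2 _]; rewrite /Lambda_dot mulrCA -mulrDr; congr (_ * _).
rewrite -cintegralP; try exact: cintegrable_conjM.
by apply: eq_cintegral => x; rewrite mulrDr mulrCA.
Qed.

Lemma conjc_nat m : conjc (m%:R : R[i]) = m%:R.
Proof. by rewrite rmorph_nat. Qed.

Lemma Lambda_dotC f g : Lambda f -> Lambda g ->
  Lambda_dot g f = conjc (Lambda_dot f g).
Proof.
move=> [f2 _] [g2 _]; rewrite /Lambda_dot rmorphM/= conjc_nat; congr (_ * _).
apply: etrans (cintegral_conj (cintegrable_conjM f2 g2)).
by apply: eq_cintegral => x; rewrite rmorphM/= conjcK mulrC.
Qed.

Lemma natC m : (m%:R : R[i]) = Complex (m%:R : R) 0.
Proof. exact/esym/(rmorph_nat (real_complex R)). Qed.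

Lemma Lambda_norm2_fin f : Lambda f -> Lambda_norm2 f \is a fin_num.
Proof.
move=> [[_ f2] _]; rewrite ge0_fin_numE ?Lambda_norm2_ge0// /Lambda_norm2.
by rewrite lte_mul_pinfty// lee_fin.
Qed.

Lemma int_abs2_fin f : Lambda f ->
  (\int[lebpn n]_x (abs2 (f x))%:E)%E \is a fin_num.
Proof. by move=> [[_ f2] _]; rewrite ge0_fin_numE ?int_abs2_ge0. Qed.

Lemma Lambda_dot_self f : Lambda f ->
  Lambda_dot f f = (fine (Lambda_norm2 f))%:C.
Proof.
move=> Lf; rewrite /Lambda_dot /Lambda_norm2 cintegral_conjM_self.
by rewrite fineM ?int_abs2_fin//= rmorphM/= rmorph_nat.
Qed.

Lemma fine_Lambda_norm2 f : Lambda f ->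
  fine (Lambda_norm2 f) = (n`!)%:R * \int[lebpn n]_x abs2 (f x).
Proof. by move=> Lf; rewrite /Lambda_norm2 fineM ?int_abs2_fin. Qed.

Lemma Rintegral_le (h : n.-tuple RT -> R) f g : Lambda f -> Lambda g ->
  measurable_fun setT h -> (forall x, `|h x| <= abs2 (f x) + abs2 (g x)) ->
  `|(n`!)%:R * \int[lebpn n]_x h x| <=
    fine (Lambda_norm2 f) + fine (Lambda_norm2 g).
Proof.
move=> Lf Lg mh hfg; have [f2 _] := Lf; have [g2 _] := Lg.
rewrite !fine_Lambda_norm2// -mulrDr normrM ger0_norm// ler_wpM2l//.
have ih := integrable_dominated f2 g2 mh hfg.
have iabs2 (k : n.-tuple RT -> R[i]) : square_integrable (lebpn n) k ->
    (lebpn n).-integrable setT (EFin \o (fun x => abs2 (k x))).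
  move=> [mk k2]; apply/integrableP; split; first exact: measurable_eabs2.
  by under eq_integral => x _ do rewrite /= ger0_norm ?abs2_ge0//.
rewrite (le_trans (le_normr_Rintegral _ ih))//.
rewrite -RintegralD//; [|exact: iabs2..].
apply: le_Rintegral => //.
  by have := integrable_abse ih; exact: eq_integrable.
have := integrableD measurableT (iabs2 _ f2) (iabs2 _ g2); exact: eq_integrable.
Qed.

Lemma ReM_nat m (z : R[i]) : complex.Re (m%:R * z) = m%:R * complex.Re z.
Proof. by case: z => a b; rewrite natC/= mul0r subr0. Qed.

Lemma ImM_nat m (z : R[i]) : complex.Im (m%:R * z) = m%:R * complex.Im z.
Proof. by case: z => a b; rewrite natC/= mul0r addr0. Qed.

Lemma normRe_Lambda_dot f g : Lambda f -> Lambda g ->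
  `|complex.Re (Lambda_dot f g)| <=
    fine (Lambda_norm2 f) + fine (Lambda_norm2 g).
Proof.
move=> Lf Lg; rewrite ReM_nat; apply: Rintegral_le => //.
  by case: (cmeasurableM (cmeasurable_conj Lf.1.1) Lg.1.1).
by move=> x; exact: normRe_conjM.
Qed.

Lemma normIm_Lambda_dot f g : Lambda f -> Lambda g ->
  `|complex.Im (Lambda_dot f g)| <=
    fine (Lambda_norm2 f) + fine (Lambda_norm2 g).
Proof.
move=> Lf Lg; rewrite ImM_nat; apply: Rintegral_le => //.
  by case: (cmeasurableM (cmeasurable_conj Lf.1.1) Lg.1.1).
by move=> x; exact: normIm_conjM.
Qed.

Lemma Lambda_norm2P a f g : Lambda f -> Lambda g ->
  (Lambda_norm2 (fun x => (a * f x + g x)%R) <=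
   (2 * abs2 a)%:E * Lambda_norm2 f + 2%:E * Lambda_norm2 g)%E.
Proof.
move=> Lf Lg; rewrite /Lambda_norm2.
have [[mf _] _] := Lf; have [[mg _] _] := Lg.
have maf : cmeasurable (fun x => a * f x) := cmeasurableM (cmeasurable_cst _ a) mf.
have := int_abs2D (lebpn n) maf mg.
rewrite int_abs2Z//.
have /fineK <- := int_abs2_fin Lf; have /fineK <- := int_abs2_fin Lg.
have /fineK <- := int_abs2_fin (LambdaP a Lf Lg).
rewrite -!EFinM -!EFinD !lee_fin => h.
apply: le_trans (ler_wpM2l _ h) _ => //.
by rewrite le_eqVlt; apply/orP; left; apply/eqP; ring.
Qed.

Lemma Lambda_norm2_eq0 f : Lambda f -> Lambda_norm2 f = 0%E ->
  \forall x \ae lebpn n, f x = 0.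
Proof.
move=> Lf /eqP; rewrite /Lambda_norm2 mule_eq0 eqe gt_eqF ?fact_gt0R//=.
by move/eqP; apply: int_abs2_eq0; exact: Lf.1.1.
Qed.

End n_variables.
End fock_functions.
Section fock_space.
Context {R : realType}.
Local Notation RT := (measurableTypeR R).

Definition fockfun := forall n, n.-tuple RT -> R[i].
Implicit Types F G K : fockfun.

Definition is_fock F :=
  (forall n, Lambda (F n)) /\ (\sum_(0 <= n <oo) Lambda_norm2 (F n) < +oo)%E.

(* Equality of the classes of F and G in the Hilbert sum: F n and G n are equal
   as square integrable functions on the n-th power of the half-line. *)
Definition fock_ae_eq F G := forall n, \forall x \ae lebpn n, F n x = G n x.

Lemma fock_ae_refl F : fock_ae_eq F F.
Proof. by move=> n; exact: nearW. Qed.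

Lemma fock_ae_sym F G : fock_ae_eq F G -> fock_ae_eq G F.
Proof. by move=> FG n; apply: filterS (FG n) => x ->. Qed.

Lemma fock_ae_trans F G K :
  fock_ae_eq F G -> fock_ae_eq G K -> fock_ae_eq F K.
Proof. by move=> FG GK n; apply: filterS2 (FG n) (GK n) => x -> ->. Qed.

Definition fock_lin (a : R[i]) F G : fockfun := fun n x => a * F n x + G n x.

Lemma is_fock0 : is_fock (fun _ _ => 0).
Proof.
split=> [n|]; first exact: Lambda0.
rewrite eseries0// => n _ _; rewrite /Lambda_norm2.
rewrite (eq_integral (cst 0%E)) ?integral0 ?mule0// => x _.
by rewrite /abs2/= expr0n/= addr0.
Qed.

Lemma is_fock_lin a F G : is_fock F -> is_fock G -> is_fock (fock_lin a F G).
Proof.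
move=> [LF F2] [LG G2]; split=> [n|]; first exact: LambdaP.
have h0 H n : (0 <= Lambda_norm2 (H n : n.-tuple RT -> R[i]))%E.
  exact: Lambda_norm2_ge0.
apply: le_lt_trans (lee_nneseries _ _) _.
- by move=> n _ _; exact: h0.
- by move=> n _; exact: Lambda_norm2P.
rewrite nneseriesD//; last 2 first.
- by move=> n _ _; rewrite mule_ge0// lee_fin mulr_ge0// abs2_ge0.
- by move=> n _ _; rewrite mule_ge0.
rewrite !nneseriesZl//.
by rewrite lte_add_pinfty// lte_mul_pinfty// lee_fin mulr_ge0// abs2_ge0.
Qed.

Definition fock_dot_fun F G : R[i] := csum (fun n => Lambda_dot (F n) (G n)).

Lemma fock_cvg F : is_fock F ->
  cvgn (series (fun n => fine (Lambda_norm2 (F n)))).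
Proof.
move=> [LF F2]; have [] // := nneseries_cvg _ F2.
by move=> n; exact: Lambda_norm2_ge0.
Qed.

Lemma csummable_fock F G : is_fock F -> is_fock G ->
  csummable (fun n => Lambda_dot (F n) (G n)).
Proof.
move=> fF fG.
have c : cvgn (series (fun n =>
    fine (Lambda_norm2 (F n)) + fine (Lambda_norm2 (G n)))).
  rewrite (_ : series _ = series (fun n => fine (Lambda_norm2 (F n))) +
                          series (fun n => fine (Lambda_norm2 (G n)))).
    by apply: is_cvgD; exact: fock_cvg.
  by rewrite seriesD.
have c0 n : 0 <= fine (Lambda_norm2 (F n)) + fine (Lambda_norm2 (G n)).
  by rewrite addr_ge0// fine_ge0// Lambda_norm2_ge0.
split; apply: normed_cvg; apply: (series_le_cvg _ c0 _ c) => n /=.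
- exact: normr_ge0.
- exact: normRe_Lambda_dot (fF.1 n) (fG.1 n).
- exact: normr_ge0.
- exact: normIm_Lambda_dot (fF.1 n) (fG.1 n).
Qed.

Lemma fock_dot_funPr a F G K : is_fock F -> is_fock G -> is_fock K ->
  fock_dot_fun F (fock_lin a G K) = a * fock_dot_fun F G + fock_dot_fun F K.
Proof.
move=> fF fG fK; rewrite -csumP; try exact: csummable_fock.
congr csum; apply/funext => n.
by apply: Lambda_dotPr; [exact: fF.1|exact: fG.1|exact: fK.1].
Qed.

Lemma fock_dot_funC F G : is_fock F -> is_fock G ->
  fock_dot_fun G F = conjc (fock_dot_fun F G).
Proof.
move=> fF fG; rewrite -csum_conj; last exact: csummable_fock.
by congr csum; apply/funext => n; apply: Lambda_dotC; [exact: fF.1|exact: fG.1].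
Qed.

Lemma fock_dot_fun_self F : is_fock F ->
  fock_dot_fun F F = (limn (series (fun n => fine (Lambda_norm2 (F n)))))%:C.
Proof.
move=> fF; rewrite /fock_dot_fun /csum.
have E n : Lambda_dot (F n) (F n) = (fine (Lambda_norm2 (F n)))%:C.
  by rewrite Lambda_dot_self//; exact: fF.1.
congr Complex; first by congr (limn (series _)); apply/funext => n; rewrite E.
under eq_fun do rewrite E/=.
by apply/cvg_lim => //; rewrite (_ : series _ = cst 0) //;
  [exact: cvg_cst|apply/funext => n; rewrite /series/= big1].
Qed.

Lemma fock_dot_fun_ge0 F : is_fock F -> 0 <= fock_dot_fun F F.
Proof.
move=> fF; rewrite fock_dot_fun_self// lecR; apply: limr_ge; first exact: fock_cvg.
by apply: nearW => n; apply: sumr_ge0 => i _; rewrite fine_ge0// Lambda_norm2_ge0.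
Qed.

Lemma fock_dot_fun_eq0 F : is_fock F -> fock_dot_fun F F = 0 ->
  fock_ae_eq F (fun _ _ => 0).
Proof.
move=> fF; rewrite fock_dot_fun_self// => -[l0] n.
have LFn : Lambda (F n) by exact: fF.1.
apply: Lambda_norm2_eq0 => //.
rewrite -(fineK (Lambda_norm2_fin LFn)); congr EFin; apply/eqP.
rewrite eq_le fine_ge0 ?Lambda_norm2_ge0// andbT -l0.
have nd : nondecreasing_seq (series (fun n => fine (Lambda_norm2 (F n)))).
  by apply/nondecreasing_series => m _ _; rewrite fine_ge0// Lambda_norm2_ge0.
apply: le_trans (nondecreasing_cvgn_le nd (fock_cvg fF) n.+1).
rewrite /series/= big_nat_recr//= lerDr sumr_ge0// => i _.
by rewrite fine_ge0// Lambda_norm2_ge0.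
Qed.

Lemma ae_eq_fock_dot F F' G G' :
  is_fock F -> is_fock F' -> is_fock G -> is_fock G' ->
  fock_ae_eq F F' -> fock_ae_eq G G' -> fock_dot_fun F G = fock_dot_fun F' G'.
Proof.
move=> fF fF' fG fG' FF' GG'; congr csum; apply/funext => n; congr (_ * _).
have m K : is_fock K -> cmeasurable (K n) by move=> fK; exact: (fK.1 n).1.1.
apply: ae_eq_cintegral.
- by apply: cmeasurableM; [exact/cmeasurable_conj/m|exact: m].
- by apply: cmeasurableM; [exact/cmeasurable_conj/m|exact: m].
- by apply: filterS2 (FF' n) (GG' n) => x -> ->.
Qed.

Definition fock_rep := {F : fockfun | `[< is_fock F >]}.

Definition fock_rep0 : fock_rep :=
  exist (fun F : fockfun => `[< is_fock F >]) _ (asboolT is_fock0).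

Definition fock_eqb (F G : fock_rep) := `[< fock_ae_eq (val F) (val G) >].

Lemma fock_eqb_refl : reflexive fock_eqb.
Proof. by move=> F; exact/asboolP/fock_ae_refl. Qed.

Lemma fock_eqb_sym : symmetric fock_eqb.
Proof. by move=> F G; apply/asboolP/asboolP; exact: fock_ae_sym. Qed.

Lemma fock_eqb_trans : transitive fock_eqb.
Proof.
by move=> G F K /asboolP FG /asboolP GK; apply/asboolP; exact: fock_ae_trans GK.
Qed.

Canonical fock_equiv := EquivRel fock_eqb fock_eqb_refl fock_eqb_sym fock_eqb_trans.

Definition fock : Type := {eq_quot fock_eqb}%qT.
HB.instance Definition _ := Choice.on fock.
HB.instance Definition _ := EqQuotient.on fock.

Definition fock_fun (u : fock) : fockfun := val (repr u).

(* The class of F if F represents a Fock vector, and 0 otherwise. *)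
Definition to_fock F : fock :=
  \pi_fock%qT (insubd fock_rep0 F).

Lemma fock_funP (u : fock) : is_fock (fock_fun u).
Proof. exact/asboolP/(valP (repr u)). Qed.

Lemma to_fockK F : is_fock F -> fock_ae_eq (fock_fun (to_fock F)) F.
Proof.
move=> fF; rewrite /fock_fun /to_fock.
set G := insubd _ F.
have -> : F = val G by rewrite /G val_insubd asboolT.
by apply/asboolP; rewrite -[asbool _]/(fock_equiv _ _) -eqmodE reprK.
Qed.

Lemma fock_eqP (u v : fock) : fock_ae_eq (fock_fun u) (fock_fun v) -> u = v.
Proof.
move=> uv; rewrite -[u]reprK -[v]reprK; apply/eqmodP/asboolP.
exact: uv.
Qed.

Lemma eq_to_fock F G : is_fock F -> is_fock G -> fock_ae_eq F G ->
  to_fock F = to_fock G.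
Proof.
move=> fF fG FG; apply/fock_eqP/(fock_ae_trans (to_fockK fF)).
exact/(fock_ae_trans FG)/fock_ae_sym/to_fockK.
Qed.

End fock_space.
Arguments fock R : clear implicits.
Arguments fockfun R : clear implicits.
Arguments fock_fun {R} u n x.
Arguments fock_lin {R} a F G n x.

Section fock_lmodule.
Context {R : realType}.
Implicit Types u v w : fock R.

Definition fock0 : fock R := to_fock (fun _ _ => 0).
Definition fock_opp u : fock R := to_fock (fun n x => - fock_fun u n x).
Definition fock_add u v : fock R :=
  to_fock (fun n x => fock_fun u n x + fock_fun v n x).
Definition fock_scale (a : R[i]) u : fock R :=
  to_fock (fun n x => a * fock_fun u n x).

Lemma fock0E : fock_ae_eq (fock_fun fock0) (fun _ _ => 0).
Proof. exact: to_fockK is_fock0. Qed.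

Lemma fock_scaleE a u :
  fock_ae_eq (fock_fun (fock_scale a u)) (fun n x => a * fock_fun u n x).
Proof.
apply: to_fockK; rewrite (_ : (fun _ _ => _) =
  fock_lin a (fock_fun u) (fun _ _ => 0)).
  by apply: is_fock_lin; [exact: fock_funP|exact: is_fock0].
by apply/functional_extensionality_dep => n; apply/funext => x; rewrite /fock_lin addr0.
Qed.

Lemma fock_oppE u :
  fock_ae_eq (fock_fun (fock_opp u)) (fun n x => - fock_fun u n x).
Proof.
apply: to_fockK; rewrite (_ : (fun _ _ => _) =
  fock_lin (-1) (fock_fun u) (fun _ _ => 0)).
  by apply: is_fock_lin; [exact: fock_funP|exact: is_fock0].
by apply/functional_extensionality_dep => n; apply/funext => x;
  rewrite /fock_lin addr0 mulN1r.
Qed.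

Lemma fock_addE u v : fock_ae_eq (fock_fun (fock_add u v))
  (fun n x => fock_fun u n x + fock_fun v n x).
Proof.
apply: to_fockK; rewrite (_ : (fun _ _ => _) =
  fock_lin 1 (fock_fun u) (fock_fun v)).
  by apply: is_fock_lin; exact: fock_funP.
by apply/functional_extensionality_dep => n; apply/funext => x; rewrite /fock_lin mul1r.
Qed.

Lemma fock_addA : associative fock_add.
Proof.
move=> u v w; apply: fock_eqP => n.
near=> x; rewrite (near (fock_addE u (fock_add v w) n) x)//.
rewrite (near (fock_addE v w n) x)//.
rewrite (near (fock_addE (fock_add u v) w n) x)//.
by rewrite (near (fock_addE u v n) x)// addrA.
Unshelve. all: by end_near. Qed.

Lemma fock_addC : commutative fock_add.
Proof.
move=> u v; apply: fock_eqP => n.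
near=> x; rewrite (near (fock_addE u v n) x)// (near (fock_addE v u n) x)//.
by rewrite addrC.
Unshelve. all: by end_near. Qed.

Lemma fock_add0 : left_id fock0 fock_add.
Proof.
move=> u; apply: fock_eqP => n.
near=> x; rewrite (near (fock_addE fock0 u n) x)// (near (fock0E n) x)//.
by rewrite add0r.
Unshelve. all: by end_near. Qed.

Lemma fock_addN : left_inverse fock0 fock_opp fock_add.
Proof.
move=> u; apply: fock_eqP => n.
near=> x; rewrite (near (fock_addE (fock_opp u) u n) x)//.
rewrite (near (fock_oppE u n) x)// (near (fock0E n) x)//.
by rewrite addNr.
Unshelve. all: by end_near. Qed.

HB.instance Definition _ :=
  GRing.isZmodule.Build (fock R) fock_addA fock_addC fock_add0 fock_addN.

Lemma fock_scaleA a b u : fock_scale a (fock_scale b u) = fock_scale (a * b) u.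
Proof.
apply: fock_eqP => n.
near=> x; rewrite (near (fock_scaleE a (fock_scale b u) n) x)//.
rewrite (near (fock_scaleE b u n) x)// (near (fock_scaleE (a * b) u n) x)//.
by rewrite mulrA.
Unshelve. all: by end_near. Qed.

Lemma fock_scale1 : left_id 1 fock_scale.
Proof.
move=> u; apply: fock_eqP => n.
by near=> x; rewrite (near (fock_scaleE 1 u n) x)// mul1r.
Unshelve. all: by end_near. Qed.

Lemma fock_scaleDr : right_distributive fock_scale +%R.
Proof.
move=> a u v; apply: fock_eqP => n.
near=> x; rewrite (near (fock_scaleE a (u + v) n) x)//.
rewrite (near (fock_addE u v n) x)//.
rewrite (near (fock_addE (fock_scale a u) (fock_scale a v) n) x)//.
rewrite (near (fock_scaleE a u n) x)// (near (fock_scaleE a v n) x)//.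
by rewrite mulrDr.
Unshelve. all: by end_near. Qed.

Lemma fock_scaleDl u : {morph fock_scale^~ u : a b / a + b}.
Proof.
move=> a b; apply: fock_eqP => n.
near=> x; rewrite (near (fock_scaleE (a + b) u n) x)//.
rewrite (near (fock_addE (fock_scale a u) (fock_scale b u) n) x)//.
rewrite (near (fock_scaleE a u n) x)// (near (fock_scaleE b u n) x)//.
by rewrite mulrDl.
Unshelve. all: by end_near. Qed.

HB.instance Definition _ := GRing.Zmodule_isLmodule.Build R[i] (fock R)
  fock_scaleA fock_scale1 fock_scaleDr fock_scaleDl.

Lemma fock_linE a u v :
  fock_ae_eq (fock_fun (a *: u + v)) (fock_lin a (fock_fun u) (fock_fun v)).
Proof.
move=> n; near=> x; rewrite (near (fock_addE (a *: u) v n) x)//.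
by rewrite (near (fock_scaleE a u n) x).
Unshelve. all: by end_near. Qed.

Definition fock_dot u v : R[i] := fock_dot_fun (fock_fun u) (fock_fun v).

Lemma fock_dotPr u a v w :
  fock_dot u (a *: v + w) = a * fock_dot u v + fock_dot u w.
Proof.
have f2 := @fock_funP R.
rewrite -fock_dot_funPr//; apply: ae_eq_fock_dot => //.
- by apply: is_fock_lin.
- exact: fock_ae_refl.
- exact: fock_linE.
Qed.

Lemma fock_dotC u v : fock_dot v u = conjc (fock_dot u v).
Proof. by apply: fock_dot_funC; exact: fock_funP. Qed.

Lemma fock_dot_ge0 u : 0 <= fock_dot u u.
Proof. by apply: fock_dot_fun_ge0; exact: fock_funP. Qed.

Lemma fock_dot_eq0 u : fock_dot u u = 0 -> u = 0.
Proof.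
move=> u0; apply: fock_eqP.
apply: fock_ae_trans (fock_ae_sym fock0E).
by apply: fock_dot_fun_eq0 => //; exact: fock_funP.
Qed.

HB.instance Definition _ := Lmodule_isInner.Build R (fock R)
  fock_dotPr fock_dotC fock_dot_ge0 fock_dot_eq0.

End fock_lmodule.

Section clifford.
Context {R : realType}.
Local Notation RT := (measurableTypeR R).
Implicit Types (z : RT -> R[i]) (u : fock R).

Definition tensor z n (w : n.-tuple RT -> R[i]) : n.+1.-tuple RT -> R[i] :=
  fun x => z (thead x) * w [tuple of behead x].

Definition single n (f : n.-tuple RT -> R[i]) : fockfun R := fun m x =>
  if @eqP _ m n is ReflectT mn then f (tcast mn x) else 0.

Definition embed n (f : n.-tuple RT -> R[i]) : fock R := to_fock (single f).

Definition vacuum : fock R := embed (fun _ : 0.-tuple RT => 1).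

(* For square integrable z the argument of to_fock represents a Fock vector, so
   that the default value 0 is not used; the same holds for embed f when f is in
   Lambda. *)
Definition creation z u : fock R := to_fock (fun n =>
  match n return n.-tuple RT -> R[i] with
  | 0 => fun=> 0
  | m.+1 => antisymmetrization (tensor z (fock_fun u m))
  end).

Definition annihilation z : fock R -> fock R := adj (creation z).

Definition Psi z : fock R -> fock R :=
  fun u => creation z u + annihilation (fun t => conjc (z t)) u.

Definition clifford : set (fock R -> fock R) :=
  von_neumann_generated [set Psi z | z in square_integrable lebp].

Definition vacuum_state (T : fock R -> fock R) : R[i] := dot vacuum (T vacuum).

Definition Psi1 : fock R -> fock R := Psi (fun t => (\1_`[0, 1] t)%:C).

Definition of_Psi1 (f : [set (-1 : R); (1 : R)] -> R[i]) : fock R -> fock R :=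
  functional_calculus Psi1 f.

Section completion.
Variables (K : hilbertType R) (iota : (fock R -> fock R) -> K).
Implicit Types k : K.

(* K with iota is a completion of the Clifford algebra for the inner product
   vacuum_state (S^* T); the values of iota outside the algebra are irrelevant. *)
Definition is_L2_completion :=
  [/\ forall (a : R[i]) S T, clifford S -> clifford T ->
        iota (a *: S + T) = a *: iota S + iota T,
      forall S T, clifford S -> clifford T ->
        dot (iota S) (iota T) = vacuum_state (adj S \o T)
    & forall k (e : R), 0 < e ->
        exists T, clifford T /\ hnorm (k - iota T) < e].

(* Graph of the unitary from K to the Fock space obtained by extending
   T |-> T vacuum by continuity. *)
Definition vacuum_unitary k u :=
  exists T : nat -> fock R -> fock R, (forall i, clifford (T i)) /\
    hcvg (fun i => iota (T i)) k /\ hcvg (fun i => T i vacuum) u.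

(* k = J_n(f). *)
Definition is_chaos n (f : n.-tuple RT -> R[i]) k :=
  Lambda f /\ vacuum_unitary k (embed f).

Definition slice (t : RT) n (f : n.+1.-tuple RT -> R[i]) : n.-tuple RT -> R[i] :=
  fun x => f [tuple of t :: x].

(* k is the sum of the J_n(v n), n <= N, and G t is the sum of the
   n J_(n-1)(v n (t, .)), 1 <= n <= N, for almost every t. *)
Definition is_derivative k (G : RT -> K) :=
  exists N (v : fockfun R) (l : nat -> K),
    (forall n, (n < N.+1)%N -> is_chaos (v n) (l n)) /\
    k = \sum_(n < N.+1) l n /\
    \forall t \ae lebp, exists j : nat -> K,
      (forall n, (n < N)%N -> is_chaos (slice t (v n.+1)) (j n)) /\
      G t = \sum_(n < N) (n.+1)%:R *: j n.

Definition derivative k : RT -> K := xget (fun=> 0) [set G | is_derivative k G].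

(* Squared norm in L^2(R_+; K), identified with the tensor product of L^2(R_+)
   and K. *)
Definition L2_norm2 (G : RT -> K) : R := \int[lebp]_t hnorm (G t) ^+ 2.

End completion.
End clifford.
Arguments single {R n} f m x : rename.
Arguments Psi1 R : clear implicits.
Arguments vacuum R : clear implicits.

(* Main.v *)
(* Psi_1 is a self-adjoint involution with m(Psi_1) = 0, so
   f(Psi_1) = alpha + beta Psi_1 with beta = (f(1) - f(-1)) / 2, and
   m(g(Psi_1)) = (g(1) + g(-1)) / 2. Since Psi_1 Omega is the indicator e of
   [0, 1], the derivative of f(Psi_1) is t |-> beta e(t), of squared norm
   |beta|^2, and the claim becomes a two-point entropy inequality for
   x = |f(1)| and y = |f(-1)|, as |f(1) - f(-1)| >= |x - y|.

   That Psi_1 is an involution follows from b(z) b*(z) + b*(z) b(z) = |z|^2 and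
   b*(z)^2 = 0. The former comes from expanding the antisymmetrization of
   z (x) w along the variable given to z, the latter from the symmetry of
   z (x) z (x) w in its first two variables. The same relation bounds b*(z), so
   that the Clifford algebra consists of bounded operators; on it T |-> T Omega
   is isometric, which makes the derivative well defined. *)

From HB Require Import structures.
Require Import Defs.
From mathcomp Require Import all_boot all_order all_algebra perm complex.
From mathcomp Require Import all_classical all_reals all_analysis.
From mathcomp Require Import measurable_realfun ring lra.
Set Implicit Arguments.
Unset Strict Implicit.
Unset Printing Implicit Defensive.
Import Order.TTheory GRing.Theory Num.Theory.
Import numFieldNormedType.Exports.
Local Open Scope classical_set_scope.
Local Open Scope complex_scope.
Local Open Scope ring_scope.

(** * Lebesgue measure on tuples *)

Section tuple_measure.
Context {R : realType}.
Local Notation RT := (measurableTypeR R).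

(** As 2 log 4 |beta|^2 = log 2 |f(1) - f(-1)|^2, the two-point inequality is needed with the
    constant log 2 = 0.69... With the choice of m made below, bounding the logarithms by ln u <= u -
    1 alone would give 3/4, which is too large. Splitting u into two factors before applying that
    bound gives 5/8, which is below log 2.

    The adjoint, the functional calculus and the derivative are each picked by choice among the
    objects with a defining property, so each needs an explicit candidate and some uniqueness. The
    adjoint of b*(z) is exhibited as n+1 times integration against conj(z) in the first variable; a
    calculus on two points is determined by its values on affine functions; a derivative is
    controlled through the kernels, which a Fock vector determines up to null sets. Of a derivative
    only the norm at almost every t is recovered, and this fixes its L^2 norm.

    Fock vectors are classes modulo null sets, so operators are first studied on functions of n
    variables, where identities hold pointwise or almost everywhere, and are carried to the Fock
    space through inner products, which do not see null sets. *)

Definition tuple_box n (A : 'I_n -> set RT) : set (n.-tuple RT) :=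
  [set x | forall i, A i (tnth x i)].

Lemma measurable_tuple_box n (A : 'I_n -> set RT) :
  (forall i, measurable (A i)) -> measurable (tuple_box A).
Proof.
move=> mA; rewrite (_ : tuple_box A = \bigcap_(i in [set: 'I_n]) [set x | A i (tnth x i)]).
  apply: fin_bigcap_measurable; first exact: finite_finset.
  move=> i _; rewrite -[X in measurable X]setTI.
  exact: measurable_tnth.
by apply/seteqP; split=> [x Ax i _|x Ax i]; exact: Ax.
Qed.

(** The sigma-algebra on tuples is generated by conditions on one coordinate. Each of these is a box
    whose other sides are the whole line, and boxes, unlike such cylinders, are stable under
    intersection, as uniqueness of measures requires. *)
Lemma measurable_tuple_boxE n : (measurable : set (set (n.-tuple RT))) =
  <<s [set tuple_box A | A in [set A : 'I_n -> set RT | forall i, measurable (A i)]] >>.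
Proof.
apply/seteqP; split; last first.
  apply: smallest_sub; first exact: sigma_algebra_measurable.
  by move=> _ [A mA <-]; exact: measurable_tuple_box.
apply: smallest_sub; first exact: smallest_sigma_algebra.
rewrite -bigcup_seq => B [i _] [A mA <-]; apply: sub_sigma_algebra.
exists (fun j => if j == i then A else setT) => /=.
  by move=> j; case: ifP.
rewrite setTI; apply/seteqP; split=> x /=.
  by move/(_ i); rewrite eqxx.
by move=> Ax j; case: eqP => // ->.
Qed.

Lemma lebpn_box n (A : 'I_n -> set RT) : (forall i, measurable (A i)) ->
  lebpn n (tuple_box A) = (\prod_(i < n) lebp (A i))%E.
Proof.
elim: n A => [|n IH] A mA.
  by rewrite big_ord0 /= diracE (_ : _ \in _)// inE => -[].
rewrite big_ord_recl/= /lebp_cons /pushforward.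
rewrite (_ : _ @^-1` _ = A ord0 `*` tuple_box (fun i => A (lift ord0 i))).
  by rewrite product_measure1E ?IH//; exact: measurable_tuple_box.
apply/seteqP; split=> -[t x] /=.
  by move=> Ax; split=> [|i]; [exact: (Ax ord0)|have := Ax (lift ord0 i); rewrite tnthS].
by move=> [A0 Ax] i; case: (unliftP ord0 i) => [j|] ->//; rewrite tnthS; exact: Ax.
Qed.

Lemma tnth_perm_tuple n (s : 'S_n) (x : n.-tuple RT) i :
  tnth (perm_tuple s x) i = tnth x (s i).
Proof. by rewrite tnth_mktuple. Qed.

Lemma perm_tupleM n (s t : 'S_n) (x : n.-tuple RT) :
  perm_tuple s (perm_tuple t x) = perm_tuple (s * t)%g x.
Proof. by apply: eq_from_tnth => i; rewrite !tnth_perm_tuple permM. Qed.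

Lemma perm_tuple1 n (x : n.-tuple RT) : perm_tuple 1%g x = x.
Proof. by apply: eq_from_tnth => i; rewrite !tnth_perm_tuple perm1. Qed.

Lemma measurable_perm_tuple n (s : 'S_n) :
  measurable_fun setT (@perm_tuple R n s).
Proof.
apply/measurable_fun_tnthP => i.
rewrite (_ : _ \o _ = (@tnth _ RT)^~ (s i)); first exact: measurable_tnth.
by apply/funext => x /=; rewrite tnth_perm_tuple.
Qed.

HB.instance Definition _ n (s : 'S_n) :=
  isMeasurableFun.Build _ _ _ _ (@perm_tuple R n s) (measurable_perm_tuple s).

(** Both measures give a box the product of the measures of its sides, in two different orders, and
    boxes are a generating family stable under intersection. *)
Lemma lebpn_perm n (s : 'S_n) A : measurable A ->
  pushforward (lebpn n) (@perm_tuple R n s) A = lebpn n A.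
Proof.
have /sigma_finiteP[F [TF ndF Foo]] :=
  sigma_finiteT (@lebp R : {sigma_finite_measure set RT -> \bar R}).
have mF k : measurable (F k) by case: (Foo k).
move=> mA; apply/esym.
pose m2 := @measure_function_pushforward__canonical__measure_function_Measure
  _ _ _ _ _ (lebpn n) _ (measurable_perm_tuple s).
rewrite -[RHS]/(m2 A); apply: (@measure_unique _ R _
  [set tuple_box A | A in [set A : 'I_n -> set RT | forall i, measurable (A i)]]
  (fun k => tuple_box (fun=> F k)) (measurable_tuple_boxE n)) => //.
- move=> _ _ [B mB <-] [C mC <-]; exists (fun i => B i `&` C i) => /=.
    by move=> i; exact: measurableI.
  apply/seteqP; split=> x /=.
    by move=> h; split=> i; case: (h i).
  by move=> [h1 h2] i; split.
- by move=> k; exists (fun=> F k).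
- rewrite -subTset => x _.
  suff [k Fk] : exists k, forall i, F k (tnth x i) by exists k.
  have /choice[K HK] : forall i, exists k, F k (tnth x i).
    move=> i; have : (\bigcup_i F i) (tnth x i) by rewrite -TF.
    by move=> [k _ ?]; exists k.
  (* One index serves all coordinates because [F] is nondecreasing. *)
  exists (\max_(i < n) K i)%N => i; move: (HK i); apply/subsetPset/ndF.
  exact: leq_bigmax.
- move=> _ [B mB <-]; rewrite /m2/= /pushforward lebpn_box//.
  rewrite (_ : _ @^-1` _ = tuple_box (fun i => B ((s^-1)%g i))).
    by rewrite lebpn_box//; exact: (reindex_inj (@perm_inj _ (s^-1)%g)).
  apply/seteqP; split=> x /= h i.
    by have := h ((s^-1)%g i); rewrite tnth_perm_tuple permKV.
  by rewrite tnth_perm_tuple; have := h (s i); rewrite permK.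
- move=> k; rewrite -[X in (X < _)%E]/(lebpn n (tuple_box _)) lebpn_box//.
  rewrite ltey_eq; apply/orP; left.
  elim/big_ind: _ => [//|x y|i _]; first exact: fin_numM.
  by rewrite ge0_fin_numE//; case: (Foo k).
Qed.

End tuple_measure.

(** * Permutation invariance and Tonelli for integrals over tuples *)

Section tuple_integral.
Context {R : realType}.
Local Notation RT := (measurableTypeR R).

Lemma integral_perm_tuple n (s : 'S_n) (f : n.-tuple RT -> \bar R) :
  measurable_fun setT f ->
  (\int[lebpn n]_x f (perm_tuple s x) = \int[lebpn n]_x f x)%E.
Proof.
move=> mf.
have H (g : n.-tuple RT -> \bar R) : measurable_fun setT g ->
    (forall x, 0 <= g x)%E ->
    (\int[lebpn n]_x g (perm_tuple s x) = \int[lebpn n]_x g x)%E.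
  move=> mg g0.
  transitivity (\int[pushforward (lebpn n) (@perm_tuple R n s)]_x g x)%E.
    by rewrite ge0_integral_pushforward//; exact: measurable_perm_tuple.
  by apply: eq_measure_integral => A mA _; exact: lebpn_perm.
rewrite integralE [RHS]integralE; congr (_ - _)%E.
  by rewrite -(H _ (measurable_funepos mf) (funepos_ge0 f))
    -[X in (\int[_]_x X^\+ x)%E]/(f \o perm_tuple s) funepos_comp.
by rewrite -(H _ (measurable_funeneg mf) (funeneg_ge0 f))
  -[X in (\int[_]_x X^\- x)%E]/(f \o perm_tuple s) funeneg_comp.
Qed.

Lemma cmeasurable_perm n (s : 'S_n) (f : n.-tuple RT -> R[i]) :
  cmeasurable f -> cmeasurable (fun x => f (perm_tuple s x)).
Proof.
by move=> [mf1 mf2]; split; [apply: (measurableT_comp mf1)|apply: (measurableT_comp mf2)];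
  exact: measurable_perm_tuple.
Qed.

Lemma cintegral_perm n (s : 'S_n) (f : n.-tuple RT -> R[i]) : cmeasurable f ->
  cintegral (lebpn n) (fun x => f (perm_tuple s x)) = cintegral (lebpn n) f.
Proof.
move=> [/measurable_EFinP mf1 /measurable_EFinP mf2].
by rewrite /cintegral /Rintegral (integral_perm_tuple s mf1)
  (integral_perm_tuple s mf2).
Qed.

Lemma square_integrable_perm n (s : 'S_n) (f : n.-tuple RT -> R[i]) :
  square_integrable (lebpn n) f ->
  square_integrable (lebpn n) (fun x => f (perm_tuple s x)).
Proof.
move=> [mf f2]; split; first exact: cmeasurable_perm.
by rewrite (integral_perm_tuple s (measurable_eabs2 mf)).
Qed.

Definition cons_tuple n t (x : n.-tuple RT) : n.+1.-tuple RT := [tuple of t :: x].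

Lemma thead_cons_tuple n t (x : n.-tuple RT) : thead (cons_tuple t x) = t.
Proof. by []. Qed.

Lemma behead_cons_tuple n t (x : n.-tuple RT) : [tuple of behead (cons_tuple t x)] = x.
Proof. exact/val_inj. Qed.

Lemma ge0_integral_lebp_cons n (f : n.+1.-tuple RT -> \bar R) :
  measurable_fun setT f -> (forall x, 0 <= f x)%E ->
  (\int[lebpn n.+1]_x f x = \int[lebpn n]_y \int[lebp]_t f (cons_tuple t y))%E.
Proof.
move=> mf f0; rewrite [LHS]ge0_integral_pushforward//; last first.
  exact: measurable_cons_pair.
rewrite preimage_setT fubini_tonelli2//.
  by apply: measurableT_comp => //; exact: measurable_cons_pair.
by move=> x /=; exact: f0.
Qed.

Lemma ge0_integral_lebp_cons1 n (f : n.+1.-tuple RT -> \bar R) :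
  measurable_fun setT f -> (forall x, 0 <= f x)%E ->
  (\int[lebpn n.+1]_x f x = \int[lebp]_t \int[lebpn n]_y f (cons_tuple t y))%E.
Proof.
move=> mf f0; rewrite [LHS]ge0_integral_pushforward//; last first.
  exact: measurable_cons_pair.
rewrite preimage_setT fubini_tonelli1//.
  by apply: measurableT_comp => //; exact: measurable_cons_pair.
by move=> x /=; exact: f0.
Qed.

Lemma measurable_integral_cons n (f : n.+1.-tuple RT -> \bar R) :
  measurable_fun setT f -> (forall x, 0 <= f x)%E ->
  measurable_fun setT (fun y => \int[lebp]_t f (cons_tuple t y))%E.
Proof.
move=> mf f0.
apply: (@measurable_fun_fubini_tonelli_G _ _ _ _ _ lebp (f \o @cons_pair R n)).
  by apply: measurableT_comp => //; exact: measurable_cons_pair.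
by move=> x /=; exact: f0.
Qed.

Lemma measurable_cons_tuple1 n (y : n.-tuple RT) :
  measurable_fun setT (fun t => cons_tuple t y).
Proof.
by apply: measurable_cons; [exact: measurable_id|exact: measurable_cst].
Qed.

Lemma measurable_cons_tuple2 n (t : RT) :
  measurable_fun setT (fun y : n.-tuple RT => cons_tuple t y).
Proof.
by apply: measurable_cons; [exact: measurable_cst|exact: measurable_id].
Qed.

(** By Tonelli the measure of a null set is the integral over [t] of the measures of its sections,
    so almost all of these vanish. This lets kernels known almost everywhere be sliced in the
    derivative. *)
Lemma ae_lebpn_cons n (P : n.+1.-tuple RT -> Prop) :
  (\forall x \ae lebpn n.+1, P x) ->
  \forall t \ae lebp, \forall y \ae lebpn n, P (cons_tuple t y).
Proof.
move=> [A [mA A0 PA]].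
have mA' : measurable_fun setT (fun x => (\1_A x)%:E : \bar R).
  exact/measurable_EFinP.
have I0 : (\int[lebp]_t \int[lebpn n]_y (\1_A (cons_tuple t y))%:E = 0)%E.
  rewrite -(ge0_integral_lebp_cons1 mA')//.
  by rewrite integral_indic// setIT.
have mI : measurable_fun setT
    (fun t => \int[lebpn n]_y (\1_A (cons_tuple t y))%:E)%E.
  apply: (@measurable_fun_fubini_tonelli_F _ _ _ _ _ (lebpn n)
    ((fun x => (\1_A x)%:E) \o @cons_pair R n)).
    by apply: measurableT_comp => //; exact: measurable_cons_pair.
  by move=> x /=; rewrite lee_fin.
have : (\int[lebp]_t `|\int[lebpn n]_y (\1_A (cons_tuple t y))%:E| = 0)%E.
  rewrite -[RHS]I0; apply: eq_integral => t _; rewrite gee0_abs//.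
  by apply: integral_ge0 => y _; rewrite lee_fin.
move/(ae_eq_integral_abs _ measurableT mI); apply: filterS => t /(_ I).
have mB : measurable [set y | A (cons_tuple t y)].
  by rewrite -[X in measurable X]setTI; exact: measurable_cons_tuple2.
rewrite (_ : (fun y => _) = fun y => (\1_[set y | A (cons_tuple t y)] y)%:E); last first.
  by apply/funext => y; rewrite !indicE; congr (_%:R%:E); apply/idP/idP; rewrite !inE.
rewrite integral_indic// setIT => B0.
exists [set y | A (cons_tuple t y)]; split => // y /= nP; exact: PA.
Qed.

End tuple_integral.

(** * Fubini for real and complex functions on tuples *)

Section tuple_fubini.
Context {R : realType}.
Local Notation RT := (measurableTypeR R).

(** The inner integral on the right is a real number, with a default value where the extended
    integral is infinite. It agrees with the extended one of Fubini's theorem for almost every [y],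
    namely where the section is integrable. *)
Lemma Rintegral_lebp_cons n (h : n.+1.-tuple RT -> R) :
  (lebpn n.+1).-integrable setT (EFin \o h) ->
  \int[lebpn n.+1]_x h x = \int[lebpn n]_y \int[lebp]_t h (cons_tuple t y).
Proof.
move=> ih; have /integrableP[mh hoo] := ih.
have mc := @measurable_cons_pair R n.
have ihc : (lebp \x lebpn n)%E.-integrable setT (EFin \o h \o @cons_pair R n).
  apply/integrableP; split; first exact: measurableT_comp.
  move: hoo; rewrite [X in (X < _)%E -> _]ge0_integral_pushforward//.
  by apply: measurableT_comp => //; exact: measurable_normr.
rewrite /Rintegral [X in fine X](_ : _ =
    \int[lebpn n]_y \int[lebp]_t (h (cons_tuple t y))%:E)%E; last first.
  rewrite [LHS](integral_pushforward mc)//.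
  by rewrite -(integral21_prod_meas1 ihc).
congr fine; apply: ae_eq_integral => //.
- exact: (measurable_fubini_G ihc).
- apply/measurable_EFinP; apply: (measurableT_comp (f := fine)) => //.
  exact: (measurable_fubini_G ihc).
- have := ae_integrable2 ihc; apply: filterS => y iy _.
  by rewrite fineK//; exact: integrable_fin_num iy.
Qed.

Lemma cintegral_lebp_cons n (f : n.+1.-tuple RT -> R[i]) :
  cintegrable (lebpn n.+1) f ->
  cintegral (lebpn n.+1) f =
  cintegral (lebpn n) (fun y => cintegral lebp (fun t => f (cons_tuple t y))).
Proof. by move=> [if1 if2]; congr Complex; exact: Rintegral_lebp_cons. Qed.

Lemma cmeasurable_cons n (f : n.+1.-tuple RT -> R[i]) y :
  cmeasurable f -> cmeasurable (fun t => f (cons_tuple t y)).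
Proof.
by move=> [m1 m2]; split; [apply: (measurableT_comp m1)|apply: (measurableT_comp m2)];
  exact: measurable_cons_tuple1.
Qed.

Lemma cmeasurable_cintegral_cons n (f : n.+1.-tuple RT -> R[i]) :
  cmeasurable f ->
  cmeasurable (fun y => cintegral lebp (fun t => f (cons_tuple t y))).
Proof.
have H (h : n.+1.-tuple RT -> R) : measurable_fun setT h ->
    measurable_fun setT (fun y => \int[lebp]_t h (cons_tuple t y)).
  move=> mh; apply: (measurableT_comp (f := fine)) => //.
  have mh' : measurable_fun setT (EFin \o h) by exact/measurable_EFinP.
  rewrite (_ : (fun y => _) = (fun y => \int[lebp]_t (EFin \o h)^\+%E (cons_tuple t y))%E
    \- (fun y => \int[lebp]_t (EFin \o h)^\-%E (cons_tuple t y))%E)%E.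
    apply: emeasurable_funB; apply: measurable_integral_cons => //.
    - exact: measurable_funepos.
    - exact: measurable_funeneg.
  apply/funext => y; rewrite integralE; congr (_ - _)%E.
    by rewrite -[X in (\int[_]_x X^\+ x)%E]/((EFin \o h) \o (fun t => cons_tuple t y))
      funepos_comp.
  by rewrite -[X in (\int[_]_x X^\- x)%E]/((EFin \o h) \o (fun t => cons_tuple t y))
    funeneg_comp.
by move=> [m1 m2]; split; [exact: (H _ m1)|exact: (H _ m2)].
Qed.

Lemma ae_square_integrable_cons n (g : n.+1.-tuple RT -> R[i]) :
  square_integrable (lebpn n.+1) g ->
  \forall y \ae lebpn n,
    (\int[lebp]_t (abs2 (g (cons_tuple t y)))%:E < +oo)%E.
Proof.
move=> [mg g2].
have mG := measurable_integral_cons (measurable_eabs2 mg).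
have /integrable_ae : (lebpn n).-integrable setT
    (fun y => \int[lebp]_t (abs2 (g (cons_tuple t y)))%:E)%E.
  apply/integrableP; split; first by apply: mG => x; rewrite lee_fin abs2_ge0.
  move: g2; rewrite ge0_integral_lebp_cons//; last 2 first.
  - exact: measurable_eabs2.
  - by move=> x; rewrite lee_fin abs2_ge0.
  apply: le_lt_trans; rewrite le_eqVlt; apply/orP; left; apply/eqP.
  by apply: eq_integral => y _; rewrite gee0_abs//; exact: int_abs2_ge0.
move=> /(_ measurableT); apply: filterS => y /(_ I).
by rewrite ge0_fin_numE//; exact: int_abs2_ge0.
Qed.

End tuple_fubini.

(** * Square integrable functions *)

Section square_integrable.
Context {R : realType} d (T : measurableType d) (mu : {measure set T -> \bar R}).
Implicit Types f g : T -> R[i].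

(** Common core of the Cauchy-Schwarz inequalities for integrals and for abstract inner products:
    with a = |f|^2, b = |g|^2 and c = |<f,g>|^2, the quadratic in s is |g - s <f,g> f|^2. *)
Lemma le_mul_of_quadratic (a b c : R) : 0 <= c ->
  (forall s, 0 <= s ^+ 2 * c * a - 2 * s * c + b) -> 0 <= a -> c <= a * b.
Proof.
move=> c0 h; rewrite le_eqVlt => /orP[/eqP a0|a0].
  rewrite -a0 mul0r leNgt; apply/negP => c_gt0.
  (* For a = 0 the expression is affine in s, and this s gives it the value -1. *)
  have := h ((b + 1) / (2 * c)); rewrite -a0 mulr0 add0r.
  rewrite (_ : 2 * _ * c = b + 1); last by field; rewrite gt_eqF.
  lra.
(* The minimizer of the quadratic. *)
have := h a^-1.
rewrite (_ : _ + b = a^-1 * (a * b - c)); last by field; rewrite gt_eqF.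
by rewrite pmulr_rge0 ?invr_gt0// subr_ge0.
Qed.

Lemma cintegrable0 : cintegrable mu (fun=> 0).
Proof. by split; exact: integrable0. Qed.

Lemma cintegral0 : cintegral mu (fun=> 0) = 0.
Proof. by rewrite /cintegral /Rintegral !integral0. Qed.

Lemma cintegralZ a f : cintegrable mu f ->
  cintegral mu (fun x => a * f x) = a * cintegral mu f.
Proof.
move=> if_; rewrite -[RHS]addr0 -cintegral0 -cintegralP//; last exact: cintegrable0.
by apply: eq_cintegral => x; rewrite addr0.
Qed.

Lemma cintegralD f g : cintegrable mu f -> cintegrable mu g ->
  cintegral mu (fun x => f x + g x) = cintegral mu f + cintegral mu g.
Proof.
move=> if_ ig; rewrite -[X in X + _]mul1r -cintegralP//.
by apply: eq_cintegral => x; rewrite mul1r.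
Qed.

Lemma integrable_abs2 f : square_integrable mu f ->
  mu.-integrable setT (EFin \o (fun x => abs2 (f x))).
Proof.
move=> [mf f2]; apply/integrableP; split; first exact: measurable_eabs2.
by under eq_integral => x _ do rewrite /= ger0_norm ?abs2_ge0//.
Qed.

Lemma fin_num_int_abs2 f : square_integrable mu f ->
  (\int[mu]_x (abs2 (f x))%:E)%E \is a fin_num.
Proof. by move=> [_ f2]; rewrite ge0_fin_numE// int_abs2_ge0. Qed.

Lemma Rintegral_abs2_ge0 f : 0 <= \int[mu]_x abs2 (f x).
Proof. by rewrite fine_ge0// int_abs2_ge0. Qed.

Lemma Cauchy_Schwarz f g : square_integrable mu f -> square_integrable mu g ->
  abs2 (cintegral mu (fun x => conjc (f x) * g x)) <=
    (\int[mu]_x abs2 (f x)) * (\int[mu]_x abs2 (g x)).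
Proof.
move=> f2 g2; set c := cintegral _ _.
apply: le_mul_of_quadratic; [exact: abs2_ge0| |exact: Rintegral_abs2_ge0].
move=> s; have ic := cintegrable_conjM f2 g2.
have sg2 : square_integrable mu (fun x => - (s%:C * c) * f x + g x).
  by apply: square_integrableD => //; exact: square_integrableZ.
have := Rintegral_abs2_ge0 (fun x => - (s%:C * c) * f x + g x).
have iZ (k : R) (h : T -> R) : mu.-integrable setT (EFin \o h) ->
    mu.-integrable setT (EFin \o (fun x => k * h x)).
  by move=> ik; have := integrableZl measurableT k ik; exact: eq_integrable.
have iD (k l : T -> R) : mu.-integrable setT (EFin \o k) ->
    mu.-integrable setT (EFin \o l) ->
    mu.-integrable setT (EFin \o (fun x => k x + l x)).
  by move=> ik il; have := integrableD measurableT ik il; exact: eq_integrable.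
have E x : abs2 (- (s%:C * c) * f x + g x) =
    (s ^+ 2 * abs2 c) * abs2 (f x) + (- (2 * s) * complex.Re (conjc c * (conjc (f x) * g x))
      + abs2 (g x)).
  by case: (c) (f x) (g x) => c1 c2 [f1 f_2] [g1 g_2]; rewrite /abs2/=; ring.
under eq_Rintegral => x _ do rewrite E.
have ir : mu.-integrable setT
    (EFin \o (fun x => complex.Re (conjc c * (conjc (f x) * g x)))).
  rewrite (_ : (fun x => _) = (fun x => complex.Re c * complex.Re (conjc (f x) * g x)
     + complex.Im c * complex.Im (conjc (f x) * g x))).
    by apply: iD; apply: iZ; [exact: ic.1|exact: ic.2].
  by apply/funext => x; case: (c) (conjc (f x) * g x) => ? ? [? ?]/=; ring.
have i1 := integrable_abs2 f2; have i2 := integrable_abs2 g2.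
have i3 := iZ (s ^+ 2 * abs2 c) _ i1; have i4 := iZ (- (2 * s)) _ ir.
rewrite (RintegralD measurableT i3 (iD _ _ i4 i2)) (RintegralD measurableT i4 i2).
rewrite (RintegralZl _ measurableT i1) (RintegralZl _ measurableT ir).
rewrite -[X in _ + (_ * X + _)]/(complex.Re
  (cintegral mu (fun x => conjc c * (conjc (f x) * g x)))).
rewrite cintegralZ// -/c conjM_self/=.
by rewrite addrA mulNr.
Qed.

End square_integrable.

(** * Contraction with a one-particle function *)

Section contraction.
Context {R : realType}.
Local Notation RT := (measurableTypeR R).
Implicit Types z : RT -> R[i].

Lemma tensor_cons z n (w : n.-tuple RT -> R[i]) t y :
  tensor z w (cons_tuple t y) = z t * w y.
Proof. by rewrite /tensor thead_cons_tuple behead_cons_tuple. Qed.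

Lemma cmeasurable_tensor z n (w : n.-tuple RT -> R[i]) :
  cmeasurable z -> cmeasurable w -> cmeasurable (tensor z w).
Proof.
move=> [z1 z2] [w1 w2]; apply: (@cmeasurableM _ _ _ (fun x => z (thead x))
  (fun x : n.+1.-tuple RT => w [tuple of behead x])).
  by split; [apply: (measurableT_comp z1)|apply: (measurableT_comp z2)];
    exact: measurable_tnth.
by split; [apply: (measurableT_comp w1)|apply: (measurableT_comp w2)];
  exact: measurable_behead.
Qed.

Lemma int_abs2_tensor z n (w : n.-tuple RT -> R[i]) :
  cmeasurable z -> cmeasurable w ->
  (\int[lebpn n.+1]_x (abs2 (tensor z w x))%:E =
   \int[lebp]_t (abs2 (z t))%:E * \int[lebpn n]_y (abs2 (w y))%:E)%E.
Proof.
move=> mz mw; rewrite ge0_integral_lebp_cons//; last 2 first.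
- exact/measurable_eabs2/cmeasurable_tensor.
- by move=> x; rewrite lee_fin abs2_ge0.
under eq_integral => y _.
  under eq_integral => t _ do rewrite tensor_cons mulrC.
  rewrite int_abs2Z// muleC.
  over.
rewrite ge0_integralZl//; first exact: measurable_eabs2.
- by move=> x _; rewrite lee_fin abs2_ge0.
- exact: int_abs2_ge0.
Qed.

Lemma square_integrable_tensor z n (w : n.-tuple RT -> R[i]) :
  square_integrable lebp z -> square_integrable (lebpn n) w ->
  square_integrable (lebpn n.+1) (tensor z w).
Proof.
move=> z2 w2; split; first exact: cmeasurable_tensor z2.1 w2.1.
rewrite int_abs2_tensor; [|exact: z2.1|exact: w2.1].
by rewrite lte_mul_pinfty// ?int_abs2_ge0// ?fin_num_int_abs2//; exact: w2.2.
Qed.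

Definition section_L2 n (g : n.+1.-tuple RT -> R[i]) y :=
  `[< (\int[lebp]_t (abs2 (g (cons_tuple t y)))%:E < +oo)%E >].

(* Cut off where the section is not square integrable, so that the value 0 of a
   divergent integral does not spoil homogeneity at exceptional points. *)
Definition contraction z n (g : n.+1.-tuple RT -> R[i]) y : R[i] :=
  if section_L2 g y
  then cintegral lebp (fun t => conjc (z t) * g (cons_tuple t y)) else 0.

Lemma square_integrable_section n (g : n.+1.-tuple RT -> R[i]) y :
  cmeasurable g -> section_L2 g y ->
  square_integrable lebp (fun t => g (cons_tuple t y)).
Proof. by move=> mg /asboolP g2; split => //; exact: cmeasurable_cons. Qed.

(** Two functions at two points, possibly in different numbers of variables, are allowed so that the
    lemma yields both the antisymmetry of a contraction and its commutation with a tensor factor.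
    For a != 0 the two sections are square integrable together, so the cut-off respects the relation
    at every point; for a = 0 the contraction on the left is 0 whether it is cut off or not. *)
Lemma contractionZ z n m (g : n.+1.-tuple RT -> R[i]) (h : m.+1.-tuple RT -> R[i])
    a x y : square_integrable lebp z -> cmeasurable g -> cmeasurable h ->
  (forall t, g (cons_tuple t x) = a * h (cons_tuple t y)) ->
  contraction z g x = a * contraction z h y.
Proof.
move=> z2 mg mh gh; have [a0|a0] := eqVneq a 0.
  rewrite a0 mul0r /contraction (_ : (fun t => _) = (fun=> 0)) ?cintegral0 ?if_same//.
  by apply/funext => t; rewrite gh a0 mul0r mulr0.
have H (b : R[i]) (k l : RT -> R[i]) : cmeasurable l -> (forall t, k t = b * l t) ->
    (\int[lebp]_t (abs2 (l t))%:E < +oo)%E ->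
    (\int[lebp]_t (abs2 (k t))%:E < +oo)%E.
  move=> ml kl loo; under eq_integral => t _ do rewrite kl.
  by rewrite int_abs2Z// lte_mul_pinfty// lee_fin abs2_ge0.
have E : section_L2 g x = section_L2 h y.
  apply: asbool_equiv_eq; split.
    apply: (H a^-1) => [|t]; first exact: cmeasurable_cons.
    by rewrite gh mulKf.
  by apply: (H a) => //; exact: cmeasurable_cons.
rewrite /contraction E; case: ifPn => [h2|]; last by rewrite mulr0.
rewrite -cintegralZ; last exact: cintegrable_conjM z2 (square_integrable_section mh h2).
by apply: eq_cintegral => t; rewrite gh mulrCA.
Qed.

Lemma contraction_lin z n (g h : n.+1.-tuple RT -> R[i]) a y :
  square_integrable lebp z -> cmeasurable g -> cmeasurable h ->
  section_L2 g y -> section_L2 h y ->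
  section_L2 (fun x => a * g x + h x) y /\
  contraction z (fun x => a * g x + h x) y =
    a * contraction z g y + contraction z h y.
Proof.
move=> z2 mg mh g2 h2.
have sg := square_integrable_section mg g2.
have sh := square_integrable_section mh h2.
have L : section_L2 (fun x => a * g x + h x) y.
  by apply/asboolP; exact: (square_integrableD (square_integrableZ a sg) sh).2.
split; first exact: L.
rewrite /contraction L g2 h2 -cintegralP; try exact: cintegrable_conjM.
by apply: eq_cintegral => t; rewrite mulrDr mulrCA.
Qed.

Lemma contraction_tensor z z' n (w : n.-tuple RT -> R[i]) y :
  square_integrable lebp z -> square_integrable lebp z' ->
  section_L2 (tensor z' w) y /\
  contraction z (tensor z' w) y =
    cintegral lebp (fun t => conjc (z t) * z' t) * w y.
Proof.
move=> z2 z'2; have L : section_L2 (tensor z' w) y.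
  apply/asboolP; under eq_integral => t _ do rewrite tensor_cons mulrC.
  exact: (square_integrableZ (w y) z'2).2.
split; first exact: L.
rewrite /contraction L [RHS]mulrC -cintegralZ; last exact: cintegrable_conjM.
by apply: eq_cintegral => t; rewrite tensor_cons mulrA mulrC.
Qed.

Lemma cmeasurable_contraction z n (g : n.+1.-tuple RT -> R[i]) :
  cmeasurable z -> cmeasurable g -> cmeasurable (contraction z g).
Proof.
move=> mz mg.
have mS : measurable [set y : n.-tuple RT | section_L2 g y].
  have mI : measurable_fun setT
      (fun y => \int[lebp]_t (abs2 (g (cons_tuple t y)))%:E)%E.
    apply: (measurable_integral_cons (measurable_eabs2 mg)) => x.
    by rewrite lee_fin abs2_ge0.
  have := emeasurable_fun_infty_o measurableT mI +oo%E.
  by rewrite setTI; congr measurable; apply/seteqP; split => y /asboolP.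
have mzg : cmeasurable (fun x : n.+1.-tuple RT => conjc (z (thead x)) * g x).
  apply: cmeasurableM => //; apply: cmeasurable_conj.
  by case: mz => z1 z_2; split; [apply: (measurableT_comp z1)|apply: (measurableT_comp z_2)];
    exact: measurable_tnth.
have [m1 m2] := cmeasurable_cintegral_cons mzg.
have H (h : n.-tuple RT -> R) : measurable_fun setT h ->
    measurable_fun setT (fun y => if section_L2 g y then h y else 0).
  move=> mh; apply: measurable_fun_ifT => //.
  by apply: (measurable_fun_bool true); rewrite setTI.
split; [move: (H _ m1)|move: (H _ m2)]; congr (measurable_fun _ _);
  by apply/funext => y; rewrite /contraction; case: ifP.
Qed.

(** Cauchy-Schwarz in [t] for each [y], then Tonelli. *)
Lemma int_abs2_contraction z n (g : n.+1.-tuple RT -> R[i]) :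
  square_integrable lebp z -> square_integrable (lebpn n.+1) g ->
  (\int[lebpn n]_y (abs2 (contraction z g y))%:E <=
   \int[lebp]_t (abs2 (z t))%:E * \int[lebpn n.+1]_x (abs2 (g x))%:E)%E.
Proof.
move=> z2 g2.
have g0 x : (0 <= (abs2 (g x))%:E)%E by rewrite lee_fin abs2_ge0.
have mg := measurable_eabs2 g2.1.
have mG := measurable_integral_cons mg g0.
have G0 y : (0 <= \int[lebp]_t (abs2 (g (cons_tuple t y)))%:E)%E.
  exact: int_abs2_ge0.
rewrite [X in (_ <= _ * X)%E]ge0_integral_lebp_cons//.
rewrite -ge0_integralZl//; last exact: int_abs2_ge0.
apply: ge0_le_integral => //.
- by move=> y _; rewrite lee_fin abs2_ge0.
- exact/measurable_eabs2/cmeasurable_contraction/g2.1/z2.1.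
- exact: measurable_funeM.
move=> y _; rewrite /contraction; case: ifPn => [L|_]; last first.
  rewrite /abs2/= expr0n/= addr0 mule_ge0//; exact: int_abs2_ge0.
have sg := square_integrable_section g2.1 L.
rewrite -(fineK (fin_num_int_abs2 z2)) -(fineK (fin_num_int_abs2 sg)) -EFinM lee_fin.
exact: Cauchy_Schwarz.
Qed.

Lemma square_integrable_contraction z n (g : n.+1.-tuple RT -> R[i]) :
  square_integrable lebp z -> square_integrable (lebpn n.+1) g ->
  square_integrable (lebpn n) (contraction z g).
Proof.
move=> z2 g2; split; first exact: cmeasurable_contraction z2.1 g2.1.
apply: le_lt_trans (int_abs2_contraction z2 g2) _.
by rewrite -(fineK (fin_num_int_abs2 z2)) -(fineK (fin_num_int_abs2 g2)) -EFinM ltry.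
Qed.

(** Fubini in the first variable. The cut-off in [contraction] is active only on a null set of [y],
    since [g] is square integrable. *)
Lemma contraction_adjoint z n (w : n.-tuple RT -> R[i]) (g : n.+1.-tuple RT -> R[i]) :
  square_integrable lebp z -> square_integrable (lebpn n) w ->
  square_integrable (lebpn n.+1) g ->
  cintegral (lebpn n.+1) (fun x => conjc (tensor z w x) * g x) =
  cintegral (lebpn n) (fun y => conjc (w y) * contraction z g y).
Proof.
move=> z2 w2 g2; have t2 := square_integrable_tensor z2 w2.
rewrite cintegral_lebp_cons; last exact: cintegrable_conjM.
apply: ae_eq_cintegral.
- apply: (cmeasurable_cintegral_cons (f := fun x => conjc (tensor z w x) * g x)).
  by apply: cmeasurableM; [exact/cmeasurable_conj/t2.1|exact: g2.1].
- apply: cmeasurableM; first exact/cmeasurable_conj/w2.1.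
  exact: cmeasurable_contraction z2.1 g2.1.
have := ae_square_integrable_cons g2; apply: filterS => y L.
rewrite /contraction (_ : section_L2 g y = true); last exact/asboolP.
rewrite -cintegralZ; last first.
  apply: cintegrable_conjM => //; apply: square_integrable_section; first exact: g2.1.
  exact/asboolP.
by apply: eq_cintegral => t; rewrite tensor_cons rmorphM/= mulrA [X in X * _]mulrC.
Qed.

End contraction.

(** * Antisymmetrization *)

Section antisymmetrization.
Context {R : realType}.
Local Notation RT := (measurableTypeR R).

(** Permuting inside [f] is a left translation of the sum over the symmetric group; permuting the
    variables of the result, as in the next lemma, is a right translation. *)
Lemma antisymmetrization_perm n (f : n.-tuple RT -> R[i]) (s : 'S_n) x :
  antisymmetrization (fun x => f (perm_tuple s x)) x =
  (-1) ^+ s * antisymmetrization f x.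
Proof.
rewrite /antisymmetrization mulrCA; congr (_ * _).
rewrite mulr_sumr [RHS](reindex_inj (mulgI s)); apply: eq_bigr => t _ /=.
by rewrite perm_tupleM odd_permM signr_addb -mulrA signrMK.
Qed.

Lemma antisymmetric_antisymmetrization n (f : n.-tuple RT -> R[i]) :
  antisymmetric_fun (antisymmetrization f).
Proof.
move=> s x; rewrite /antisymmetrization mulrCA; congr (_ * _).
rewrite mulr_sumr [RHS](reindex_inj (mulIg s)); apply: eq_bigr => t _ /=.
by rewrite perm_tupleM odd_permM addbC signr_addb -mulrA signrMK.
Qed.

Lemma antisymmetrization_sum n (I : finType) (c : I -> R[i])
    (f : I -> n.-tuple RT -> R[i]) x :
  antisymmetrization (fun x => \sum_i c i * f i x) x =
  \sum_i c i * antisymmetrization (f i) x.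
Proof.
rewrite /antisymmetrization mulr_sumr.
under eq_bigr => s _ do rewrite !mulr_sumr.
rewrite exchange_big/=; apply: eq_bigr => i _.
rewrite !mulr_sumr; apply: eq_bigr => s _.
by rewrite [in RHS]mulrCA; congr (_ * _); rewrite mulrCA.
Qed.

Lemma cintegrable_sum d (T : measurableType d) (mu : {measure set T -> \bar R})
    (I : Type) (r : seq I) (f : I -> T -> R[i]) :
  (forall i, cintegrable mu (f i)) -> cintegrable mu (fun x => \sum_(i <- r) f i x).
Proof.
move=> fi; elim: r => [|i r [IH1 IH2]].
  by rewrite (_ : (fun x => _) = (fun=> 0)); [exact: cintegrable0|
    apply/funext => x; rewrite big_nil].
have [f1 f2] := fi i.
have D (k l : T -> R) : mu.-integrable setT (EFin \o k) ->
    mu.-integrable setT (EFin \o l) ->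
    mu.-integrable setT (EFin \o (fun x => k x + l x)).
  by move=> ik il; have := integrableD measurableT ik il; exact: eq_integrable.
split.
- move: (D _ _ f1 IH1); congr (integrable _ _ _); apply/funext => x /=.
  by rewrite big_cons; case: (f i x) (\sum_(_ <- _) _) => ? ? [].
- move: (D _ _ f2 IH2); congr (integrable _ _ _); apply/funext => x /=.
  by rewrite big_cons; case: (f i x) (\sum_(_ <- _) _) => ? ? [].
Qed.

Lemma cintegral_sum d (T : measurableType d) (mu : {measure set T -> \bar R})
    (I : Type) (r : seq I) (f : I -> T -> R[i]) :
  (forall i, cintegrable mu (f i)) ->
  cintegral mu (fun x => \sum_(i <- r) f i x) = \sum_(i <- r) cintegral mu (f i).
Proof.
move=> fi; elim: r => [|i r IH].
  rewrite big_nil -[RHS](cintegral0 mu).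
  by apply: eq_cintegral => x; rewrite big_nil.
rewrite big_cons -IH -cintegralD//; last exact: cintegrable_sum.
by apply: eq_cintegral => x; rewrite big_cons.
Qed.

Lemma square_integrable_sum d (T : measurableType d) (mu : {measure set T -> \bar R})
    (I : Type) (r : seq I) (c : I -> R[i]) (f : I -> T -> R[i]) :
  (forall i, square_integrable mu (f i)) ->
  square_integrable mu (fun x => \sum_(i <- r) c i * f i x).
Proof.
move=> fi; elim: r => [|i r IH].
  rewrite (_ : (fun x => _) = (fun=> 0)); first exact: square_integrable0.
  by apply/funext => x; rewrite big_nil.
rewrite (_ : (fun x => _) = (fun x => c i * f i x + \sum_(j <- r) c j * f j x)).
  by apply: square_integrableD => //; exact: square_integrableZ.
by apply/funext => x; rewrite big_cons.
Qed.

Lemma square_integrable_antisymmetrization n (f : n.-tuple RT -> R[i]) :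
  square_integrable (lebpn n) f ->
  square_integrable (lebpn n) (antisymmetrization f).
Proof.
move=> f2; apply: square_integrableZ; apply: square_integrable_sum => s.
exact: square_integrable_perm.
Qed.

(** Antisymmetry of [g] turns each sign times g(x) into g at the permuted point. The n! integrals
    are then equal by permutation invariance of the measure, and their average is any one of
    them. *)
Lemma cintegral_antisymmetrization n (f g : n.-tuple RT -> R[i]) :
  square_integrable (lebpn n) f -> Lambda g ->
  cintegral (lebpn n) (fun x => conjc (antisymmetrization f x) * g x) =
  cintegral (lebpn n) (fun x => conjc (f x) * g x).
Proof.
move=> f2 [g2 ga].
have ifg s : cintegrable (lebpn n)
    (fun x => conjc (f (perm_tuple s x)) * g (perm_tuple s x)).
  exact: cintegrable_conjM (square_integrable_perm s f2) (square_integrable_perm s g2).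
transitivity (cintegral (lebpn n) (fun x => (n`!)%:R^-1 *
    \sum_(s : 'S_n) conjc (f (perm_tuple s x)) * g (perm_tuple s x))).
  apply: eq_cintegral => x; rewrite rmorphM/= fmorphV/= conjc_nat -mulrA; congr (_ * _).
  rewrite rmorph_sum/= mulr_suml; apply: eq_bigr => s _.
  by rewrite rmorphM rmorph_sign ga -mulrA mulrCA.
rewrite cintegralZ; last exact: cintegrable_sum.
rewrite cintegral_sum//.
rewrite (eq_bigr (fun=> cintegral (lebpn n) (fun x => conjc (f x) * g x))); last first.
  move=> s _; apply: (cintegral_perm s (f := fun x => conjc (f x) * g x)).
  by apply: cmeasurableM; [exact/cmeasurable_conj/f2.1|exact: g2.1].
rewrite sumr_const card_Sn -[X in _ * X]mulr_natl mulrA mulVf ?mul1r//.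
Qed.

End antisymmetrization.

(** * Creation and annihilation on n-particle functions *)

Section particle_operators.
Context {R : realType}.
Local Notation RT := (measurableTypeR R).
Implicit Types z : RT -> R[i].

Definition create z n (w : n.-tuple RT -> R[i]) : n.+1.-tuple RT -> R[i] :=
  antisymmetrization (tensor z w).

(** The factor n+1 is the ratio of the weights (n+1)! and n! in the inner products of the two
    degrees. *)
Definition annihilate z n (g : n.+1.-tuple RT -> R[i]) : n.-tuple RT -> R[i] :=
  fun y => (n.+1)%:R * contraction z g y.

(** The cycle that brings coordinate [i] to the front and keeps the order of the others; its sign is
    (-1)^i. *)
Definition to_front n (i : 'I_n.+1) : 'S_n.+1 := lift_perm ord0 i 1%g.

Definition remove n (i : 'I_n.+1) (x : n.+1.-tuple RT) : n.-tuple RT :=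
  [tuple tnth x (lift i k) | k < n].

Lemma tensorE z n (w : n.-tuple RT -> R[i]) (s : 'S_n.+1) x :
  tensor z w (perm_tuple s x) =
  z (tnth x (s ord0)) * w [tuple tnth x (s (lift ord0 k)) | k < n].
Proof.
rewrite /tensor; congr (z _ * w _).
  by rewrite /thead tnth_perm_tuple.
apply: eq_from_tnth => k; rewrite tnth_mktuple -tnth_perm_tuple.
by rewrite [in RHS](tuple_eta (perm_tuple s x)) tnthS.
Qed.

Lemma tensor_to_front z n (w : n.-tuple RT -> R[i]) i x :
  tensor z w (perm_tuple (to_front i) x) = z (tnth x i) * w (remove i x).
Proof.
rewrite tensorE lift_perm_id; congr (_ * w _); apply: eq_from_tnth => k.
by rewrite !tnth_mktuple lift_perm_lift perm1.
Qed.

Lemma tensor_lift_perm z n (w : n.-tuple RT -> R[i]) s x :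
  tensor z w (perm_tuple (lift_perm ord0 ord0 s) x) =
  tensor z (fun y => w (perm_tuple s y)) x.
Proof.
rewrite tensorE lift_perm_id; congr (_ * w _).
apply: eq_from_tnth => k; rewrite tnth_perm_tuple tnth_mktuple lift_perm_lift.
by rewrite [in LHS](tuple_eta x) tnthS.
Qed.

(** A permutation of n+1 points amounts to the image of the first point and a permutation of the
    remaining n. Injectivity is enough, the cardinals being (n+1) n! and (n+1)!. *)
Lemma lift_perm_bij n :
  bijective (fun p : 'I_n.+1 * 'S_n => lift_perm ord0 p.1 p.2).
Proof.
apply: inj_card_bij; last by rewrite card_prod !card_Sn card_ord factS.
move=> [i s] [j t] /= E.
have ij : i = j by have := congr1 (fun u : 'S_n.+1 => u ord0) E; rewrite !lift_perm_id.
rewrite -ij in E *; congr (_, _); apply/permP => k.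
have := congr1 (fun u : 'S_n.+1 => u (lift ord0 k)) E.
by rewrite !lift_perm_lift => /lift_inj.
Qed.

(** As in a Laplace expansion, the permutations are grouped by the image [i] of the first index.
    Antisymmetry of [w] makes the n! terms of a group equal, and n!/(n+1)! leaves the weight
    1/(n+1). *)
Lemma createE z n (w : n.-tuple RT -> R[i]) x : antisymmetric_fun w ->
  create z w x = \sum_(i < n.+1)
    ((n.+1)%:R^-1 * (-1) ^+ i) * tensor z w (perm_tuple (to_front i) x).
Proof.
move=> wa; rewrite /create /antisymmetrization.
rewrite (reindex (fun p : 'I_n.+1 * 'S_n => lift_perm ord0 p.1 p.2)); last first.
  exact/onW_bij/lift_perm_bij.
have E (p : 'I_n.+1 * 'S_n) : true ->
    (-1) ^+ lift_perm ord0 p.1 p.2 *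
      tensor z w (perm_tuple (lift_perm ord0 p.1 p.2) x) =
    (-1) ^+ p.1 * tensor z w (perm_tuple (to_front p.1) x).
  case: p => i s _ /=; rewrite odd_lift_perm/= signr_addb signr_odd -mulrA; congr (_ * _).
  (* The first factor fixes the variable of [z], so it only permutes those of [w], and its sign
     cancels the one that [w] produces. *)
  rewrite (_ : lift_perm _ _ _ = lift_perm ord0 ord0 s * to_front i)%g; last first.
    by rewrite lift_permM mulg1.
  rewrite -perm_tupleM tensor_lift_perm /tensor wa.
  by rewrite [X in _ * X]mulrCA signrMK.
rewrite (eq_bigr _ E) -(pair_bigA _ (fun (i : 'I_n.+1) (s : 'S_n) =>
  (-1) ^+ i * tensor z w (perm_tuple (to_front i) x)))/=.
rewrite mulr_sumr; apply: eq_bigr => i _.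
rewrite sumr_const card_Sn -[X in _ * X]mulr_natr factS natrM invfM -[LHS]mulrA.
rewrite [X in _ * X]mulrCA mulVf; first by rewrite mulr1 mulrA.
by rewrite pnatr_eq0 -lt0n fact_gt0.
Qed.

Lemma Lambda_create z n (w : n.-tuple RT -> R[i]) :
  square_integrable lebp z -> Lambda w -> Lambda (create z w).
Proof.
move=> z2 [w2 _]; split; last exact: antisymmetric_antisymmetrization.
exact/square_integrable_antisymmetrization/square_integrable_tensor.
Qed.

Lemma perm_tuple_cons n (s : 'S_n) t (y : n.-tuple RT) :
  cons_tuple t (perm_tuple s y) =
  perm_tuple (lift_perm ord0 ord0 s) (cons_tuple t y).
Proof.
apply: eq_from_tnth => i; rewrite tnth_perm_tuple.
case: (unliftP ord0 i) => [j|] ->; last by rewrite lift_perm_id.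
by rewrite lift_perm_lift !tnthS tnth_perm_tuple.
Qed.

Lemma contraction_antisymmetric z n (g : n.+1.-tuple RT -> R[i]) :
  square_integrable lebp z -> Lambda g -> antisymmetric_fun (contraction z g).
Proof.
move=> z2 [g2 ga] s x; apply: contractionZ => // [||t].
- exact: g2.1.
- exact: g2.1.
by rewrite perm_tuple_cons ga odd_lift_perm.
Qed.

Lemma Lambda_contraction z n (g : n.+1.-tuple RT -> R[i]) :
  square_integrable lebp z -> Lambda g -> Lambda (contraction z g).
Proof.
move=> z2 Lg; split; last exact: contraction_antisymmetric.
exact: square_integrable_contraction z2 Lg.1.
Qed.

Lemma LambdaZ n a (g : n.-tuple RT -> R[i]) :
  Lambda g -> Lambda (fun x => a * g x).
Proof.
move=> Lg; move: (LambdaP a Lg (Lambda0 _)); congr Lambda.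
by apply/funext => x; rewrite addr0.
Qed.

Lemma Lambda_annihilate z n (g : n.+1.-tuple RT -> R[i]) :
  square_integrable lebp z -> Lambda g -> Lambda (annihilate z g).
Proof. by move=> z2 Lg; exact/LambdaZ/Lambda_contraction. Qed.

(** Against an antisymmetric function the antisymmetrization drops out; Fubini then turns the tensor
    product into a contraction, and (n+1)! = (n+1) n! supplies the factor of [annihilate]. *)
Lemma create_adjoint z n (w : n.-tuple RT -> R[i]) (g : n.+1.-tuple RT -> R[i]) :
  square_integrable lebp z -> Lambda w -> Lambda g ->
  Lambda_dot (create z w) g = Lambda_dot w (annihilate z g).
Proof.
move=> z2 Lw Lg; rewrite /Lambda_dot /create cintegral_antisymmetrization//; last first.
  exact: square_integrable_tensor Lw.1.
rewrite contraction_adjoint//; [|exact: Lw.1|exact: Lg.1].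
rewrite (_ : (fun x => conjc (w x) * annihilate z g x) =
  (fun x => (n.+1)%:R * (conjc (w x) * contraction z g x))).
  rewrite cintegralZ; last first.
    exact: cintegrable_conjM Lw.1 (square_integrable_contraction z2 Lg.1).
  by rewrite factS natrM mulrA [X in _ = X * _]mulrC.
by apply/funext => x; rewrite /annihilate mulrCA.
Qed.

Lemma contraction_sum z n (I : Type) (r : seq I) (c : I -> R[i])
    (g : I -> n.+1.-tuple RT -> R[i]) y :
  square_integrable lebp z -> (forall i, cmeasurable (g i)) ->
  (forall i, section_L2 (g i) y) ->
  [/\ cmeasurable (fun x => \sum_(i <- r) c i * g i x),
    section_L2 (fun x => \sum_(i <- r) c i * g i x) y &
    contraction z (fun x => \sum_(i <- r) c i * g i x) y =
    \sum_(i <- r) c i * contraction z (g i) y].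
Proof.
move=> z2 mg g2; elim: r => [|i r [IH1 IH2 IH3]].
  have -> : (fun x => \sum_(i <- [::]) c i * g i x) = (fun=> 0).
    by apply/funext => x; rewrite big_nil.
  have L : section_L2 (fun=> 0 : R[i]) y.
    by apply/asboolP; exact: (square_integrable0 _).2.
  split; [exact: cmeasurable_cst _ 0|exact: L|].
  rewrite big_nil /contraction L -[RHS](cintegral0 lebp).
  by apply: eq_cintegral => t; rewrite mulr0.
have -> : (fun x => \sum_(j <- i :: r) c j * g j x) =
    (fun x => c i * g i x + \sum_(j <- r) c j * g j x).
  by apply/funext => x; rewrite big_cons.
have [h1 h2] := contraction_lin (c i) z2 (mg i) IH1 (g2 i) IH2.
split; [|exact: h1|by rewrite big_cons h2 IH3].
by apply: cmeasurableD => //; apply: cmeasurableM => //; exact: cmeasurable_cst.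
Qed.

End particle_operators.

(** * Canonical anticommutation relations in a fixed degree *)

Section anticommutation.
Context {R : realType}.
Local Notation RT := (measurableTypeR R).
Implicit Types z : RT -> R[i].

Lemma ae_eq_Lambda_dot n (f g g' : n.-tuple RT -> R[i]) :
  Lambda f -> Lambda g -> Lambda g' ->
  (\forall x \ae lebpn n, g x = g' x) -> Lambda_dot f g = Lambda_dot f g'.
Proof.
move=> [[mf _] _] [[mg _] _] [[mg' _] _] gg'; congr (_ * _).
apply: ae_eq_cintegral; try by apply: cmeasurableM => //; exact: cmeasurable_conj.
by apply: filterS gg' => x ->.
Qed.

Lemma Lambda_dotZr n a (f g : n.-tuple RT -> R[i]) : Lambda f -> Lambda g ->
  Lambda_dot f (fun x => a * g x) = a * Lambda_dot f g.
Proof.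
move=> Lf Lg; rewrite /Lambda_dot [RHS]mulrCA; congr (_ * _).
rewrite -cintegralZ; last exact: cintegrable_conjM Lf.1 Lg.1.
by apply: eq_cintegral => x; rewrite mulrCA.
Qed.

Lemma to_front0 n : @to_front n ord0 = 1%g.
Proof. exact: lift_perm1. Qed.

Lemma remove_cons n (j : 'I_n.+1) t (y : n.+1.-tuple RT) :
  remove (lift ord0 j) (cons_tuple t y) = cons_tuple t (remove j y).
Proof.
apply: eq_from_tnth => k; rewrite tnth_mktuple.
case: (unliftP ord0 k) => [i|] ->.
  rewrite tnthS tnth_mktuple (_ : lift (lift ord0 j) (lift ord0 i) = lift ord0 (lift j i)).
    by rewrite tnthS.
  by apply/val_inj => /=; rewrite /bump !leq0n !add1n ltnS addnS.
by rewrite (_ : lift (lift ord0 j) ord0 = ord0)//; exact/val_inj.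
Qed.

(** When [z] receives a variable other than the first, the integration falls on [w] and leaves that
    factor alone: removing variable j+1 after prepending [t] is prepending [t] after removing
    variable j. *)
Lemma contraction_to_front z n (w : n.+1.-tuple RT -> R[i]) (j : 'I_n.+1) y :
  square_integrable lebp z -> square_integrable (lebpn n.+1) w ->
  contraction z (fun x => tensor z w (perm_tuple (to_front (lift ord0 j)) x)) y =
  tensor z (contraction z w) (perm_tuple (to_front j) y).
Proof.
move=> z2 w2; rewrite tensor_to_front; apply: contractionZ => // [||t].
- exact: cmeasurable_perm (cmeasurable_tensor z2.1 w2.1).
- exact: w2.1.
- by rewrite tensor_to_front remove_cons tnthS.
Qed.

Lemma contraction_to_front0 z n (w : n.-tuple RT -> R[i]) y :
  contraction z (fun x => tensor z w (perm_tuple (to_front ord0) x)) y =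
  contraction z (tensor z w) y.
Proof.
congr (contraction z _ y); apply/funext => x.
by rewrite to_front0 perm_tuple1.
Qed.

(** The factor n+1 cancels the weight in [createE]. The identity is asserted almost everywhere
    because [contraction] is split over the sum at points where the sections of all the terms are
    square integrable. *)
Lemma ae_annihilate_create z n (w : n.-tuple RT -> R[i]) :
  square_integrable lebp z -> Lambda w ->
  \forall y \ae lebpn n, annihilate z (create z w) y =
    \sum_(i < n.+1) (-1) ^+ i *
      contraction z (fun x => tensor z w (perm_tuple (to_front i) x)) y.
Proof.
move=> z2 [w2 wa].
have G2 i : square_integrable (lebpn n.+1)
    (fun x => tensor z w (perm_tuple (to_front i) x)).
  exact/square_integrable_perm/square_integrable_tensor.
have : \forall y \ae lebpn n, forall i, section_L2
    (fun x => tensor z w (perm_tuple (@to_front n i) x)) y.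
  apply: filter_forall => i; have := ae_square_integrable_cons (G2 i).
  by apply: filterS => y ?; exact/asboolP.
apply: filterS => y Ly; rewrite /annihilate.
have -> : create z w = fun x => \sum_(i < n.+1)
    ((n.+1)%:R^-1 * (-1) ^+ i) * tensor z w (perm_tuple (to_front i) x).
  by apply/funext => x; exact: createE.
have [_ _ ->] := contraction_sum (index_enum _)
  (fun i : 'I_n.+1 => (n.+1)%:R^-1 * (-1) ^+ i) z2 (fun i => (G2 i).1) Ly.
rewrite mulr_sumr; apply: eq_bigr => i _.
by rewrite -[in LHS]mulrA mulrA divff ?mul1r// pnatr_eq0.
Qed.

Lemma create_annihilateE z n (w : n.+1.-tuple RT -> R[i]) y :
  square_integrable lebp z -> Lambda w ->
  create z (annihilate z w) y =
    \sum_(j < n.+1) (-1) ^+ j *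
      tensor z (contraction z w) (perm_tuple (to_front j) y).
Proof.
move=> z2 Lw; rewrite createE; last by have [] := Lambda_annihilate z2 Lw.
apply: eq_bigr => j _; rewrite !tensor_to_front /annihilate.
rewrite [_%:R^-1 * _]mulrC -!mulrA; congr (_ * _).
by rewrite [z _ * _]mulrCA [LHS]mulrA mulVf ?mul1r// pnatr_eq0.
Qed.

(** Term 0 of the first expansion contracts [z] with itself and gives |z|^2 w; its term j+1 is the
    negative of term j of the second expansion. *)
Lemma ae_anticommutation z n (w : n.+1.-tuple RT -> R[i]) :
  square_integrable lebp z -> Lambda w ->
  \forall y \ae lebpn n.+1,
    annihilate z (create z w) y + create z (annihilate z w) y =
    cintegral lebp (fun t => conjc (z t) * z t) * w y.
Proof.
move=> z2 Lw; apply: filterS (ae_annihilate_create z2 Lw) => y ->.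
rewrite create_annihilateE// big_ord_recl expr0 mul1r.
rewrite contraction_to_front0.
have [_ ->] := contraction_tensor w y z2 z2.
rewrite -addrA -big_split big1 ?addr0// => j _ /=.
rewrite (contraction_to_front _ _ z2 Lw.1).
by rewrite /bump leq0n add1n exprS mulN1r mulNr addNr.
Qed.

Lemma ae_annihilate_create0 z (w : 0.-tuple RT -> R[i]) :
  square_integrable lebp z -> Lambda w ->
  \forall y \ae lebpn 0, annihilate z (create z w) y =
    cintegral lebp (fun t => conjc (z t) * z t) * w y.
Proof.
move=> z2 Lw; apply: filterS (ae_annihilate_create z2 Lw) => y ->.
rewrite big_ord_recl big_ord0 addr0 expr0 mul1r.
rewrite contraction_to_front0.
by have [_ ->] := contraction_tensor w y z2 z2.
Qed.

(** Adjointness moves both terms onto [w], where the relation holds almost everywhere. In this weak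
    form it can be summed over the degrees and, for v = w, bounds both operators. *)
Lemma Lambda_dot_anticommutation z n (v w : n.+1.-tuple RT -> R[i]) :
  square_integrable lebp z -> Lambda v -> Lambda w ->
  Lambda_dot (create z v) (create z w) +
    Lambda_dot (annihilate z v) (annihilate z w) =
  cintegral lebp (fun t => conjc (z t) * z t) * Lambda_dot v w.
Proof.
move=> z2 Lv Lw.
have Lav := Lambda_annihilate z2 Lv; have Law := Lambda_annihilate z2 Lw.
have Lcw := Lambda_create z2 Lw; have Lac := Lambda_annihilate z2 Lcw.
have Lca := Lambda_create z2 Law.
rewrite create_adjoint// (Lambda_dotC Law Lav) -(create_adjoint z2 Law Lv).
rewrite -(Lambda_dotC Lca Lv) -[X in X + _]mul1r -Lambda_dotPr//.
rewrite -Lambda_dotZr//; apply: ae_eq_Lambda_dot => //.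
- exact: LambdaP.
- exact: LambdaZ.
by apply: filterS (ae_anticommutation z2 Lw) => y; rewrite mul1r.
Qed.

Lemma Lambda_dot_create0 z (v w : 0.-tuple RT -> R[i]) :
  square_integrable lebp z -> Lambda v -> Lambda w ->
  Lambda_dot (create z v) (create z w) =
  cintegral lebp (fun t => conjc (z t) * z t) * Lambda_dot v w.
Proof.
move=> z2 Lv Lw; have Lcw := Lambda_create z2 Lw.
rewrite create_adjoint// -Lambda_dotZr//; apply: ae_eq_Lambda_dot => //.
- exact: Lambda_annihilate.
- exact: LambdaZ.
- exact: ae_annihilate_create0.
Qed.

Lemma antisymmetrization_tensor_tensor z n (w : n.-tuple RT -> R[i]) x :
  antisymmetrization (tensor z (tensor z w)) x = 0.
Proof.
pose s := tperm (@ord0 n.+1) (lift ord0 ord0).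
have E y : tensor z (tensor z w) (perm_tuple s y) = tensor z (tensor z w) y.
  rewrite tensorE tpermL /tensor mulrA [in RHS]mulrA; congr (_ * w _).
    rewrite mulrC; congr (z _ * z _).
    - by rewrite /thead tnth_mktuple tpermR.
    - by rewrite [in LHS](tuple_eta y) tnthS.
  apply: eq_from_tnth => k; rewrite !tnth_behead !tnth_mktuple.
  have inordS m (i : 'I_m) : inord i.+1 = lift ord0 i :> 'I_m.+1.
    by apply/val_inj; rewrite /= inordK// ltnS.
  by rewrite !inordS tpermD// -val_eqE/= /bump !leq0n.
have := antisymmetrization_perm (tensor z (tensor z w)) s x.
rewrite (_ : (fun x => _) = tensor z (tensor z w)); last exact/funext.
rewrite odd_tperm /= mulN1r => /eqP.
by rewrite -addr_eq0 -mulr2n mulrn_eq0/= => /eqP.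
Qed.

(** The inner antisymmetrization permutes all variables but the first. The outer one absorbs each
    such permutation up to a sign, so only antisymmetrizations of the tensor product with [z] twice
    remain. *)
Lemma create_create z n (w : n.-tuple RT -> R[i]) x : create z (create z w) x = 0.
Proof.
rewrite /create.
have -> : tensor z (antisymmetrization (tensor z w)) = fun x =>
    \sum_(s : 'S_n.+1) ((n.+1)`!%:R^-1 * (-1) ^+ s) *
      tensor z (tensor z w) (perm_tuple (lift_perm ord0 ord0 s) x).
  apply/funext => y; rewrite {1}/tensor /antisymmetrization mulrCA !mulr_sumr.
  apply: eq_bigr => s _; rewrite tensor_lift_perm [in RHS]/tensor -!mulrA.
  by congr (_ * _); rewrite mulrCA.
rewrite antisymmetrization_sum big1// => s _.
by rewrite antisymmetrization_perm antisymmetrization_tensor_tensor !mulr0.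
Qed.

End anticommutation.

(** * Creation and annihilation on the Fock space *)

Section fock_operators.
Context {R : realType}.
Local Notation RT := (measurableTypeR R).
Implicit Types (z : RT -> R[i]) (u v : fock R) (F : fockfun R).

Definition norm2 z : R[i] := cintegral lebp (fun t => conjc (z t) * z t).

Lemma norm2E z : norm2 z = (\int[lebp]_t abs2 (z t))%:C.
Proof. exact: cintegral_conjM_self. Qed.

Lemma fine_Lambda_norm2_create z n (w : n.-tuple RT -> R[i]) :
  square_integrable lebp z -> Lambda w ->
  fine (Lambda_norm2 (create z w)) <=
    (\int[lebp]_t abs2 (z t)) * fine (Lambda_norm2 w).
Proof.
move=> z2; case: n w => [|n] w Lw; have Lc := Lambda_create z2 Lw.
  have := Lambda_dot_create0 z2 Lw Lw.
  rewrite !Lambda_dot_self// -/(norm2 z) norm2E -rmorphM/= => /(congr1 (@complex.Re R))/= ->.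
  exact: lexx.
have La := Lambda_annihilate z2 Lw.
have := Lambda_dot_anticommutation z2 Lw Lw.
rewrite !Lambda_dot_self// -/(norm2 z) norm2E -rmorphM -rmorphD.
move=> /(congr1 (@complex.Re R))/= <-.
by rewrite lerDl fine_ge0// Lambda_norm2_ge0.
Qed.

Lemma fine_Lambda_norm2_annihilate z n (w : n.+1.-tuple RT -> R[i]) :
  square_integrable lebp z -> Lambda w ->
  fine (Lambda_norm2 (annihilate z w)) <=
    (\int[lebp]_t abs2 (z t)) * fine (Lambda_norm2 w).
Proof.
move=> z2 Lw; have Lc := Lambda_create z2 Lw.
have La := Lambda_annihilate z2 Lw.
have := Lambda_dot_anticommutation z2 Lw Lw.
rewrite !Lambda_dot_self// -/(norm2 z) norm2E -rmorphM -rmorphD.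
move=> /(congr1 (@complex.Re R))/= <-.
by rewrite lerDr fine_ge0// Lambda_norm2_ge0.
Qed.

Definition fock_create z F : fockfun R := fun n =>
  match n return n.-tuple RT -> R[i] with
  | 0 => fun=> 0
  | m.+1 => create z (F m)
  end.

Definition fock_annihilate z F : fockfun R := fun n => annihilate z (F n.+1).

Local Arguments fock_create z F n x : clear implicits.
Local Arguments fock_annihilate z F n x : clear implicits.

Lemma nneseriesS (a : nat -> \bar R) : (forall n, 0 <= a n)%E ->
  (\sum_(0 <= n <oo) a n = a 0%N + \sum_(0 <= n <oo) a n.+1)%E.
Proof.
move=> a0; rewrite nneseries_recl//; congr (_ + _)%E.
rewrite -nneseries_addn//; congr (limn _); apply/funext => n.
by apply: eq_bigr => i _; rewrite addn1.
Qed.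

Lemma is_fock_create z F : square_integrable lebp z -> is_fock F ->
  is_fock (fock_create z F).
Proof.
move=> z2 fF; have [LF F2] := fF.
split=> [[|n]|]; [exact: Lambda0|exact: Lambda_create|].
rewrite nneseriesS; last by move=> n; exact: Lambda_norm2_ge0.
apply: lte_add_pinfty.
  by rewrite -ge0_fin_numE ?Lambda_norm2_ge0//; exact/Lambda_norm2_fin/Lambda0.
apply: (@le_lt_trans _ _ ((\int[lebp]_t abs2 (z t))%:E *
  \sum_(0 <= n <oo) Lambda_norm2 (F n))%E); last first.
  by rewrite lte_mul_pinfty// lee_fin Rintegral_abs2_ge0.
rewrite -nneseriesZl//; last by move=> n _; exact: Lambda_norm2_ge0.
apply: lee_nneseries => n *; first exact: Lambda_norm2_ge0.
have Lc := Lambda_create z2 (LF n).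
rewrite /= -(fineK (Lambda_norm2_fin (LF n))) -(fineK (Lambda_norm2_fin Lc)).
by rewrite -EFinM lee_fin fine_Lambda_norm2_create.
Qed.

Lemma is_fock_annihilate z F : square_integrable lebp z -> is_fock F ->
  is_fock (fock_annihilate z F).
Proof.
move=> z2 [LF F2]; split=> [n|]; first exact: Lambda_annihilate.
apply: (@le_lt_trans _ _ ((\int[lebp]_t abs2 (z t))%:E *
  \sum_(0 <= n <oo) Lambda_norm2 (F n.+1))%E); last first.
  rewrite lte_mul_pinfty// ?lee_fin ?Rintegral_abs2_ge0//.
  apply: le_lt_trans F2; rewrite [leRHS]nneseriesS; last first.
    by move=> n; exact: Lambda_norm2_ge0.
  by rewrite leeDr// Lambda_norm2_ge0.
rewrite -nneseriesZl//; last by move=> n _; exact: Lambda_norm2_ge0.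
apply: lee_nneseries => n *; first exact: Lambda_norm2_ge0.
have La := Lambda_annihilate z2 (LF n.+1).
rewrite -(fineK (Lambda_norm2_fin (LF n.+1))) -(fineK (Lambda_norm2_fin La)).
by rewrite -EFinM lee_fin fine_Lambda_norm2_annihilate.
Qed.

Lemma creationE z u : square_integrable lebp z ->
  fock_ae_eq (fock_fun (creation z u)) (fock_create z (fock_fun u)).
Proof. by move=> z2; apply/to_fockK/is_fock_create => //; exact: fock_funP. Qed.

Definition annihilator z u : fock R := to_fock (fock_annihilate z (fock_fun u)).

Lemma annihilatorE z u : square_integrable lebp z ->
  fock_ae_eq (fock_fun (annihilator z u)) (fock_annihilate z (fock_fun u)).
Proof. by move=> z2; apply/to_fockK/is_fock_annihilate => //; exact: fock_funP. Qed.

Lemma csumS (a : nat -> R[i]) : csummable (fun n => a n.+1) -> a 0%N = 0 ->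
  csum a = csum (fun n => a n.+1).
Proof.
move=> [c1 c2] a0.
have H (b : nat -> R) : cvgn (series (fun n => b n.+1)) -> b 0%N = 0 ->
    limn (series b) = limn (series (fun n => b n.+1)).
  move=> cb b0; apply/cvg_lim => //; rewrite -cvg_shiftS.
  rewrite (_ : [sequence _]_n = series (fun n => b n.+1))//.
  by apply/funext => n; rewrite /series/= big_nat_recl//= b0 add0r.
by rewrite /csum (H (fun n => complex.Re (a n)) c1) ?(H (fun n => complex.Im (a n)) c2) ?a0.
Qed.

Lemma csummableS (a : nat -> R[i]) : csummable (fun n => a n.+1) -> a 0%N = 0 ->
  csummable a.
Proof.
have H (b : nat -> R) : b 0%N = 0 -> cvgn (series (fun n => b n.+1)) ->
    cvgn (series b).
  move=> b0 cb; apply/cvg_ex; exists (limn (series (fun n => b n.+1))).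
  rewrite -cvg_shiftS (_ : [sequence _]_n = series (fun n => b n.+1))//.
  by apply/funext => n; rewrite /series/= big_nat_recl//= b0 add0r.
by move=> [c1 c2] a0; split;
  [apply: (H (fun n => complex.Re (a n)) _ c1)|apply: (H (fun n => complex.Im (a n)) _ c2)]; rewrite a0.
Qed.

(** Degree by degree this is [create_adjoint]. Creation raises the degree by one, so the series on
    the left is shifted past its zero term of degree 0. *)
Lemma dot_creation z u v : square_integrable lebp z ->
  dot (creation z u) v = dot u (annihilator z v).
Proof.
move=> z2; have fu := fock_funP u; have fv := fock_funP v.
have fc := is_fock_create z2 fu; have fa := is_fock_annihilate z2 fv.
transitivity (fock_dot_fun (fock_create z (fock_fun u)) (fock_fun v)).
  exact: (ae_eq_fock_dot (fock_funP _) fc fv fv (creationE u z2) (fock_ae_refl _)).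
transitivity (fock_dot_fun (fock_fun u) (fock_annihilate z (fock_fun v))); last first.
  exact/esym/(ae_eq_fock_dot fu fu (fock_funP _) fa (fock_ae_refl _) (annihilatorE v z2)).
have E n : Lambda_dot (fock_create z (fock_fun u) n.+1) (fock_fun v n.+1) =
    Lambda_dot (fock_fun u n) (fock_annihilate z (fock_fun v) n).
  by apply: create_adjoint => //; [exact: fu.1|exact: fv.1].
rewrite /fock_dot_fun csumS.
- by congr csum; apply/funext => n; exact: E.
- have := csummable_fock fu fa; congr csummable; apply/funext => n.
  by rewrite E.
- rewrite /Lambda_dot (_ : (fun x => _) = (fun=> 0)) ?cintegral0 ?mulr0//.
  by apply/funext => x; rewrite rmorph0 mul0r.
Qed.

Lemma dot_anticommutation z u v : square_integrable lebp z ->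
  dot (creation z u) (creation z v) + dot (annihilator z u) (annihilator z v) =
  norm2 z * dot u v.
Proof.
move=> z2; have fu := fock_funP u; have fv := fock_funP v.
have fcu := is_fock_create z2 fu; have fau := is_fock_annihilate z2 fu.
have fcv := is_fock_create z2 fv; have fav := is_fock_annihilate z2 fv.
have -> : dot (creation z u) (creation z v) =
    fock_dot_fun (fock_create z (fock_fun u)) (fock_create z (fock_fun v)).
  exact: (ae_eq_fock_dot (fock_funP _) fcu (fock_funP _) fcv
    (creationE u z2) (creationE v z2)).
have -> : dot (annihilator z u) (annihilator z v) =
    fock_dot_fun (fock_annihilate z (fock_fun u)) (fock_annihilate z (fock_fun v)).
  exact: (ae_eq_fock_dot (fock_funP _) fau (fock_funP _) fav
    (annihilatorE u z2) (annihilatorE v z2)).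
have sa := csummable_fock fau fav.
have sc : csummable (fun n => Lambda_dot (create z (fock_fun u n))
    (create z (fock_fun v n))).
  have := csummable_fock fu (is_fock_annihilate z2 fcv).
  congr csummable; apply/funext => n; apply/esym/create_adjoint => //.
    exact: fu.1.
  by apply: Lambda_create => //; exact: fv.1.
rewrite /fock_dot_fun csumS//; last first.
  rewrite /Lambda_dot (_ : (fun x => _) = (fun=> 0)) ?cintegral0 ?mulr0//.
  by apply/funext => x; rewrite rmorph0 mul0r.
(* Re-indexes the annihilation terms by the degree of the components of [u] and [v], as the creation
   terms now are; degree 0 contributes nothing, the vacuum component being annihilated. *)
pose b n := if n is m.+1 then Lambda_dot (fock_annihilate z (fock_fun u) m)
  (fock_annihilate z (fock_fun v) m) else 0.
have sb : csummable b by exact: csummableS.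
rewrite -[X in _ + X](csumS (a := b))// -[X in X + _]mul1r -csumP//.
have suv := csummable_fock fu fv.
have s0 : csummable (fun=> 0 : R[i]).
  by split; rewrite (_ : series _ = cst 0); try exact: is_cvg_cst;
    apply/funext => n; rewrite /series/= big1.
rewrite -[RHS]addr0 [X in _ = _ + X](_ : _ = csum (fun=> 0)); last first.
  by rewrite /csum/= (_ : series _ = cst 0) ?lim_cst//; apply/funext => n; rewrite /series/= big1.
rewrite -csumP//; congr csum; apply/funext => n; rewrite mul1r addr0.
case: n => [|n]; last by apply: Lambda_dot_anticommutation => //; [exact: fu.1|exact: fv.1].
by rewrite addr0; apply: Lambda_dot_create0 => //; [exact: fu.1|exact: fv.1].
Qed.

(** In every degree, <b* u, b v> = <b* b* u, v> and b* b* = 0. *)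
Lemma dot_creation_annihilator z u v : square_integrable lebp z ->
  dot (creation z u) (annihilator z v) = 0.
Proof.
move=> z2; have fu := fock_funP u; have fv := fock_funP v.
have fcu := is_fock_create z2 fu; have fav := is_fock_annihilate z2 fv.
have -> : dot (creation z u) (annihilator z v) =
    fock_dot_fun (fock_create z (fock_fun u)) (fock_annihilate z (fock_fun v)).
  exact: (ae_eq_fock_dot (fock_funP _) fcu (fock_funP _) fav
    (creationE u z2) (annihilatorE v z2)).
rewrite /fock_dot_fun (_ : (fun n => _) = (fun=> 0)).
  by rewrite /csum/= (_ : series _ = cst 0) ?lim_cst//; apply/funext => n; rewrite /series/= big1.
apply/funext => n; rewrite -create_adjoint//; [|exact: fcu.1|exact: fv.1].
rewrite /Lambda_dot (_ : (fun x => _) = (fun=> 0)) ?cintegral0 ?mulr0//.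
apply/funext => x; case: n x => [|n] x; last by rewrite create_create rmorph0 mul0r.
rewrite (_ : create _ _ x = 0) ?rmorph0 ?mul0r//.
rewrite /create /antisymmetrization big1 ?mulr0// => s _.
by rewrite /tensor !mulr0.
Qed.

End fock_operators.
Arguments fock_create {R} z F n x.
Arguments fock_annihilate {R} z F n x.

(** * Bounded operators *)

Section inner_product.
Context {R : realType} {H : innerType R}.
Implicit Types (u v w : H) (a : R[i]) (S T : H -> H).

Lemma dotDr u v w : dot u (v + w) = dot u v + dot u w.
Proof. by rewrite -{1}[v]scale1r dotPr mul1r. Qed.

Lemma dotr0 u : dot u (0 : H) = 0.
Proof.
by have /eqP := dotDr u 0 0; rewrite addr0 -subr_eq0 opprD addrA subrr sub0r oppr_eq0 => /eqP.
Qed.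

Lemma dotZr u a v : dot u (a *: v) = a * dot u v.
Proof. by rewrite -[a *: v]addr0 dotPr dotr0 addr0. Qed.

Lemma dotBr u v w : dot u (v - w) = dot u v - dot u w.
Proof. by rewrite dotDr -scaleN1r dotZr mulN1r. Qed.

Lemma dotDl u v w : dot (u + v) w = dot u w + dot v w.
Proof. by rewrite dotC dotDr rmorphD/= -!dotC. Qed.

Lemma dotZl a u v : dot (a *: u) v = conjc a * dot u v.
Proof. by rewrite dotC dotZr rmorphM/= -dotC. Qed.

Lemma dot_self u : dot u u = (hnorm u ^+ 2)%:C.
Proof.
have := dot_ge0 u; rewrite /hnorm; case: (dot u u) => x y /=.
by rewrite lecE/= => /andP[/eqP -> x0]; rewrite sqr_sqrtr.
Qed.

Lemma hnorm_ge0 u : 0 <= hnorm u.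
Proof. exact: sqrtr_ge0. Qed.

Lemma hnorm_sqr u : hnorm u ^+ 2 = complex.Re (dot u u).
Proof. by rewrite dot_self. Qed.

Lemma hnorm_eq0 u : hnorm u = 0 -> u = 0.
Proof. by move=> u0; apply: dot_eq0; rewrite dot_self u0 expr0n. Qed.

Lemma hnorm0 : hnorm (0 : H) = 0.
Proof. by rewrite /hnorm dotr0 sqrtr0. Qed.

Lemma hnormZ_sqr a u : hnorm (a *: u) ^+ 2 = abs2 a * hnorm u ^+ 2.
Proof.
by rewrite hnorm_sqr dotZl dotZr mulrA dot_self conjM_self -rmorphM.
Qed.

Lemma hnormB u v : hnorm (u - v) = hnorm (v - u).
Proof.
apply/eqP; rewrite -(@eqrXn2 _ 2)// ?hnorm_ge0//.
by rewrite -opprB -scaleN1r hnormZ_sqr /abs2/= oppr0 sqrrN expr1n expr0n addr0 mul1r.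
Qed.

Lemma dot_Cauchy_Schwarz u v : abs2 (dot u v) <= hnorm u ^+ 2 * hnorm v ^+ 2.
Proof.
apply: le_mul_of_quadratic; [exact: abs2_ge0| |exact: sqr_ge0].
move=> s; have := sqr_ge0 (hnorm (- (s%:C * dot u v) *: u + v)).
rewrite [X in 0 <= X -> _]hnorm_sqr dotDr !dotDl !dotZl !dotZr !dot_self (dotC u v).
by case: (dot u v) => x y; rewrite /abs2/= => h; apply: le_trans h _;
  rewrite le_eqVlt; apply/orP; left; apply/eqP; ring.
Qed.

Lemma ler_hnormD u v : hnorm (u + v) <= hnorm u + hnorm v.
Proof.
rewrite -(@ler_pXn2r _ 2)// ?nnegrE ?addr_ge0 ?hnorm_ge0//.
rewrite hnorm_sqr dotDr !dotDl !dot_self sqrrD (dotC u v).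
have : complex.Re (dot u v) <= hnorm u * hnorm v.
  apply: le_trans (ler_norm _) _.
  rewrite -(@ler_pXn2r _ 2)// ?nnegrE ?mulr_ge0 ?hnorm_ge0//.
  rewrite exprMn; apply: le_trans (dot_Cauchy_Schwarz u v).
  by rewrite -normrX ger0_norm ?sqr_ge0// /abs2 lerDl sqr_ge0.
by case: (dot u v) => x y /=; rewrite mulr2n; lra.
Qed.

Lemma ler_hnormB u v : hnorm u <= hnorm v + hnorm (u - v).
Proof. by rewrite -{1}[u](subrK v) addrC ler_hnormD. Qed.

Lemma dot_inj v w : (forall u, dot u v = dot u w) -> v = w.
Proof.
move=> vw; apply/eqP; rewrite -subr_eq0; apply/eqP/dot_eq0.
by rewrite dotBr vw subrr.
Qed.

Lemma is_adjointC S T : is_adjoint S T -> is_adjoint T S.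
Proof. by move=> ST u v; rewrite dotC -ST -dotC. Qed.

(** The inner product separates vectors, so an operator has at most one adjoint and the choice in
    [adj] is forced. *)
Lemma adjE S T : is_adjoint S T -> adj T = S.
Proof.
move=> ST; apply: xget_unique => // S' S'T; apply/funext => u.
by apply: dot_inj => v; rewrite -(is_adjointC S'T) -(is_adjointC ST).
Qed.

Lemma is_adjoint_linear S T : is_adjoint S T -> linear T.
Proof.
by move=> ST a u v; apply: dot_inj => w; rewrite -ST !dotPr !ST.
Qed.

(** |S u|^2 = <u, T S u> <= K |u| |S u|, divided by |S u|. *)
Lemma is_adjoint_bounded S T (K : R) : is_adjoint S T ->
  (forall u, hnorm (T u) <= K * hnorm u) -> forall u, hnorm (S u) <= K * hnorm u.
Proof.
move=> ST TK u; have [Su0|Su0] := eqVneq (hnorm (S u)) 0.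
  by rewrite Su0; apply: le_trans (TK u); exact: hnorm_ge0.
have Su_gt0 : 0 < hnorm (S u) by rewrite lt_neqAle eq_sym Su0 hnorm_ge0.
rewrite -(ler_pM2r Su_gt0) -expr2 hnorm_sqr ST.
apply: le_trans (ler_norm _) _.
have Ku : 0 <= K * hnorm (S u) by apply: le_trans (TK _); exact: hnorm_ge0.
have KS : 0 <= K * hnorm u * hnorm (S u).
  by rewrite mulrAC mulr_ge0// hnorm_ge0.
rewrite -(@ler_pXn2r _ 2)// ?nnegrE//.
apply: (@le_trans _ _ (abs2 (dot u (T (S u))))).
  by rewrite -normrX ger0_norm ?sqr_ge0// /abs2 lerDl sqr_ge0.
apply: le_trans (dot_Cauchy_Schwarz _ _) _.
rewrite [leRHS](_ : _ = hnorm u ^+ 2 * (K * hnorm (S u)) ^+ 2); last by ring.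
by rewrite ler_wpM2l ?sqr_ge0// ler_pXn2r ?nnegrE ?hnorm_ge0// TK.
Qed.

Lemma bounded_operators_adj S T (K : R) : is_adjoint S T ->
  (forall u, hnorm (T u) <= K * hnorm u) -> bounded_operators T.
Proof.
by move=> ST TK; split; [exact: is_adjoint_linear ST|exists K|exists S].
Qed.

Lemma adjP T : bounded_operators T -> is_adjoint (adj T) T.
Proof. by move=> [_ _ [S ST]]; rewrite (adjE ST). Qed.

Lemma bounded_adj T : bounded_operators T -> bounded_operators (adj T).
Proof.
move=> bT; have [_ [K TK] _] := bT; have ST := adjP bT.
exact: bounded_operators_adj (is_adjointC ST) (is_adjoint_bounded ST TK).
Qed.

Lemma bounded_id : bounded_operators (id : H -> H).
Proof.
by apply: (@bounded_operators_adj id id 1) => // u; rewrite mul1r.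
Qed.

Lemma bounded0 : bounded_operators (fun _ : H => 0).
Proof.
apply: (@bounded_operators_adj (fun=> 0) _ 0) => [u v|u].
  by rewrite dotr0 dotC dotr0 rmorph0.
by rewrite hnorm0 mul0r.
Qed.

Lemma bounded_lin a S T : bounded_operators S -> bounded_operators T ->
  bounded_operators (fun u => a *: S u + T u).
Proof.
move=> bS bT; have [_ [K SK] _] := bS; have [_ [L TL] _] := bT.
apply: (@bounded_operators_adj (fun u => conjc a *: adj S u + adj T u) _
  (Num.sqrt (abs2 a) * K + L)) => [u v|u].
  by rewrite dotDl dotDr dotZl dotZr conjcK (adjP bS) (adjP bT).
apply: le_trans (ler_hnormD _ _) _; rewrite mulrDl lerD//.
apply: (@le_trans _ _ (Num.sqrt (abs2 a) * hnorm (S u))); last first.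
  by rewrite -mulrA ler_wpM2l ?sqrtr_ge0.
rewrite -(@ler_pXn2r _ 2)// ?nnegrE ?mulr_ge0 ?hnorm_ge0 ?sqrtr_ge0//.
by rewrite hnormZ_sqr exprMn (sqr_sqrtr (abs2_ge0 a)).
Qed.

(** This makes the bounded operators one of the algebras intersected in [von_neumann_generated],
    which is how elements of the Clifford algebra are seen to be bounded. *)
Lemma von_neumann_bounded_operators : von_neumann_algebra (@bounded_operators R H).
Proof.
split=> //; first by move=> T; exact: bounded_adj.
apply/seteqP; split=> [T [] //|T bT]; split=> // S [bS ST].
by rewrite ST.
Qed.

(** The algebra is a bicommutant, and a commutant of linear operators is closed under linear
    combinations. *)
Lemma von_neumann_lin (M : set (H -> H)) a S T : von_neumann_algebra M ->
  M S -> M T -> M (fun u => a *: S u + T u).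
Proof.
move=> [_ _ <-] [bS CS] [bT CT]; split; first exact: bounded_lin.
move=> U CU; have [[linU _ _] _] := CU.
apply/funext => u /=; rewrite linU.
have /(congr1 (fun f => f u)) /= <- := CS _ CU.
by have /(congr1 (fun f => f u)) /= <- := CT _ CU.
Qed.

Lemma von_neumann_id (M : set (H -> H)) : von_neumann_algebra M -> M id.
Proof. by move=> [_ _ <-]; split=> //; exact: bounded_id. Qed.

End inner_product.

(** * The generators of the Clifford algebra *)

Section car_pair.
Context {R : realType} {H : innerType R}.
Implicit Types (u v w : H) (C A : H -> H).

Lemma hnorm_sqrD (c : R) u v w : dot v v + dot w w = c%:C * dot u u ->
  hnorm v ^+ 2 + hnorm w ^+ 2 = c * hnorm u ^+ 2.
Proof.
by rewrite !dot_self => /(congr1 (@complex.Re R)); rewrite /= mul0r subr0.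
Qed.

Variables (C A : H -> H) (CA : is_adjoint C A).

Lemma is_adjoint_add : is_adjoint (fun u => C u + A u) (fun u => C u + A u).
Proof. by move=> u v; rewrite dotDl dotDr CA (is_adjointC CA) addrC. Qed.

Lemma dot_car_add u v :
  (forall u v, dot (C u) (C v) + dot (A u) (A v) = dot u v) ->
  (forall u v, dot (C u) (A v) = 0) ->
  dot (C u + A u) (C v + A v) = dot u v.
Proof.
move=> CC CA0; rewrite dotDl !dotDr CA0 addr0 (dotC (C v) (A u)) CA0 rmorph0 add0r.
exact: CC.
Qed.

End car_pair.

(** * Boundedness of the generators and the involution Psi_1 *)

Section clifford_operators.
Context {R : realType}.
Local Notation RT := (measurableTypeR R).
Implicit Types (z : RT -> R[i]) (u v : fock R) (T : fock R -> fock R).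

Lemma hnorm_creation_annihilator z u : square_integrable lebp z ->
  hnorm (creation z u) ^+ 2 + hnorm (annihilator z u) ^+ 2 =
  (\int[lebp]_t abs2 (z t)) * hnorm u ^+ 2.
Proof.
move=> z2; apply: hnorm_sqrD; rewrite -norm2E; exact: dot_anticommutation.
Qed.

Lemma bounded_creation z : square_integrable lebp z ->
  bounded_operators (creation z) /\ bounded_operators (annihilator z).
Proof.
move=> z2; have ST u v := dot_creation u v z2.
pose K := Num.sqrt (\int[lebp]_t abs2 (z t)).
have HK (T : fock R -> fock R) : (forall u, hnorm (T u) ^+ 2 <=
    (\int[lebp]_t abs2 (z t)) * hnorm u ^+ 2) ->
    forall u, hnorm (T u) <= K * hnorm u.
  move=> TK u; rewrite -(@ler_pXn2r _ 2)// ?nnegrE ?mulr_ge0 ?hnorm_ge0 ?sqrtr_ge0//.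
  by rewrite exprMn (sqr_sqrtr (Rintegral_abs2_ge0 _ _)).
split.
- apply: (bounded_operators_adj (is_adjointC ST) (HK _ _)) => u.
  by rewrite -hnorm_creation_annihilator// lerDl sqr_ge0.
- apply: (bounded_operators_adj ST (HK _ _)) => u.
  by rewrite -hnorm_creation_annihilator// lerDr sqr_ge0.
Qed.

Lemma annihilationE z : square_integrable lebp z -> annihilation z = annihilator z.
Proof.
by move=> z2; apply/adjE/is_adjointC => u v; exact: dot_creation.
Qed.

Lemma square_integrable_conj z : square_integrable lebp z ->
  square_integrable lebp (fun t => conjc (z t)).
Proof.
move=> [mz z2]; split; first exact: cmeasurable_conj.
apply: le_lt_trans z2; rewrite le_eqVlt; apply/orP; left; apply/eqP.
apply: eq_integral => t _; congr EFin.
by case: (z t) => a b; rewrite /abs2/= sqrrN.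
Qed.

Lemma bounded_Psi z : square_integrable lebp z -> bounded_operators (Psi z).
Proof.
move=> z2; have zc2 := square_integrable_conj z2.
rewrite (_ : Psi z = fun u => 1 *: creation z u +
  annihilator (fun t => conjc (z t)) u).
  exact: bounded_lin (bounded_creation z2).1 (bounded_creation zc2).2.
by apply/funext => u; rewrite /Psi scale1r annihilationE.
Qed.

Lemma clifford_bounded T : clifford T -> bounded_operators T.
Proof.
apply; split; first exact: von_neumann_bounded_operators.
by move=> _ [z z2 <-]; exact: bounded_Psi.
Qed.

Lemma clifford_lin a S T : clifford S -> clifford T ->
  clifford (fun u : fock R => a *: S u + T u).
Proof.
move=> CS CT M [vM AM]; apply: von_neumann_lin => //.
- exact: (CS M (conj vM AM)).
- exact: (CT M (conj vM AM)).
Qed.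

Lemma clifford_id : clifford (id : fock R -> fock R).
Proof. by move=> M [vM _]; exact: von_neumann_id. Qed.

Lemma clifford_Psi z : square_integrable lebp z -> clifford (Psi z).
Proof. by move=> z2 M [_ AM]; apply: AM; exists z. Qed.

Definition unit_indicator : RT -> R[i] := fun t => (\1_`[0, 1] t)%:C.

Lemma abs2_unit_indicator t : abs2 (unit_indicator t) = \1_`[0, 1] t.
Proof. by rewrite /abs2/= expr0n/= addr0 indicE; case: (_ \in _); rewrite ?expr1n ?expr0n. Qed.

Lemma int_abs2_unit_indicator :
  (\int[lebp]_t (abs2 (unit_indicator t))%:E = 1)%E.
Proof.
under eq_integral => t _ do rewrite abs2_unit_indicator.
rewrite integral_indic//= setIT /lebp /mrestr.
rewrite (_ : _ `&` _ = `[0, 1]%classic).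
  by rewrite lebesgue_measure_itv/= lte_fin ltr01 oppr0 adde0.
by apply/seteqP; split=> t /=; rewrite !in_itv/= ?andbT;
  [case|move=> h; split=> //; case/andP: h].
Qed.

Lemma square_integrable_unit_indicator : square_integrable lebp unit_indicator.
Proof.
split; last by rewrite int_abs2_unit_indicator ltry.
split; last exact: measurable_cst.
exact: measurable_indic.
Qed.

Lemma Psi1E : Psi1 R =
  fun u => creation unit_indicator u + annihilator unit_indicator u.
Proof.
apply/funext => u.
rewrite /Psi1 /Psi -annihilationE; last exact: square_integrable_unit_indicator.
congr (_ + annihilation _ u); apply/funext => t.
by rewrite /unit_indicator conjc_real.
Qed.

Lemma clifford_Psi1 : clifford (Psi1 R).
Proof. exact: clifford_Psi square_integrable_unit_indicator. Qed.

Lemma bounded_Psi1 : bounded_operators (Psi1 R).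
Proof. exact: bounded_Psi square_integrable_unit_indicator. Qed.

Lemma Psi1_selfadjoint : is_adjoint (Psi1 R) (Psi1 R).
Proof.
rewrite Psi1E; apply: is_adjoint_add => u v.
exact: dot_creation square_integrable_unit_indicator.
Qed.

Lemma norm2_unit_indicator : norm2 unit_indicator = 1.
Proof. by rewrite norm2E /Rintegral int_abs2_unit_indicator. Qed.

(** A self-adjoint isometry squares to the identity. It is isometric because the diagonal terms add
    up to |e|^2 <u,v> = <u,v> and the mixed terms vanish. *)
Lemma Psi1_involutive : involutive (Psi1 R).
Proof.
have e2 := square_integrable_unit_indicator.
move=> u; apply: dot_inj => v; rewrite -[LHS]Psi1_selfadjoint Psi1E.
apply: dot_car_add => u' v'; last exact: dot_creation_annihilator.
by rewrite dot_anticommutation// norm2_unit_indicator mul1r.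
Qed.

End clifford_operators.

(** * Chaos decomposition *)

Section chaos.
Context {R : realType}.
Local Notation RT := (measurableTypeR R).

Lemma single_same n (f : n.-tuple RT -> R[i]) : single f n = f.
Proof.
apply/funext => x; rewrite /single; case: eqP => // e.
by rewrite (eq_irrelevance e erefl) tcast_id.
Qed.

Lemma single_neq n (f : n.-tuple RT -> R[i]) m : m != n -> single f m = fun=> 0.
Proof.
by move=> mn; apply/funext => x; rewrite /single; case: eqP mn => // ->; rewrite eqxx.
Qed.

Lemma is_fock_single n (f : n.-tuple RT -> R[i]) : Lambda f -> is_fock (single f).
Proof.
move=> Lf; have Ls m : Lambda (single f m).
  by case: (eqVneq m n) => [->|mn]; rewrite ?single_same// single_neq//; exact: Lambda0.
split=> //; rewrite (nneseriesD1 (n := n) (P := xpredT))//;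
  last by move=> k _; exact: Lambda_norm2_ge0.
rewrite eseries0 ?adde0 ?single_same.
  by have := Lambda_norm2_fin Lf; rewrite ge0_fin_numE// Lambda_norm2_ge0.
move=> k _ kn; rewrite single_neq//.
by rewrite /Lambda_norm2 (eq_integral (cst 0%E)) ?integral0 ?mule0// => x _;
  rewrite /abs2/= expr0n/= addr0.
Qed.

Lemma embedE n (f : n.-tuple RT -> R[i]) : Lambda f ->
  fock_ae_eq (fock_fun (embed f)) (single f).
Proof. by move=> Lf; exact: (to_fockK (is_fock_single Lf)). Qed.

Lemma csum_single (a : nat -> R[i]) n : (forall k, k != n -> a k = 0) ->
  csum a = a n.
Proof.
move=> a0.
have H (b : nat -> R) : (forall k, k != n -> b k = 0) -> limn (series b) = b n.
  move=> b0; apply/cvg_lim => //; apply: cvg_near_cst.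
  exists n.+1 => // k /= nk; apply/eqP.
  rewrite /series/= big_mkord (bigD1 (Ordinal nk))//= big1 ?addr0// => i.
  by rewrite -val_eqE/= => /b0.
rewrite /csum (H (fun k => complex.Re (a k))) ?(H (fun k => complex.Im (a k))).
- by case: (a n).
- by move=> k /a0 ->.
- by move=> k /a0 ->.
Qed.

Lemma Lambda_dot0 n (f : n.-tuple RT -> R[i]) : Lambda_dot f (fun=> 0) = 0.
Proof.
rewrite /Lambda_dot (_ : (fun x => _) = (fun=> 0)) ?cintegral0 ?mulr0//.
by apply/funext => x; rewrite mulr0.
Qed.

Lemma dot_embed n (f : n.-tuple RT -> R[i]) (u : fock R) : Lambda f ->
  dot u (embed f) = Lambda_dot (fock_fun u n) f.
Proof.
move=> Lf; have fu := fock_funP u; have fs := is_fock_single Lf.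
transitivity (fock_dot_fun (fock_fun u) (single f)).
  exact: (ae_eq_fock_dot fu fu (fock_funP _) fs (fock_ae_refl _) (embedE Lf)).
rewrite /fock_dot_fun (csum_single (n := n)) ?single_same// => k kn.
by rewrite single_neq// Lambda_dot0.
Qed.

Lemma dot_embed_same n (f g : n.-tuple RT -> R[i]) : Lambda f -> Lambda g ->
  dot (embed f) (embed g) = Lambda_dot f g.
Proof.
move=> Lf Lg; rewrite dot_embed//; congr (_ * _); apply: ae_eq_cintegral.
- by apply: cmeasurableM; [exact/cmeasurable_conj/((fock_funP _).1 n).1.1|exact: Lg.1.1].
- by apply: cmeasurableM; [exact/cmeasurable_conj/Lf.1.1|exact: Lg.1.1].
by apply: filterS (embedE Lf n) => x ->; rewrite single_same.
Qed.

Lemma hnorm_embed n (f : n.-tuple RT -> R[i]) : Lambda f ->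
  hnorm (embed f) ^+ 2 = fine (Lambda_norm2 f).
Proof. by move=> Lf; rewrite hnorm_sqr dot_embed_same// Lambda_dot_self. Qed.

Lemma dot_embed_neq m n (f : m.-tuple RT -> R[i]) (g : n.-tuple RT -> R[i]) :
  Lambda f -> Lambda g -> m != n -> dot (embed f) (embed g) = 0.
Proof.
move=> Lf Lg mn; rewrite dot_embed// -[RHS](mulr0 (n`!)%:R); congr (_ * _).
rewrite -[RHS](cintegral0 (lebpn n)); apply: ae_eq_cintegral.
- by apply: cmeasurableM; [exact/cmeasurable_conj/((fock_funP _).1 n).1.1|exact: Lg.1.1].
- exact: cmeasurable_cst.
apply: filterS (embedE Lf n) => x ->.
by rewrite single_neq ?rmorph0 ?mul0r// eq_sym.
Qed.

Lemma integral_lebpn0_cst (r : R) : (\int[lebpn 0]_x r%:E = r%:E)%E.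
Proof.
rewrite integral_cst//.
by rewrite -[X in (_ * X)%E]/(\d_([tuple] : 0.-tuple RT) setT) diracT mule1.
Qed.

Lemma Lambda_const (c : R[i]) : Lambda (fun _ : 0.-tuple RT => c).
Proof.
split; last first.
  by move=> s x; rewrite (_ : s = 1%g) ?odd_perm1 ?expr0 ?mul1r//; apply/permP => -[].
split; first exact: cmeasurable_cst.
by rewrite integral_lebpn0_cst ltry.
Qed.

Lemma Lambda_dot_const (c d : R[i]) :
  Lambda_dot (fun _ : 0.-tuple RT => c) (fun=> d) = conjc c * d.
Proof.
rewrite /Lambda_dot fact0 mul1r /cintegral /Rintegral.
by rewrite !integral_lebpn0_cst; case: (conjc c * d).
Qed.

Lemma dot_vacuum : dot (vacuum R) (vacuum R) = 1.
Proof.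
rewrite dot_embed_same; try exact: Lambda_const.
by rewrite Lambda_dot_const rmorph1 mulr1.
Qed.

Definition one_particle (z : RT -> R[i]) : 1.-tuple RT -> R[i] := fun x => z (thead x).

Lemma int_abs2_one_particle (z : RT -> R[i]) : cmeasurable z ->
  (\int[lebpn 1]_x (abs2 (one_particle z x))%:E = \int[lebp]_t (abs2 (z t))%:E)%E.
Proof.
move=> mz.
have := int_abs2_tensor mz (cmeasurable_cst (0.-tuple RT) 1).
rewrite integral_lebpn0_cst /abs2/= expr1n expr0n addr0 mule1 => <-.
by apply: eq_integral => x _; rewrite /tensor mulr1.
Qed.

Lemma antisymmetric1 (f : 1.-tuple RT -> R[i]) : antisymmetric_fun f.
Proof.
move=> s x; rewrite (_ : s = 1%g) ?odd_perm1 ?expr0 ?mul1r ?perm_tuple1//.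
by apply/permP => i; rewrite !ord1.
Qed.

Lemma Lambda_one_particle (z : RT -> R[i]) : square_integrable lebp z ->
  Lambda (one_particle z).
Proof.
move=> [mz z2]; split; last exact: antisymmetric1.
split; last by rewrite int_abs2_one_particle.
by case: mz => z1 z_2; split; [apply: (measurableT_comp z1)|apply: (measurableT_comp z_2)];
  exact: measurable_tnth.
Qed.

(** The measure on 0-tuples is a Dirac mass at the only point, so an almost everywhere statement
    there holds at that point. *)
Lemma vacuum0 x : fock_fun (vacuum R) 0 x = 1.
Proof.
have [A [mA A0 PA]] := embedE (Lambda_const 1) 0.
apply: contrapT => nP; have : A x.
  by apply: PA => /=; rewrite single_same; apply: contra_not nP => ->.
move: A0; rewrite /= diracE (tuple0 x) => + Ax; rewrite mem_set// => /eqP.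
by rewrite eqe oner_eq0.
Qed.

Lemma creation_vacuum (z : RT -> R[i]) : square_integrable lebp z ->
  creation z (vacuum R) = embed (one_particle z).
Proof.
move=> z2; have Lz := Lambda_one_particle z2; have fv := fock_funP (vacuum R).
apply: eq_to_fock; [exact: is_fock_create|exact: is_fock_single|].
case=> [|[|n]].
- by rewrite single_neq//; exact: nearW.
- apply: nearW => x; rewrite single_same; rewrite -[LHS]/(create _ _ x) createE; last first.
    exact: (fv.1 0).2.
  rewrite big_ord_recl big_ord0 addr0 expr0 mulr1 invr1 mul1r.
  by rewrite to_front0 perm_tuple1 /tensor vacuum0 mulr1.
(* The chosen representative of the vacuum is known to vanish in positive degree only almost
   everywhere; the norm bound on [create] carries this over to the next degree. *)
- rewrite single_neq//; apply: Lambda_norm2_eq0.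
    exact: (Lambda_create z2 (fv.1 n.+1)).
  have Lw := fv.1 n.+1; have Lc := Lambda_create z2 Lw.
  rewrite -(fineK (Lambda_norm2_fin Lc)); congr EFin; apply/eqP.
  rewrite eq_le fine_ge0 ?Lambda_norm2_ge0// andbT.
  apply: le_trans (fine_Lambda_norm2_create z2 Lw) _.
  rewrite (_ : fine _ = 0) ?mulr0// /Lambda_norm2.
  rewrite (ae_eq_int_abs2 (g := fun=> 0) Lw.1.1 (cmeasurable_cst _ _)); last first.
    have := embedE (Lambda_const 1) n.+1; apply: filterS => x ->.
    by rewrite single_neq.
  by rewrite (eq_integral (cst 0%E)) ?integral0 ?mule0// => x _; rewrite /abs2/= expr0n/= addr0.
Qed.

Lemma fine_Lambda_norm2_one_particle (z : RT -> R[i]) : square_integrable lebp z ->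
  fine (Lambda_norm2 (one_particle z)) = \int[lebp]_t abs2 (z t).
Proof.
by move=> [mz z2]; rewrite /Lambda_norm2 int_abs2_one_particle// mul1e.
Qed.

(** In |b*(z) Omega|^2 + |b(z) Omega|^2 = |z|^2 the first term already equals |z|^2. *)
Lemma annihilator_vacuum (z : RT -> R[i]) : square_integrable lebp z ->
  annihilator z (vacuum R) = 0.
Proof.
move=> z2; apply: hnorm_eq0; apply/eqP; rewrite -sqrf_eq0; apply/eqP.
have hv : hnorm (vacuum R) ^+ 2 = 1 by rewrite hnorm_sqr dot_vacuum.
have hc : hnorm (creation z (vacuum R)) ^+ 2 = \int[lebp]_t abs2 (z t).
  rewrite creation_vacuum// hnorm_embed; last exact: Lambda_one_particle.
  exact: fine_Lambda_norm2_one_particle.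
have h := hnorm_creation_annihilator (vacuum R) z2.
have aux (x y w i : R) : x = i -> w = 1 -> x + y = i * w -> y = 0.
  by move=> -> ->; rewrite mulr1 -[RHS]addr0 => /addrI.
exact: aux hc hv h.
Qed.

Lemma Psi1_vacuum : Psi1 R (vacuum R) = embed (one_particle unit_indicator).
Proof.
have e2 := @square_integrable_unit_indicator R.
by rewrite Psi1E (annihilator_vacuum e2) addr0 (creation_vacuum e2).
Qed.

Lemma dot_vacuum_Psi1 : dot (vacuum R) (Psi1 R (vacuum R)) = 0.
Proof.
rewrite Psi1_vacuum dot_embed_neq//; first exact: Lambda_const.
exact/Lambda_one_particle/square_integrable_unit_indicator.
Qed.

End chaos.

(** * Functional calculus of an involution *)

Section two_point_calculus.
Context {R : realType}.

Definition two_points := [set (-1 : R); (1 : R)].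
Implicit Types f g : two_points -> R[i].

Definition at_plus : two_points :=
  exist _ (1 : R) (mem_set (or_intror erefl : two_points 1)).
Definition at_minus : two_points :=
  exist _ (-1 : R) (mem_set (or_introl erefl : two_points (-1))).

Lemma two_pointsP (x : two_points) : x = at_minus \/ x = at_plus.
Proof.
case: x => x px; have [x1|x1] := set_mem px; [left|right]; exact/val_inj.
Qed.

Definition mean f : R[i] := (f at_plus + f at_minus) / 2.
Definition slope f : R[i] := (f at_plus - f at_minus) / 2.

Lemma two_pointsE f x : f x = slope f * (\val x)%:C + mean f.
Proof.
rewrite /slope /mean; case: (two_pointsP x) => ->/=.
  rewrite (_ : (-1)%:C = -1 :> R[i]); last by rewrite rmorphN1.
  by field.
by rewrite mulr1; field.
Qed.

Lemma mean_lin (a : R[i]) f g :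
  mean (fun x => a * f x + g x) = a * mean f + mean g.
Proof. by rewrite /mean; field. Qed.

Lemma slope_lin (a : R[i]) f g :
  slope (fun x => a * f x + g x) = a * slope f + slope g.
Proof. by rewrite /slope; field. Qed.

(** With [slope_mul], the product of C[X]/(X^2 - 1) in the coordinates 1 and X, which is also how
    operators a + b T multiply for an involution T. *)
Lemma mean_mul f g :
  mean (fun x => f x * g x) = mean f * mean g + slope f * slope g.
Proof. by rewrite /mean /slope; field. Qed.

Lemma slope_mul f g :
  slope (fun x => f x * g x) = mean f * slope g + slope f * mean g.
Proof. by rewrite /mean /slope; field. Qed.

End two_point_calculus.

Section involution_calculus.
Context {R : realType} {H : innerType R}.
Variable T : H -> H.
Hypotheses (bT : bounded_operators T) (TT : is_adjoint T T) (TK : involutive T).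
Implicit Types f g : @two_points R -> R[i].

Let lT : linear T. Proof. by case: bT. Qed.

Let TD u v : T (u + v) = T u + T v.
Proof. by rewrite -[u]scale1r lT !scale1r. Qed.

Let TZ (a : R[i]) u : T (a *: u) = a *: T u.
Proof. by apply: dot_inj => v; rewrite -TT !dotZr TT. Qed.

Definition two_point_calculus f : H -> H := fun u => mean f *: u + slope f *: T u.

Lemma bounded_two_point_calculus f : bounded_operators (two_point_calculus f).
Proof.
rewrite (_ : two_point_calculus f = fun u => slope f *: T u + (mean f *: u + 0)).
  exact: bounded_lin bT (bounded_lin _ bounded_id bounded0).
by apply/funext => u; rewrite /two_point_calculus addr0 addrC.
Qed.

Lemma is_functional_calculus_two_point :
  is_functional_calculus T two_point_calculus.
Proof.
split; first exact: bounded_two_point_calculus.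
split.
  move=> a f g; apply/funext => u; rewrite /two_point_calculus mean_lin slope_lin.
  rewrite -[RHS]/(a *: (mean f *: u + slope f *: T u) + (mean g *: u + slope g *: T u)).
  by rewrite scalerDr !scalerDl !scalerA addrACA.
split.
  move=> f g; apply/funext => u; rewrite /two_point_calculus /= mean_mul slope_mul.
  rewrite TD !TZ TK !scalerDr !scalerDl !scalerA.
  by rewrite -!addrA; congr (_ + _); rewrite addrC -!addrA; congr (_ + _); rewrite addrC.
split.
  apply/funext => u; rewrite /two_point_calculus /mean /slope subrr mul0r scale0r addr0.
  by rewrite -mulr2n -[1 *+ 2]/(2%:R) divff ?scale1r// pnatr_eq0.
split.
  move=> f u v; rewrite /two_point_calculus /mean /slope dotDl dotDr !dotZl !dotZr TT.
  have c2 : conjc (2^-1 : R[i]) = 2^-1 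
    by rewrite (fmorphV (@conjc R)); congr (_^-1); exact: conjc_nat.
  have cM (x y : R[i]) : conjc (x * y) = conjc x * conjc y by exact: rmorphM.
  have cD (x y : R[i]) : conjc (x + y) = conjc x + conjc y by exact: rmorphD.
  have cB (x y : R[i]) : conjc (x - y) = conjc x - conjc y by exact: rmorphB.
  by rewrite !cM cD cB !conjcK c2.
apply/funext => u; rewrite /two_point_calculus /mean /slope/=.
rewrite (_ : (-1)%:C = -1 :> R[i]); last by rewrite rmorphN1.
rewrite subrr mul0r scale0r add0r opprK.
by rewrite -mulr2n -[1 *+ 2]/(2%:R) divff ?scale1r// pnatr_eq0.
Qed.

(** A function on two points is affine in the inclusion, so linearity and the values at 1 and at the
    inclusion determine a functional calculus. *)
Lemma functional_calculusE f :
  functional_calculus T f = two_point_calculus f.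
Proof.
congr (_ f); apply: xget_unique; first exact: is_functional_calculus_two_point.
move=> Phi [_ [Plin [_ [P1 [_ PT]]]]]; apply/funext => g.
have P0 : Phi (fun=> 0) = fun=> 0.
  have := Plin 1 (fun=> 0) (fun=> 0).
  rewrite (_ : (fun x => _) = (fun=> 0)); last by apply/funext => x; rewrite mulr0 addr0.
  move=> /esym/eqP; rewrite scale1r -subr_eq0 addrK => /eqP P0.
  by rewrite P0; apply/funext.
have Pm : Phi (fun=> mean g) = fun u => mean g *: u.
  have := Plin (mean g) (fun=> 1) (fun=> 0).
  rewrite (_ : (fun x => _) = (fun=> mean g)); last by apply/funext => x; rewrite mulr1 addr0.
  by move=> ->; rewrite P1 P0; apply/funext => u; rewrite -[LHS]/(mean g *: u + 0) addr0.
have {1}-> : g = fun x => slope g * (\val x)%:C + (fun=> mean g) x.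
  by apply/funext => x; rewrite -two_pointsE.
rewrite Plin PT Pm; apply/funext => u.
by rewrite -[LHS]/(slope g *: T u + mean g *: u) addrC.
Qed.

End involution_calculus.

(** * The completion and the derivative *)

Section completion_facts.
Context {R : realType} {K : hilbertType R}.
Variable iota : (fock R -> fock R) -> K.
Hypothesis hK : is_L2_completion iota.
Implicit Types (k l : K) (u v : fock R) (S T : fock R -> fock R).

Lemma hcvg_hnorm (H : innerType R) (s : nat -> H) p :
  hcvg s p -> (fun n => hnorm (s n)) @ \oo --> (hnorm p : R).
Proof.
move=> sl; apply/subr_cvg0; apply/norm_cvg0P.
apply: (squeeze_cvgr _ (cvg_cst 0) sl).
apply: nearW => n; rewrite normr_ge0/= ler_norml.
have := ler_hnormB (s n) p; have := ler_hnormB p (s n); rewrite hnormB => h1 h2.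
by apply/andP; split; lra.
Qed.

Lemma hcvg_lin (H : innerType R) (a : R[i]) (s s' : nat -> H) p p' :
  hcvg s p -> hcvg s' p' -> hcvg (fun n => a *: s n + s' n) (a *: p + p').
Proof.
move=> sl sl'.
have b : (fun n => Num.sqrt (abs2 a) * hnorm (s n - p) + hnorm (s' n - p')) @ \oo
    --> (0 : R).
  rewrite -[X in _ --> X](addr0 (0 : R)); apply: cvgD => //.
  rewrite -[X in _ --> X](mulr0 (Num.sqrt (abs2 a))); apply: cvgMr => //.
apply: (squeeze_cvgr _ (cvg_cst 0) b).
apply: nearW => n; rewrite hnorm_ge0/=.
rewrite (_ : _ - _ = a *: (s n - p) + (s' n - p')); last first.
  by rewrite scalerBr opprD addrACA.
apply: le_trans (ler_hnormD _ _) _; rewrite lerD2r.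
rewrite -(@ler_pXn2r _ 2)// ?nnegrE ?mulr_ge0 ?hnorm_ge0 ?sqrtr_ge0//.
by rewrite hnormZ_sqr exprMn (sqr_sqrtr (abs2_ge0 a)).
Qed.

Lemma hcvg_cst (H : innerType R) (p : H) : hcvg (fun=> p) p.
Proof.
by rewrite /hcvg (_ : (fun=> _) = fun=> 0 : R); [exact: cvg_cst|
  apply/funext => n; rewrite subrr hnorm0].
Qed.

Lemma iota_lin a S T : clifford S -> clifford T ->
  iota (fun u => a *: S u + T u) = a *: iota S + iota T.
Proof. by move=> CS CT; case: hK => + _ _; apply. Qed.

Lemma hnorm_iota T : clifford T -> hnorm (iota T) = hnorm (T (vacuum R)).
Proof.
move=> CT; case: hK => _ + _ => /(_ T T CT CT) E.
rewrite /hnorm E /vacuum_state.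
by have /is_adjointC <- := adjP (clifford_bounded CT).
Qed.

Lemma vacuum_unitary_iota T : clifford T ->
  vacuum_unitary iota (iota T) (T (vacuum R)).
Proof.
by move=> CT; exists (fun=> T); split => //; split; exact: hcvg_cst.
Qed.

Lemma vacuum_unitary_lin a k k' u u' : vacuum_unitary iota k u ->
  vacuum_unitary iota k' u' -> vacuum_unitary iota (a *: k + k') (a *: u + u').
Proof.
move=> [T [CT [Tk Tu]]] [T' [CT' [Tk' Tu']]].
exists (fun n v => a *: T n v + T' n v); split.
  by move=> i; exact: clifford_lin.
split; last exact: hcvg_lin.
have := hcvg_lin a Tk Tk'; congr hcvg; apply/funext => n.
by rewrite iota_lin.
Qed.

Lemma vacuum_unitary_hnorm k u : vacuum_unitary iota k u -> hnorm k = hnorm u.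
Proof.
move=> [T [CT [Tk Tu]]]; have := hcvg_hnorm Tk; have := hcvg_hnorm Tu.
rewrite (_ : (fun n => hnorm (iota (T n))) = (fun n => hnorm (T n (vacuum R)))).
  by move=> h1 h2; apply: (cvg_unique _ h2 h1).
by apply/funext => n; exact: hnorm_iota.
Qed.

Lemma vacuum_unitary0 : vacuum_unitary iota 0 0.
Proof.
have h := vacuum_unitary_iota (@clifford_id R).
by have := vacuum_unitary_lin (-1) h h; rewrite !scaleN1r !addNr.
Qed.

(** The graph is linear and isometric, so it can pair 0 only with 0. *)
Lemma vacuum_unitary_unique k u u' : vacuum_unitary iota k u ->
  vacuum_unitary iota k u' -> u = u'.
Proof.
move=> ku ku'; have := vacuum_unitary_hnorm (vacuum_unitary_lin (-1) ku ku').
rewrite !scaleN1r addNr hnorm0 => /esym/hnorm_eq0/eqP.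
by rewrite addrC subr_eq0 => /eqP.
Qed.

Lemma vacuum_unitary_sum N (c : nat -> R[i]) (l : nat -> K) (u : nat -> fock R) :
  (forall n, (n < N)%N -> vacuum_unitary iota (l n) (u n)) ->
  vacuum_unitary iota (\sum_(n < N) c n *: l n) (\sum_(n < N) c n *: u n).
Proof.
elim: N => [|N IH] lu; first by rewrite !big_ord0; exact: vacuum_unitary0.
rewrite !big_ord_recr/= [X in vacuum_unitary _ X _]addrC [X in vacuum_unitary _ _ X]addrC.
apply: vacuum_unitary_lin; first exact: lu.
by apply: IH => n nN; apply: lu; exact: ltnW.
Qed.

End completion_facts.

(** * Nonnegative integrals of almost everywhere equal functions *)

Section negligible_modification.
Import HBNNSimple.
Context d (T : measurableType d) {R : realType} (mu : {measure set T -> \bar R}).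

(* The squared norm of a derivative is only known almost everywhere, whereas
   ae_eq_integral asks for both functions to be measurable. *)
Lemma ae_eq_ge0_integral (f g : T -> \bar R) :
  (forall x, 0 <= f x)%E -> (forall x, 0 <= g x)%E -> measurable_fun setT g ->
  (\forall x \ae mu, f x = g x) -> (\int[mu]_x f x = \int[mu]_x g x)%E.
Proof.
move=> f0 g0 mg fg; apply/eqP; rewrite eq_le; apply/andP; split.
  (* A simple function below [f] is almost everywhere below [g], and these two are measurable. *)
  rewrite ge0_integralTE//; apply: ge_ereal_sup => _ [h hf <-].
  rewrite -integralT_nnsfun; apply: ae_ge0_le_integral => //.
  - by move=> x _; rewrite lee_fin; exact: fun_ge0.
  - exact/measurable_EFinP.
  - by apply: filterS fg => x <- _; exact: hf.
have [A [mA A0 fgA]] := fg.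
(* Replaced by 0 on the null set [A], [g] keeps its integral and lies below [f] at every point. *)
have mgA : measurable_fun setT (g \_ (~` A)).
  by apply/(measurable_restrictT _ (measurableC mA)).1/(measurable_funS _ _ mg).
rewrite (_ : (\int[mu]_x g x)%E = \int[mu]_x (g \_ (~` A)) x)%E; last first.
  apply: ae_eq_integral => //; exists A; split => // x /= nP.
  by apply: contrapT => nA; apply: nP => _; rewrite patchE mem_set.
have gAf x : ((g \_ (~` A)) x <= f x)%E.
  rewrite patchE; case: ifPn => // /set_mem nA.
  by rewrite (_ : g x = f x)//; apply: contrapT => nfg; apply: nA; apply: fgA => /= /esym.
rewrite !ge0_integralTE//; last by move=> x; rewrite patchE; case: ifP.
apply: ereal_sup_le => _ [h hg <-]; exists h => // x.
exact: le_trans (hg x) (gAf x).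
Qed.

End negligible_modification.

(** * Chaos decompositions of a + b Psi_1 *)

Section derivative_two_point.
Context {R : realType} {K : hilbertType R}.
Local Notation RT := (measurableTypeR R).
Variable iota : (fock R -> fock R) -> K.
Hypothesis hK : is_L2_completion iota.

Lemma eq_embed n (f g : n.-tuple RT -> R[i]) : Lambda f -> Lambda g ->
  (\forall x \ae lebpn n, f x = g x) -> embed f = embed g.
Proof.
move=> Lf Lg fg; apply: eq_to_fock; [exact: is_fock_single|exact: is_fock_single|].
move=> m; have [->|mn] := eqVneq m n; first by rewrite !single_same.
by rewrite !single_neq//; exact: nearW.
Qed.

Lemma embedZ n (a : R[i]) (f : n.-tuple RT -> R[i]) : Lambda f ->
  embed (fun x => a * f x) = a *: embed f.
Proof.
move=> Lf; apply: fock_eqP => m.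
have h1 := embedE (LambdaZ a Lf) m; have h2 := embedE Lf m.
have h3 := fock_scaleE a (embed f) m.
have E x : single (fun x => a * f x) m x = a * single f m x.
  have [e|mn] := eqVneq m n; last by rewrite !single_neq// mulr0.
  by subst m; rewrite !single_same.
apply: filterS3 h1 h2 h3 => x e1 e2 e3.
exact: (etrans e1 (etrans (E x) (etrans (congr1 ( *%R a) (esym e2)) (esym e3)))).
Qed.

Lemma fock_fun_sum_embed M (v : fockfun R) :
  (forall n, (n < M)%N -> Lambda (v n)) ->
  forall m, \forall x \ae lebpn m,
    fock_fun (\sum_(n < M) embed (v n)) m x = if (m < M)%N then v m x else 0.
Proof.
elim: M => [|M IH] Lv m; first by rewrite big_ord0; exact: fock0E.
have Lv' n : (n < M)%N -> Lambda (v n) by move=> nM; apply: Lv; exact: ltnW.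
have h1 := IH Lv' m; have h2 := embedE (Lv M (ltnSn M)) m.
have h3 := fock_addE (\sum_(n < M) embed (v n)) (embed (v M)) m.
rewrite big_ord_recr/=; apply: filterS3 h1 h2 h3 => x e1 e2 ->; rewrite e1 e2.
have [e|mM] := eqVneq m M.
  by subst m; rewrite ltnn ltnSn single_same add0r.
by rewrite single_neq// addr0 ltnS [in RHS]leq_eqVlt (negbTE mM).
Qed.

Variables (a b : R[i]).

Definition affine_Psi1 : fock R -> fock R := fun u => a *: u + b *: Psi1 R u.

Definition chaos0 : 0.-tuple RT -> R[i] := fun=> a.
Definition chaos1 : 1.-tuple RT -> R[i] := fun x => b * one_particle unit_indicator x.

Lemma Lambda_chaos1 : Lambda chaos1.
Proof. exact/LambdaZ/Lambda_one_particle/square_integrable_unit_indicator. Qed.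

Lemma clifford0 : clifford (fun _ : fock R => 0).
Proof.
have -> : (fun _ : fock R => 0) = (fun u : fock R => -1 *: u + u).
  by apply/funext => u; rewrite scaleN1r addNr.
exact: (clifford_lin (-1) (@clifford_id R) (@clifford_id R)).
Qed.

Lemma cliffordZ c (T : fock R -> fock R) : clifford T -> clifford (fun u => c *: T u).
Proof.
move=> CT; have -> : (fun u => c *: T u) = (fun u => c *: T u + 0).
  by apply/funext => u; rewrite addr0.
exact: (clifford_lin c CT clifford0).
Qed.

Lemma clifford_affine_Psi1 : clifford affine_Psi1.
Proof. exact: clifford_lin (@clifford_id R) (cliffordZ b (@clifford_Psi1 R)). Qed.

Lemma embed_const c : embed (fun _ : 0.-tuple RT => c) = c *: vacuum R.
Proof.
rewrite -embedZ; last exact: Lambda_const.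
by congr embed; apply/funext => x; rewrite mulr1.
Qed.

Lemma embed_chaos1 : embed chaos1 = b *: Psi1 R (vacuum R).
Proof.
rewrite Psi1_vacuum embedZ//.
exact/Lambda_one_particle/square_integrable_unit_indicator.
Qed.

Lemma affine_Psi1_vacuum :
  affine_Psi1 (vacuum R) = embed chaos0 + embed chaos1.
Proof. by rewrite embed_chaos1 embed_const. Qed.

Lemma iota_const c : vacuum_unitary iota (iota (fun u => c *: u))
  (embed (fun _ : 0.-tuple RT => c)).
Proof.
rewrite embed_const.
exact: (vacuum_unitary_iota iota (cliffordZ c (@clifford_id R))).
Qed.

Definition two_chaoses : fockfun R := fun n =>
  match n return n.-tuple RT -> R[i] with
  | 0 => fun=> a
  | 1 => chaos1
  | _ => fun=> 0
  end.

Local Arguments two_chaoses n x : clear implicits.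

(** The existence half: it ensures that [derivative] does not fall back on its default value. *)
Lemma is_derivative_affine_Psi1 : is_derivative iota (iota affine_Psi1)
  (fun t => iota (fun u => (b * unit_indicator t) *: u)).
Proof.
exists 1%N, two_chaoses, (fun n => if n is 0 then iota (fun u => a *: u)
  else iota (fun u => b *: Psi1 R u)); split; [|split].
- case=> [|[|//]] _; split.
  + exact: Lambda_const.
  + exact: iota_const.
  + exact: Lambda_chaos1.
  + rewrite -[X in vacuum_unitary _ _ X]/(embed chaos1) embed_chaos1.
    exact: (vacuum_unitary_iota iota (cliffordZ b (@clifford_Psi1 R))).
- rewrite !big_ord_recr big_ord0/= add0r.
  have C1 := cliffordZ a (@clifford_id R); have C2 := cliffordZ b (@clifford_Psi1 R).
  have -> : affine_Psi1 = fun u => 1 *: (a *: u) + b *: Psi1 R u.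
    by apply/funext => u; rewrite scale1r.
  by rewrite -[X in _ = X + _]scale1r; exact: (iota_lin hK 1 C1 C2).
(* The slice at [t] of the kernel b e is the constant b e(t), a kernel of degree 0, represented by
   that multiple of the identity. *)
- apply: nearW => t; exists (fun=> iota (fun u => (b * unit_indicator t) *: u)).
  split; last by rewrite big_ord_recr big_ord0/= add0r scale1r.
  case=> [|//] _; split; first exact: (Lambda_const (b * unit_indicator t)).
  exact: iota_const.
Qed.

Lemma fock_fun_affine_Psi1 m : \forall x \ae lebpn m,
  fock_fun (affine_Psi1 (vacuum R)) m x = two_chaoses m x.
Proof.
have h1 := embedE (Lambda_const a) m; have h2 := embedE Lambda_chaos1 m.
have h3 := fock_addE (embed chaos0) (embed chaos1) m.
have E x : single chaos0 m x + single chaos1 m x = two_chaoses m x.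
  case: m x {h1 h2 h3} => [|[|m]] x.
  - by rewrite single_same single_neq// addr0.
  - by rewrite single_same single_neq// add0r.
  - by rewrite !single_neq// addr0.
rewrite affine_Psi1_vacuum.
apply: filterS3 h1 h2 h3 => x e1 e2 e3.
exact: (etrans e3 (etrans (congr2 +%R e1 e2) (E x))).
Qed.

(** Both decompositions are sent to the same Fock vector by the vacuum unitary, and a Fock vector
    determines its components up to null sets. *)
Lemma is_derivative_components N (v : fockfun R) (l : nat -> K) :
  (forall n, (n < N.+1)%N -> is_chaos iota (v n) (l n)) ->
  iota affine_Psi1 = \sum_(n < N.+1) l n ->
  forall m, \forall x \ae lebpn m,
    two_chaoses m x = if (m < N.+1)%N then v m x else 0.
Proof.
move=> vl kl m.
have U1 := vacuum_unitary_iota iota clifford_affine_Psi1.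
have U2 : vacuum_unitary iota (\sum_(n < N.+1) l n) (\sum_(n < N.+1) embed (v n)).
  have := vacuum_unitary_sum hK (fun=> 1) (fun n nN => (vl n nN).2).
  by under eq_bigr do rewrite scale1r;
    under [X in vacuum_unitary _ _ X]eq_bigr do rewrite scale1r.
rewrite -kl in U2.
have UU := vacuum_unitary_unique hK U1 U2.
have h1 := fock_fun_affine_Psi1 m.
have h2 := fock_fun_sum_embed (fun n nN => (vl n nN).1) m.
rewrite -UU in h2.
by apply: filterS2 h1 h2 => x <- <-.
Qed.

End derivative_two_point.

Lemma sum_scale_head (R : realType) (V : lmodType R[i]) N (g : nat -> V) :
  (forall n, (0 < n < N.+1)%N -> g n = 0) ->
  \sum_(n < N.+1) (n.+1)%:R *: g n = g 0%N.
Proof.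
move=> g0; rewrite big_ord_recl scale1r big1 ?addr0// => i _.
by rewrite g0 ?scaler0//= /bump add1n ltnS ltn_ord.
Qed.

(** * The norm of the derivative *)

Section derivative_norm.
Context {R : realType} {K : hilbertType R}.
Local Notation RT := (measurableTypeR R).
Variable iota : (fock R -> fock R) -> K.
Hypothesis hK : is_L2_completion iota.
Variables (a b : R[i]).

Local Notation F := (affine_Psi1 a b).

Lemma embed0 n : embed (fun _ : n.-tuple RT => 0 : R[i]) = 0.
Proof.
have -> : (fun _ : n.-tuple RT => 0 : R[i]) = fun x => 0 * (fun=> 0) x.
  by apply/funext => x; rewrite mulr0.
by rewrite (embedZ 0 (@Lambda0 R n)) scale0r.
Qed.

Lemma hnorm_embed_const (c : R[i]) :
  hnorm (embed (fun _ : 0.-tuple RT => c)) ^+ 2 = abs2 c.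
Proof.
rewrite hnorm_embed; last exact: Lambda_const.
by rewrite /Lambda_norm2 fact0 mul1e integral_lebpn0_cst.
Qed.

Lemma int_abs2_chaos1 :
  (\int[lebpn 1]_x (abs2 (chaos1 b x))%:E = (abs2 b)%:E)%E.
Proof.
have [m2 _] := @square_integrable_unit_indicator R.
rewrite int_abs2Z; last first.
  exact: (Lambda_one_particle (@square_integrable_unit_indicator R)).1.1.
by rewrite int_abs2_one_particle// int_abs2_unit_indicator mule1.
Qed.

(** The chosen derivative may come from any decomposition and any version in [t], so its norm is
    read off from the kernels alone: by isometry it is that of the slices of the kernels a, b e, 0,
    ... *)
Lemma ae_hnorm_derivative G : is_derivative iota (iota F) G ->
  \forall t \ae (@lebp R), hnorm (G t) ^+ 2 = abs2 b * \1_`[0, 1] t.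
Proof.
move=> [[|N] [v [l [vl [kl Gj]]]]]; have comps := is_derivative_components hK vl kl.
  (* A decomposition of length N = 0 has no component of degree 1, which forces b e = 0. *)
  have b0 : abs2 b = 0.
    apply: EFin_inj; rewrite -int_abs2_chaos1.
    rewrite (ae_eq_int_abs2 (g := fun=> 0) (Lambda_chaos1 b).1.1 (cmeasurable_cst _ _)).
      by rewrite (eq_integral (cst 0%E)) ?integral0// => x _; rewrite /abs2/= expr0n/= addr0.
    exact: (comps 1).
  apply: filterS Gj => t [j [_ ->]].
  by rewrite big_ord0 hnorm0 expr0n b0 mul0r.
(* Fubini for null sets, degree by degree; finitely many exceptional sets of [t] are then joined. *)
have hs (n : 'I_N.+1) : \forall t \ae (@lebp R), \forall y \ae lebpn n,
    slice t (v n.+1) y = slice t (two_chaoses a b (n := n.+1)) y.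
  have := ae_lebpn_cons (comps n.+1); rewrite ltnS ltn_ord.
  by apply: filterS => t; apply: filterS => y /esym.
have {}hs : \forall t \ae (@lebp R), forall n : 'I_N.+1, \forall y \ae lebpn n,
    slice t (v n.+1) y = slice t (two_chaoses a b (n := n.+1)) y.
  exact: filter_forall.
apply: filterS2 hs Gj => t ht [j [hj Gt]].
have E0 : embed (slice t (v 1)) = embed (fun _ : 0.-tuple RT => b * unit_indicator t).
  exact: (eq_embed (hj 0%N (ltn0Sn N)).1 (Lambda_const (b * unit_indicator t)) (ht ord0)).
have ES n : (0 < n < N.+1)%N -> embed (slice t (v n.+1)) = 0.
  case: n => [/andP[h _]|n nN]; first exact: False_ind _ (notF h).
  exact: (etrans (eq_embed (hj n.+1 nN).1 (@Lambda0 R n.+1) (ht (Ordinal nN)))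
    (@embed0 n.+1)).
have U := vacuum_unitary_sum hK (fun n => (n.+1)%:R) (fun n nN => (hj n nN).2).
rewrite -Gt (sum_scale_head ES) E0 in U.
by rewrite (vacuum_unitary_hnorm hK U) hnorm_embed_const abs2M abs2_unit_indicator.
Qed.

Lemma L2_norm2_derivative : L2_norm2 (derivative iota (iota F)) = abs2 b.
Proof.
have /ae_hnorm_derivative h : is_derivative iota (iota F) (derivative iota (iota F)).
  apply: (@xgetPex _ (fun=> 0) (is_derivative iota (iota F))).
  by eexists; exact: is_derivative_affine_Psi1.
rewrite /L2_norm2 /Rintegral.
rewrite (@ae_eq_ge0_integral _ _ _ _ _ (fun t : RT => (abs2 b * \1_`[0, 1] t)%:E)).
- under eq_integral => t _ do rewrite -abs2_unit_indicator -abs2M.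
  have [m2 _] := @square_integrable_unit_indicator R.
  by rewrite int_abs2Z// int_abs2_unit_indicator mule1.
- by move=> t; rewrite lee_fin sqr_ge0.
- by move=> t; rewrite lee_fin mulr_ge0 ?abs2_ge0.
- by apply/measurable_EFinP/measurable_funM => //; exact: measurable_indic.
- by apply: filterS h => t ->.
Qed.

End derivative_norm.

(** * The two-point entropy inequality *)

Section two_point_entropy.
Context {R : realType}.
Implicit Types x y m u : R.

Lemma ln_le_subr1 x : 0 < x -> ln x <= x - 1.
Proof.
by move=> x0; rewrite -{1}[x](subrK 1) addrC le_ln1Dx// ltrBrDl subrr.
Qed.

(* ln u = ln ((1 + u) / 2) + ln (2 u / (1 + u)). *)
Lemma ln_le_half_steps u : 0 < u -> ln u <= (u - 1) / 2 + (u - 1) / (u + 1).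
Proof.
move=> u0; have u1 : 0 < u + 1 by rewrite addr_gt0.
have v0 : 0 < (u + 1) / 2 by rewrite divr_gt0.
have w0 : 0 < 2 * u / (u + 1) by rewrite divr_gt0// mulr_gt0.
have E : ln u = ln ((u + 1) / 2) + ln (2 * u / (u + 1)).
  by rewrite -lnM ?posrE//; congr ln; field; rewrite gt_eqF.
rewrite E (le_trans (lerD (ln_le_subr1 v0) (ln_le_subr1 w0)))//.
by rewrite le_eqVlt; apply/orP; left; apply/eqP; field; rewrite gt_eqF.
Qed.

(** At u = 1/2 the half-step bound gives only 7/12 < 5/8; applied to each factor of 1/2 = (3/4)(2/3)
    it gives 15/56 + 11/30 > 5/8. *)
Lemma ln2_ge : 5 / 8 <= ln (2 : R).
Proof.
have E : ln (2 : R) = - (ln (3 / 4) + ln (2 / 3)).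
  rewrite -lnM ?posrE ?divr_gt0//.
  by rewrite -lnV ?posrE ?mulr_gt0 ?divr_gt0//; congr ln; field.
have h1 : ln (3 / 4 : R) <= - (15 / 56).
  have /ln_le_half_steps/le_trans : 0 < 3 / 4 :> R by rewrite divr_gt0.
  by apply; rewrite le_eqVlt; apply/orP; left; apply/eqP; field.
have h2 : ln (2 / 3 : R) <= - (11 / 30).
  have /ln_le_half_steps/le_trans : 0 < 2 / 3 :> R by rewrite divr_gt0.
  by apply; rewrite le_eqVlt; apply/orP; left; apply/eqP; field.
rewrite E; lra.
Qed.

Lemma sqr_ln_le x m : 0 <= x -> 0 < m ->
  x ^+ 2 * (ln (x ^+ 2) - ln (m ^+ 2)) <=
  x ^+ 2 * ((x - m) / m + 2 * (x - m) / (x + m)).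
Proof.
rewrite le_eqVlt => /predU1P[<- _|x0 m0]; first by rewrite expr0n !mul0r.
rewrite ler_wpM2l ?sqr_ge0// !lnXn// -mulrnBl -ln_div ?posrE//.
have := ln_le_half_steps (divr_gt0 x0 m0).
rewrite (_ : _ / 2 + _ = ((x - m) / m + 2 * (x - m) / (x + m)) / 2); last first.
  by field; rewrite gt_eqF ?gt_eqF// ?addr_gt0.
by rewrite ler_pdivlMr// mulr_natr.
Qed.

(* With M the mean of x^2 and y^2, - M ln M is at most - M ln (m ^ 2) - M + m ^ 2
   for every m > 0; at m = (x + y) / 2 the bound sqr_ln_le leaves a rational
   inequality in which (x - y) ^ 2 factors out. *)
Lemma two_point_entropy_le x y : 0 <= x -> 0 <= y ->
  (x ^+ 2 * ln (x ^+ 2) + y ^+ 2 * ln (y ^+ 2)) / 2 -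
    (x ^+ 2 + y ^+ 2) / 2 * ln ((x ^+ 2 + y ^+ 2) / 2) <= ln 2 * (x - y) ^+ 2.
Proof.
move=> x0 y0; have [xy0|xy0] := eqVneq (x + y) 0.
  move/eqP: xy0; rewrite paddr_eq0// => /andP[/eqP-> /eqP->].
  by rewrite expr0n !mul0r !addr0 mul0r mul0r !subr0 expr0n mulr0.
pose m := (x + y) / 2; pose M := (x ^+ 2 + y ^+ 2) / 2.
have m0 : 0 < m by rewrite divr_gt0// lt_neqAle eq_sym xy0 addr_ge0.
have M0 : 0 < M.
  rewrite (_ : M = m ^+ 2 + ((x - y) / 2) ^+ 2); last by rewrite /M /m; field.
  by rewrite ltr_pwDl ?exprn_gt0// sqr_ge0.
have hM : M * (ln (m ^+ 2) - ln M) <= m ^+ 2 - M.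
  rewrite -ln_div ?posrE ?exprn_gt0//.
  have := ln_le_subr1 (divr_gt0 (exprn_gt0 2 m0) M0).
  rewrite -(ler_pM2l M0) => /le_trans; apply.
  by rewrite le_eqVlt; apply/orP; left; apply/eqP; field; rewrite gt_eqF.
have hx := sqr_ln_le x0 m0; have hy := sqr_ln_le y0 m0.
have h2 := ln2_ge; have d0 := sqr_ge0 (x - y).
have xm : 0 < x + m by rewrite ltr_wpDl.
have ym : 0 < y + m by rewrite ltr_wpDl.
apply: (@le_trans _ _ (5 / 8 * (x - y) ^+ 2)); last by rewrite ler_wpM2r.
rewrite -/M.
have : (x ^+ 2 * ((x - m) / m + 2 * (x - m) / (x + m)) +
        y ^+ 2 * ((y - m) / m + 2 * (y - m) / (y + m))) / 2 + (m ^+ 2 - M)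
       <= 5 / 8 * (x - y) ^+ 2.
  rewrite -subr_ge0.
  (* The slack is of fourth order in x - y: 5/8 is exactly the second-order coefficient of the left
     side at x = y, the least constant that these bounds allow. *)
  rewrite (_ : _ - _ = (x - y) ^+ 4 / (32 * (x + m) * (y + m))).
    by rewrite divr_ge0 ?exprn_even_ge0// ltW// !mulr_gt0.
  by rewrite /M /m; field; rewrite /m in xm ym m0; rewrite !gt_eqF//; lra.
by move: hx hy hM; rewrite /M; lra.
Qed.

(** The squared reverse triangle inequality. It reduces to Cauchy-Schwarz in the plane, whose defect
    is a square by Lagrange's identity. *)
Lemma abs2_subr_ge (z w : R[i]) :
  (Num.sqrt (abs2 z) - Num.sqrt (abs2 w)) ^+ 2 <= abs2 (z - w).
Proof.
have hz := abs2_ge0 z; have hw := abs2_ge0 w.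
rewrite sqrrB !sqr_sqrtr// -sqrtrM//.
have h : complex.Re z * complex.Re w + complex.Im z * complex.Im w <=
    Num.sqrt (abs2 z * abs2 w).
  apply: le_trans (ler_norm _) _; rewrite -sqrtr_sqr ler_wsqrtr//.
  rewrite -subr_ge0 (_ : _ - _ =
    (complex.Re z * complex.Im w - complex.Im z * complex.Re w) ^+ 2).
    exact: sqr_ge0.
  by rewrite /abs2; ring.
have -> : abs2 (z - w) = abs2 z + abs2 w -
    (complex.Re z * complex.Re w + complex.Im z * complex.Im w) *+ 2.
  by case: z w {h hz hw} => a b [c d]; rewrite /abs2/=; ring.
by move: h; lra.
Qed.

End two_point_entropy.

(** * Vacuum expectations of functions of Psi_1 and the conclusion *)

Lemma of_Psi1E (R : realType) (g : @two_points R -> R[i]) :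
  of_Psi1 g = affine_Psi1 (mean g) (slope g).
Proof.
exact: (functional_calculusE (@bounded_Psi1 R) (@Psi1_selfadjoint R)
  (@Psi1_involutive R) g).
Qed.

Lemma dot_unit_orthogonal (R : realType) (H : innerType R) (u v : H) (a b : R[i]) :
  dot u u = 1 -> dot u v = 0 -> dot u (a *: u + b *: v) = a.
Proof. by move=> uu uv; rewrite dotDr !dotZr uu uv mulr1 mulr0 addr0. Qed.

Lemma vacuum_state_affine_Psi1 (R : realType) (a b : R[i]) :
  vacuum_state (affine_Psi1 a b) = a.
Proof. exact: (dot_unit_orthogonal a b (@dot_vacuum R) (@dot_vacuum_Psi1 R)). Qed.

Lemma vacuum_state_of_Psi1 (R : realType) (h : @two_points R -> R) :
  vacuum_state (of_Psi1 (fun x => (h x)%:C)) = ((h at_plus + h at_minus) / 2)%:C.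
Proof.
rewrite of_Psi1E vacuum_state_affine_Psi1 /mean -rmorphD.
by rewrite rmorphM/=; congr (_ * _); rewrite fmorphV rmorph_nat.
Qed.

Theorem proposition4p18 (R : realType) (K : hilbertType R)
    (iota : (fock R -> fock R) -> K) (hK : is_L2_completion iota)
    (f : [set (-1 : R); (1 : R)] -> R[i]) :
  vacuum_state (of_Psi1 (fun x => (abs2 (f x) * ln (abs2 (f x)))%:C))
    - vacuum_state (of_Psi1 (fun x => (abs2 (f x))%:C))
      * (ln (complex.Re (vacuum_state (of_Psi1 (fun x => (abs2 (f x))%:C)))))%:C
  <= (2 * ln 4 * L2_norm2 (derivative iota (iota (of_Psi1 f))))%:C.
Proof.
rewrite (vacuum_state_of_Psi1 (fun x => abs2 (f x) * ln (abs2 (f x)))).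
rewrite (vacuum_state_of_Psi1 (fun x => abs2 (f x))) [of_Psi1 f]of_Psi1E.
rewrite (L2_norm2_derivative hK) -rmorphM -rmorphB lecR /=.
have h1 := two_point_entropy_le (sqrtr_ge0 (abs2 (f at_plus)))
  (sqrtr_ge0 (abs2 (f at_minus))).
have h2 := abs2_subr_ge (f at_plus) (f at_minus).
rewrite !sqr_sqrtr ?abs2_ge0// in h1; apply: le_trans h1 _.
have -> : abs2 (slope f) = abs2 (f at_plus - f at_minus) / 4.
  rewrite /slope abs2M; congr (_ * _).
  have -> : (2^-1 : R[i]) = (2^-1 : R)%:C by rewrite fmorphV rmorph_nat.
  by rewrite /abs2/= expr0n addr0; field.
(* The 1/4 from the squared slope meets 2 ln 4 = 4 ln 2, which leaves the constant ln 2 of the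
   two-point inequality. *)
have -> : ln (4 : R) = ln 2 *+ 2 by rewrite -lnXn// -natrX.
have l2 : 0 <= ln (2 : R) by rewrite ln_ge0// ler1n.
apply: le_trans (ler_wpM2l l2 h2) _.
by rewrite le_eqVlt; apply/orP; left; apply/eqP; field.
Qed.
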